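(* Let $\lambda<0$ and let $B^{\lambda,br}$ be a Brownian bridge of length $1$ from $0$ to $\lambda$. Then its Vervaat transform $(V(B^{\lambda,br})_t;\ 0 \leq t \leq 1)$ is not a Markov process with respect to its induced (natural) filtration.
   Context: Vervaat transform: for continuous $f:[0,1]\to\mathbb{R}$ with $f(0)=0$, let $\tau(f)$ be the first time at which $f$ attains its minimum on $[0,1]$. Define $V(f)(t)=f(\tau(f)+t)-f(\tau(f))$ for $0\le t\le 1-\tau(f)$ and $V(f)(t)=f(\tau(f)+t-1)+f(1)-f(\tau(f))$ for $1-\tau(f)\le t\le 1$. Markov is meant in the possibly time-inhomogeneous sense. *)

(* Defs.v *)
From HB Require Import structures.
From mathcomp Require Import all_boot all_order all_algebra.
From mathcomp Require Import all_classical all_reals all_analysis.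

Set Implicit Arguments.
Unset Strict Implicit.
Unset Printing Implicit Defensive.

Import Order.TTheory GRing.Theory Num.Theory.
Import numFieldNormedType.Exports.

Local Open Scope classical_set_scope.
Local Open Scope ring_scope.

(** Processes with time set [0, 1] are represented by families indexed by all
    of [R]; every notion below only reads them at times in [0, 1]. *)

Section Vervaat.
Context {R : realType}.
Implicit Types f : R -> R.

Definition argmin01 f : set R :=
  [set t | 0 <= t <= 1 /\ forall s, 0 <= s <= 1 -> f t <= f s].

(* For continuous [f], [argmin01 f] is nonempty and compact, so that this
   infimum is a minimum. *)
Definition first_argmin f : R := inf (argmin01 f).

(* When f 0 = 0 the two branches agree at t = 1 - tau. *)
Definition vervaat f (t : R) : R :=
  let tau := first_argmin f in
  if t <= 1 - tau then f (tau + t) - f tau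
  else f (tau + t - 1) + f 1 - f tau.

End Vervaat.

Section BrownianBridge.
Context {R : realType}.

(* Transition density of Brownian motion; the second argument of [normal_pdf]
   is the standard deviation. *)
Definition bm_density (t x y : R) : R := normal_pdf x (Num.sqrt t) y.

(* For s < t1 < ... < tn < 1 and ts = [:: t1; ...; tn], with W a Brownian
   motion such that W_s = x, this is
   P(W_t1 \in A t1, ..., W_tn \in A tn, W_1 \in dlambda) / dlambda. *)
Fixpoint bm_fdd_to (lambda : R) (A : R -> set R) (s x : R) (ts : seq R) :
    \bar R :=
  if ts is t :: ts' then
    (\int[lebesgue_measure]_(y in A t)
       ((bm_density (t - s) x y)%:E * bm_fdd_to lambda A t y ts'))%E
  else (bm_density (1 - s) x lambda)%:E.

(* Continuous process whose finite-dimensional distributions are those of a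
   Brownian motion W started from 0 and conditioned on W_1 = lambda.  The
   initial value is prescribed on every path, so that every path lies in the
   domain of the Vervaat transform. *)
Record is_brownian_bridge d (T : measurableType d) (P : probability T R)
    (lambda : R) (B : R -> {RV P >-> R}) : Prop := {
  bridge_continuous :
    forall w, {within `[0, 1], continuous (fun t : R => B t w : R)} ;
  bridge_start : forall w, B 0 w = 0 ;
  bridge_end : {ae P, forall w, B 1 w = lambda} ;
  bridge_fdd : forall (ts : seq R) (A : R -> set R),
    path <%R 0 (rcons ts 1) ->
    (forall t, measurable (A t)) ->
    (P (\big[setI/setT]_(t <- ts) (B t @^-1` A t))
       * (bm_density 1 0 lambda)%:E = bm_fdd_to lambda A 0 0 ts)%E
}.

End BrownianBridge.

Section Markov.
Context {R : realType} d (T : measurableType d).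
Implicit Types (X : R -> T -> R) (G : set (set T)).

Definition sigma_rv (Y : T -> R) : set (set T) :=
  preimage_set_system setT Y measurable.

Definition natural_filtration X (s : R) : set (set T) :=
  <<s \bigcup_(u in `[0, s]) sigma_rv (X u) >>.

(* Y is a version of the conditional probability P(E | G). *)
Definition is_cond_prob (P : probability T R) G (E : set T) (Y : T -> R) :
    Prop :=
  [/\ sigma_rv Y `<=` G,
      P.-integrable setT (EFin \o Y) &
      forall F, G F -> (\int[P]_(w in F) (Y w)%:E = P (E `&` F))%E].

(* P(X_t \in A | F_s) = P(X_t \in A | sigma(X_s)) almost surely, expressed by
   the existence of a common version; the transition kernels may depend on both
   s and t. *)
Definition is_markov (P : probability T R) X : Prop :=
  forall (s t : R) (A : set R), 0 <= s -> s <= t -> t <= 1 -> measurable A ->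
  exists Y : T -> R,
    is_cond_prob P (sigma_rv (X s)) (X t @^-1` A) Y /\
    is_cond_prob P (natural_filtration X s) (X t @^-1` A) Y.

End Markov.

(* Main.v *)
From HB Require Import structures.
Require Import Defs.
From mathcomp Require Import all_boot all_order all_algebra.
From mathcomp Require Import all_classical all_reals all_analysis.
From mathcomp Require Import measurable_realfun ring lra zify.

Set Implicit Arguments.
Unset Strict Implicit.
Unset Printing Implicit Defensive.

Import Order.TTheory GRing.Theory Num.Theory.
Import numFieldNormedType.Exports.

Local Open Scope classical_set_scope.
Local Open Scope ring_scope.

(* Write mu(I) = P(V_s in I), nu(I) = P(V_s in I, V_t < 0), and let mu1, nu1 be
   the same masses on the event V_u < 0, for fixed u < s < t.  The path V is
   nonnegative until the splice point 1 - tau, where tau is the first argmin of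
   the bridge, and stays above lambda afterwards.  So V_u < 0 reveals that the
   splice has already occurred, whereas V_s in I leaves a chance that it only
   occurs after t' > t, in which case V_t >= 0.

   On a grid of mesh 1 / N the law of V is a sum over the position of the splice
   of products of Gaussian kernels.  Monotone likelihood ratios, which follow
   from the total positivity of these kernels, give, for I on the left of J and
   both far enough to the right,
     nu(J) mu1(I) <= theta nu1(I) mu(J),
     theta = (t / s) / (1 + (t' - s) eps),
   where eps bounds from below the chance of a late splice; theta < 1 when t is
   close to s.  The inequality passes to the limit of dyadic grids because the
   argmin is almost surely unique.

   If V were Markov, some Y depending only on V_s would satisfy
   E[Y; V_s in J] = nu(J) and E[Y; V_u < 0, V_s in J] = nu1(J).  The first
   equality and the inequality bound Y on the right of I by theta times the
   ratio rho(I) = nu1(I) / mu1(I); by the second one rho(J) <= theta rho(I) for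
   all I on the left of J.  Iterating along intervals increasing to a point b,
   nu vanishes on the right of b.  But nu(J) > 0 for every interval J: by
   Cameron-Martin shifts along polygonal paths, made on the grids with constants
   independent of the mesh, the bridge stays with positive probability in any
   tube around any of these paths. *)

(** * Iterated Gaussian kernels *)

(** A bridge is only known through its finite-dimensional laws, so every estimate is made on a grid,
    with constants free of the mesh. The numerator of theta arises as follows. The mass of the piece
    before [s] decreases when the splice is delayed, and is the same for all splices after [s]; it
    is then at most its average over the splices before [s]. Hence the splices between [s] and [t]
    add at most the proportion [(t - s) / s] to those before [s]. The denominator counts the splices
    between [s] and [t']. The time [t'] is kept apart from [t] because [eps] must be fixed before
    [t] approaches [s]. Since [Y] is determined only almost everywhere, intervals take the place of
    points, and a contraction iterated along them takes the place of a comparison of densities.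
    Shifts serve twice: they spread positive probability from one tube to the others, and they make
    events with nearly equal minima disjoint, which gives the uniqueness of the argmin. *)

Section lebesgue_invariance.
Context {R : realType}.
Local Notation mu := (@lebesgue_measure R).
Local Open Scope ereal_scope.

Let measurable_addr (c : R) :
  measurable_fun setT ((fun x => x + c)%R : measurableTypeR R -> measurableTypeR R).
Proof. exact: measurable_funD. Qed.

Let shift_mfun (c : R) : {mfun measurableTypeR R >-> measurableTypeR R} :=
  HB.pack (fun x : measurableTypeR R => (x + c)%R : measurableTypeR R)
    (isMeasurableFun.Build _ _ _ _ _ (measurable_addr c)).

Let lebesgue_measure_shift (c : R) (A : set R) : measurable A ->
  pushforward mu (shift_mfun c) A = mu A.
Proof.
move=> mA; apply/esym/lebesgue_measure_unique => //= _ [[a b]] _ <-.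
rewrite /pushforward.
have -> : shift_mfun c @^-1` `](a, b).1, (a, b).2]%classic = `](a - c)%R,
  (b - c)%R]%classic.
  by apply/seteqP; split => x; rewrite /preimage/= !in_itv/= ltrBlDr lerBrDr.
rewrite !lebesgue_measure_itv/= !lte_fin ltrD2r.
by case: ifP => // _; rewrite -!EFinD; congr EFin; lra.
Qed.

Lemma ge0_integral_shift (c : R) (f : R -> \bar R) :
  measurable_fun setT f -> (forall x, 0 <= f x) ->
  \int[mu]_x f (x + c)%R = \int[mu]_x f x.
Proof.
move=> mf f0.
transitivity (\int[pushforward mu (shift_mfun c)]_x f x).
  by rewrite ge0_integral_pushforward// preimage_setT.
by apply: eq_measure_integral => A mA _; exact: lebesgue_measure_shift.
Qed.

Lemma ge0_integral_opp (f : R -> \bar R) :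
  measurable_fun setT f -> (forall x, 0 <= f x) ->
  \int[mu]_x f (- x)%R = \int[mu]_x f x.
Proof.
move=> mf f0.
transitivity (\int[pushforward mu (-%R : _ -> measurableTypeR R)]_x f x).
  by rewrite ge0_integral_pushforward// preimage_setT.
by apply: eq_measure_integral => A mA _; exact: lebesgue_measureN.
Qed.

End lebesgue_invariance.

Lemma measurable_bm_densityl (R : realType) (h x : R) :
  measurable_fun setT (bm_density h x).
Proof. exact: measurable_normal_pdf. Qed.
#[global] Hint Resolve measurable_bm_densityl : core.

Section kernel.
Context {R : realType}.
Variable h : R.
Hypothesis h0 : 0 < h.
Local Notation mu := (@lebesgue_measure R).
Local Notation p := (bm_density h).

Let sh0 : Num.sqrt h != 0. Proof. by rewrite gt_eqF// sqrtr_gt0. Qed.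

Lemma bm_densityE x y : p x y =
  normal_peak (Num.sqrt h) * expR (- (y - x) ^+ 2 / (h *+ 2)).
Proof. by rewrite /bm_density normal_pdfE// /normal_fun sqr_sqrtr// ltW. Qed.

Local Opaque normal_pdf normal_peak expR.

Lemma bm_density_gt0 x y : 0 < p x y.
Proof. by rewrite bm_densityE mulr_gt0 ?expR_gt0// normal_peak_gt0. Qed.

Lemma bm_density_ge0 x y : 0 <= p x y.
Proof. exact/ltW/bm_density_gt0. Qed.

Lemma bm_density_ub x y : p x y <= normal_peak (Num.sqrt h).
Proof. exact: normal_pdf_ub. Qed.

Lemma bm_densityC x y : p x y = p y x.
Proof.
have -> := bm_densityE x y; have -> := bm_densityE y x.
by have -> : (y - x) ^+ 2 = (x - y) ^+ 2 by rewrite -[y - x]opprB sqrrN.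
Qed.

Lemma bm_density_shift c x y : p (x + c) (y + c) = p x y.
Proof.
have -> := bm_densityE (x + c) (y + c); have -> := bm_densityE x y.
by rewrite opprD addrACA subrr addr0.
Qed.

(** Once the squares are expanded, the exponents of the two sides differ by
    [(y - x) * (b - a) / h]. *)
Lemma bm_density_TP2 x y a b : x <= y -> a <= b ->
  p y a * p x b <= p x a * p y b.
Proof.
move=> xy ab.
have -> := bm_densityE x a; have -> := bm_densityE y a.
have -> := bm_densityE x b; have -> := bm_densityE y b.
rewrite mulrACA [leRHS]mulrACA -!expRD.
rewrite ler_wpM2l ?mulr_ge0 ?normal_peak_ge0// ler_expR -!mulrDl.
rewrite ler_wpM2r ?invr_ge0 ?mulrn_wge0 ?(ltW h0)//.
have : 0 <= (y - x) * (b - a) by rewrite mulr_ge0 ?subr_ge0.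
nra.
Qed.

(** Completing the square gives the one-step Cameron-Martin density for a drift of slope [s]. *)
Lemma bm_density_tilt s x y : p x (y - s * h) =
  p x y * expR (s * (y - x) - s ^+ 2 * h / 2).
Proof.
have -> := bm_densityE x (y - s * h); have -> := bm_densityE x y.
rewrite -[RHS]mulrA -expRD.
suff -> : - (y - s * h - x) ^+ 2 / (h *+ 2) =
  - (y - x) ^+ 2 / (h *+ 2) + (s * (y - x) - s ^+ 2 * h / 2) by [].
by field; rewrite gt_eqF.
Qed.

Lemma measurable_bm_density d (T : measurableType d) (f g : T -> R) :
  measurable_fun setT f -> measurable_fun setT g ->
  measurable_fun setT (fun t => p (f t) (g t)).
Proof.
move=> mf mg; under eq_fun do rewrite bm_densityE.
apply: measurable_funM => //; apply: measurableT_comp => //.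
apply: measurable_funM => //; apply: measurableT_comp => //.
by apply: measurable_funX; apply: measurable_funB.
Qed.

Lemma integral_bm_density x : (\int[mu]_y (p x y)%:E = 1)%E.
Proof. exact: integral_normal_pdf. Qed.

End kernel.

Section path_kernel.
Context {R : realType}.
Variable h : R.
Hypothesis h0 : 0 < h.
Local Notation mu := (@lebesgue_measure R).
Local Notation p := (bm_density h).
Implicit Types w : nat -> R -> R.

Let measurable_pw x (g : R -> R) : measurable_fun setT g ->
  measurable_fun [set: measurableTypeR R] (fun z => (p x z * g z)%:E).
Proof.
move=> mg; apply/measurable_EFinP.
exact: (@measurable_funM _ (measurableTypeR R) R setT (p x)
  g (measurable_bm_densityl _ _) mg).
Qed.

Let measurable_p x : measurable_fun [set: measurableTypeR R] (fun z => (p x z)%:E).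
Proof. by apply/measurable_EFinP; exact: (measurable_bm_densityl h x). Qed.

(** Unnormalised density of a walk with [n + 1] Gaussian steps and [n] weighted intermediate points.
    The weights keep their absolute indices [a], [a + 1], ..., so that cutting a path does not
    renumber them. Values in [\bar R] let Tonelli apply before finiteness is known. *)
Fixpoint pathQ (h : R) w (a n : nat) (x y : R) : \bar R :=
  if n is n'.+1 then
    (\int[mu]_z ((bm_density h x z * w a z)%:E * pathQ h w a.+1 n' z y))%E
  else (bm_density h x y)%:E.

Lemma pathQ_ge0 w a n x y : (forall i z, 0 <= w i z) -> (0 <= pathQ h w a n x y)%E.
Proof.
move=> w0; elim: n a x => [|n IH] a x /=; first by rewrite lee_fin bm_density_ge0.
by apply: integral_ge0 => z _; rewrite mule_ge0// lee_fin mulr_ge0// bm_density_ge0.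
Qed.

(** The weights may depend on the parameter because [tupI_moving] uses weights that depend on the
    cut coordinate. Each step of the induction adds the new intermediate point to the parameter
    space. *)
Lemma measurable_pathQ n d (T : measurableType d) (W : nat -> T * R -> R) a
    (f g : T -> R) :
  (forall i, measurable_fun setT (W i)) -> (forall i t, 0 <= W i t) ->
  measurable_fun setT f -> measurable_fun setT g ->
  measurable_fun setT (fun t => pathQ h (fun i z => W i (t, z)) a n (f t) (g t)).
Proof.
elim: n d T W a f g => [|n IH] d T W a f g mW W0 mf mg /=.
  by apply/measurable_EFinP; apply: measurable_bm_density.
apply: (measurable_fun_fubini_tonelli_F (m2 := mu) (fun u : T * R =>
   (bm_density h (f u.1) u.2 * W a (u.1, u.2))%:E *
   pathQ h (fun i z => W i (u.1, z)) a.+1 n u.2 (g u.1))%E).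
- apply: emeasurable_funM.
    apply/measurable_EFinP; apply: measurable_funM.
      by apply: measurable_bm_density => //; apply: measurableT_comp.
    by rewrite (_ : (fun u : T * R => W a (u.1, u.2)) = W a);
      [exact: mW|apply/funext => -[]].
  apply: (IH _ _ (fun i (v : (T * R) * R) => W i (v.1.1, v.2)) a.+1
     (fun u : T * R => u.2) (fun u : T * R => g u.1)) => //.
  + move=> i; apply: measurableT_comp => //.
    by apply: measurable_fun_pair => //; apply: measurableT_comp.
  + exact: measurable_snd.
  + exact: measurableT_comp.
- by move=> u /=; rewrite mule_ge0 ?pathQ_ge0// lee_fin mulr_ge0// bm_density_ge0.
Qed.

Lemma measurable_pathQ2 w a n d (T : measurableType d) (f g : T -> R) :
  (forall i, measurable_fun setT (w i)) -> (forall i t, 0 <= w i t) ->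
  measurable_fun setT f -> measurable_fun setT g ->
  measurable_fun setT (fun t => pathQ h w a n (f t) (g t)).
Proof.
move=> mw w0 mf mg.
apply: (@measurable_pathQ n _ T (fun i v => w i v.2)) => // i.
exact: measurableT_comp.
Qed.

(** With weights at most 1, every kernel but the last contributes at most its total mass 1, and the
    last is at most its peak; the bound is uniform in [n]. *)
Lemma pathQ_ub w a n x y : (forall i, measurable_fun setT (w i)) ->
  (forall i z, 0 <= w i z <= 1) ->
  (pathQ h w a n x y <= (normal_peak (Num.sqrt h))%:E)%E.
Proof.
move=> mw w01; have w0 i z : 0 <= w i z by case/andP: (w01 i z).
elim: n a x => [|n IH] a x /=; first by rewrite lee_fin bm_density_ub.
apply: (@le_trans _ _ (\int[mu]_z ((normal_peak (Num.sqrt h))%:E * (p x z)%:E))%E).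
  apply: ge0_le_integral => //.
  - by move=> z _; rewrite mule_ge0 ?pathQ_ge0// lee_fin mulr_ge0// bm_density_ge0.
  - apply: emeasurable_funM; last exact: measurable_pathQ2.
    exact: measurable_pw.
  - by apply: measurable_funeM; exact: measurable_p.
  - move=> z _; rewrite muleC; apply: lee_pmul => //.
    + exact: pathQ_ge0.
    + by rewrite lee_fin mulr_ge0// bm_density_ge0.
    + by rewrite lee_fin ler_piMr ?bm_density_ge0//; case/andP: (w01 a z).
rewrite ge0_integralZl_EFin ?normal_peak_ge0//.
- by rewrite integral_bm_density// mule1.
- by move=> z _; rewrite lee_fin bm_density_ge0.
Qed.

Lemma pathQ_fin w a n x y : (forall i, measurable_fun setT (w i)) ->
  (forall i z, 0 <= w i z <= 1) -> pathQ h w a n x y \is a fin_num.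
Proof.
move=> mw w01; rewrite ge0_fin_numE; first exact: le_lt_trans (pathQ_ub _ _ _ _ mw w01)
  (ltry _).
by apply: pathQ_ge0 => i z; case/andP: (w01 i z).
Qed.

Lemma pathQ_le w w' a n x y : (forall i, measurable_fun setT (w i)) ->
  (forall i, measurable_fun setT (w' i)) ->
  (forall i z, 0 <= w i z) -> (forall i z, 0 <= w' i z) ->
  (forall i z, (a <= i < a + n)%N -> w i z <= w' i z) ->
  (pathQ h w a n x y <= pathQ h w' a n x y)%E.
Proof.
move=> mw mw' w0 w'0; elim: n a x => [//|n IH] a x ww' /=.
apply: ge0_le_integral => //.
- by move=> z _; rewrite mule_ge0 ?pathQ_ge0// lee_fin mulr_ge0// bm_density_ge0.
- apply: emeasurable_funM; last exact: measurable_pathQ2.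
  exact: measurable_pw.
- apply: emeasurable_funM; last exact: measurable_pathQ2.
  exact: measurable_pw.
- move=> z _; apply: lee_pmul; rewrite ?pathQ_ge0//.
  + by rewrite lee_fin mulr_ge0// bm_density_ge0.
  + by rewrite lee_fin ler_wpM2l ?bm_density_ge0// ww'//; lia.
  + by apply: IH => i t ia; apply: ww'; lia.
Qed.

Lemma eq_pathQ w w' a b n x y :
  (forall i z, (i < n)%N -> w (a + i)%N z = w' (b + i)%N z) ->
  pathQ h w a n x y = pathQ h w' b n x y.
Proof.
elim: n a b x => [//|n IH] a b x ww' /=; apply: eq_integral => z _.
rewrite (IH _ b.+1)//; last by move=> i t ia; rewrite !addSnnS; exact: ww'.
by have := ww' 0%N z isT; rewrite !addn0 => ->.
Qed.

Lemma pathQ_eq0 w a n x y i : (a <= i < a + n)%N -> (forall z, w i z = 0) ->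
  pathQ h w a n x y = 0%E.
Proof.
elim: n a x => [|n IH] a x ia wi /=; first by lia.
apply: integral0_eq => z _; have [->|ai] := eqVneq a i.
  by rewrite wi mulr0 mul0e.
by rewrite IH ?mule0//; lia.
Qed.

(** Chapman-Kolmogorov equation, the point of index [a + n1] being singled out; the induction
    exchanges its integral with that over the first point. *)
Lemma pathQ_cat w a n1 n2 x y : (forall i, measurable_fun setT (w i)) ->
  (forall i z, 0 <= w i z) ->
  pathQ h w a (n1 + n2.+1) x y =
  (\int[mu]_z ((w (a + n1)%N z)%:E *
     (pathQ h w a n1 x z * pathQ h w (a + n1).+1 n2 z y)))%E.
Proof.
move=> mw w0; elim: n1 a x => [|n1 IH] a x.
  rewrite add0n addn0 /=; apply: eq_integral => z _.
  by rewrite EFinM -muleA [in LHS]muleC -muleA; congr (_ * _)%E; rewrite muleC.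
rewrite addSn /=.
transitivity (\int[mu]_z \int[mu]_z' ((p x z * w a z)%:E * ((w (a + n1.+1)%N z')%:E *
     (pathQ h w a.+1 n1 z z' * pathQ h w (a + n1.+1).+1 n2 z' y))))%E.
  apply: eq_integral => z _; rewrite IH addSnnS ge0_integralZl_EFin//.
  - by move=> z' _; rewrite !mule_ge0 ?lee_fin ?pathQ_ge0.
  - apply: emeasurable_funM.
      by apply/measurable_EFinP; exact: (mw (a + n1.+1)%N).
    by apply: emeasurable_funM; apply: measurable_pathQ2.
  - by rewrite mulr_ge0// bm_density_ge0.
rewrite (fubini_tonelli (m1 := mu) (m2 := mu)
  (fun u : R * R => ((p x u.1 * w a u.1)%:E * ((w (a + n1.+1)%N u.2)%:E *
     (pathQ h w a.+1 n1 u.1 u.2 * pathQ h w (a + n1.+1).+1 n2 u.2 y))))%E).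
- apply: eq_integral => z' _.
  transitivity (\int[mu]_z ((w (a + n1.+1)%N z')%:E * pathQ h w (a + n1.+1).+1 n2 z' y *
      ((p x z * w a z)%:E * pathQ h w a.+1 n1 z z')))%E.
    by apply: eq_integral => z _ /=; rewrite muleCA -!muleA; congr (_ * _)%E;
      rewrite muleA muleC.
  rewrite ge0_integralZl//.
  + by rewrite -muleA [(pathQ _ _ _ _ _ _ * _)%E]muleC.
  + apply: emeasurable_funM; last exact: measurable_pathQ2.
    exact: measurable_pw.
  + by move=> z _; rewrite mule_ge0 ?pathQ_ge0// lee_fin mulr_ge0// bm_density_ge0.
  + by rewrite mule_ge0 ?lee_fin ?pathQ_ge0.
- apply: emeasurable_funM.
    apply/measurable_EFinP; apply: measurable_funM.
      by apply: measurable_bm_density => //; apply: measurableT_comp.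
    exact: measurableT_comp.
  apply: emeasurable_funM.
    by apply/measurable_EFinP; apply: measurableT_comp.
  by apply: emeasurable_funM; apply: measurable_pathQ2.
- by move=> u /=; rewrite !mule_ge0 ?lee_fin ?pathQ_ge0// mulr_ge0 ?bm_density_ge0.
Qed.

Lemma pathQ_shift c w a n x y : (forall i, measurable_fun setT (w i)) ->
  (forall i z, 0 <= w i z) ->
  pathQ h (fun i z => w i (z - c)) a n x y = pathQ h w a n (x - c) (y - c).
Proof.
move=> mw w0; elim: n a x => [|n IH] a x /=; first by rewrite bm_density_shift.
rewrite -[RHS](ge0_integral_shift (- c)).
- by apply: eq_integral => z _; rewrite IH bm_density_shift.
- apply: emeasurable_funM; last exact: measurable_pathQ2.
  exact: measurable_pw.
- by move=> z; rewrite mule_ge0 ?pathQ_ge0// lee_fin mulr_ge0// bm_density_ge0.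
Qed.

End path_kernel.

(** * Monotone likelihood ratios *)

Section likelihood_ratio.
Context {R : realType}.
Local Notation mu := (@lebesgue_measure R).

(* [g / f] is nondecreasing, without division. *)
Definition ratio_ndecr (f g : R -> R) := forall x y, x <= y -> f y * g x <= f x * g y.

Lemma lr_refl f : ratio_ndecr f f.
Proof. by move=> x y _; rewrite mulrC. Qed.

Lemma lrM f g f' g' : (forall x, 0 <= f x) -> (forall x, 0 <= g x) ->
  (forall x, 0 <= f' x) -> (forall x, 0 <= g' x) ->
  ratio_ndecr f g -> ratio_ndecr f' g' -> ratio_ndecr (fun x => f x * f' x)
    (fun x => g x * g' x).
Proof.
move=> f0 g0 f'0 g'0 fg fg' x y xy; rewrite mulrACA [leRHS]mulrACA.
by rewrite ler_pM ?mulr_ge0 ?fg ?fg'.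
Qed.

(** A product of two integrals is a double integral, which may be symmetrised in its variables. The
    pointwise inequality is therefore asked only after adding the term with [a] and [b] exchanged,
    the form in which total positivity supplies it. *)
Lemma integralM_le (A1 B1 A2 B2 : R -> R) :
  measurable_fun setT A1 -> measurable_fun setT B1 ->
  measurable_fun setT A2 -> measurable_fun setT B2 ->
  (forall x, 0 <= A1 x) -> (forall x, 0 <= B1 x) ->
  (forall x, 0 <= A2 x) -> (forall x, 0 <= B2 x) ->
  (forall a b, A1 a * B1 b + A1 b * B1 a <= A2 a * B2 b + A2 b * B2 a) ->
  ((\int[mu]_a (A1 a)%:E) * (\int[mu]_a (B1 a)%:E) <=
   (\int[mu]_a (A2 a)%:E) * (\int[mu]_a (B2 a)%:E))%E.
Proof.
move=> mA1 mB1 mA2 mB2 A10 B10 A20 B20 AB.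
have mprod (A B : R -> R) : measurable_fun setT A -> measurable_fun setT B ->
    measurable_fun setT (fun u : R * R => (A u.1 * B u.2)%:E).
  move=> mA mB; apply/measurable_EFinP.
  by apply: measurable_funM; apply: measurableT_comp.
have mEA (A : R -> R) : measurable_fun setT A ->
    measurable_fun [set: measurableTypeR R] (fun u => (A u)%:E).
  by move=> mA; apply/measurable_EFinP; exact: mA.
have int2 (A B : R -> R) : measurable_fun setT A -> measurable_fun setT B ->
    (forall x, 0 <= A x) -> (forall x, 0 <= B x) ->
    ((\int[mu]_a (A a)%:E) * (\int[mu]_a (B a)%:E) =
    \int[mu \x mu]_u (A u.1 * B u.2)%:E)%E.
  move=> mA mB A0 B0.
  rewrite (fubini_tonelli1 (m1 := mu) (m2 := mu) (fun u => (A u.1 * B u.2)%:E)) //=.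
  - rewrite -ge0_integralZr//; last 3 first.
    + exact: mEA.
    + by move=> x _; rewrite lee_fin.
    + by apply: integral_ge0 => x _; rewrite lee_fin.
    apply: eq_integral => a _; rewrite /fubini_F /=.
    under [RHS]eq_integral do rewrite EFinM.
    rewrite ge0_integralZl_EFin//.
    + by move=> x _; rewrite lee_fin.
    + exact: mEA.
  - exact: mprod.
  - by move=> u; rewrite lee_fin mulr_ge0.
have int2' (A B : R -> R) : measurable_fun setT A -> measurable_fun setT B ->
    (forall x, 0 <= A x) -> (forall x, 0 <= B x) ->
    ((\int[mu]_a (A a)%:E) * (\int[mu]_a (B a)%:E) =
    \int[mu \x mu]_u (A u.2 * B u.1)%:E)%E.
  move=> mA mB A0 B0; rewrite muleC int2//; apply: eq_integral => u _.
  by rewrite mulrC.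
have double (A B : R -> R) : measurable_fun setT A -> measurable_fun setT B ->
    (forall x, 0 <= A x) -> (forall x, 0 <= B x) ->
    (2%:E * ((\int[mu]_a (A a)%:E) * (\int[mu]_a (B a)%:E)) =
    \int[mu \x mu]_u (A u.1 * B u.2 + A u.2 * B u.1)%:E)%E.
  move=> mA mB A0 B0.
  under [RHS]eq_integral do rewrite EFinD.
  rewrite ge0_integralD//.
  - rewrite -int2// -int2'//.
    by rewrite (_ : 2 = 1 + 1)// EFinD ge0_muleDl// mul1e.
  - by move=> u _; rewrite lee_fin mulr_ge0.
  - exact: mprod.
  - by move=> u _; rewrite lee_fin mulr_ge0.
  - by under eq_fun do rewrite mulrC; exact: mprod.
rewrite -(@lee_pmul2l _ 2%:E)// ?lte_fin//.
rewrite !double//; apply: ge0_le_integral => //.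
- by move=> u _; rewrite lee_fin addr_ge0 ?mulr_ge0.
- apply/measurable_EFinP/measurable_funD; apply/measurable_EFinP; first exact: mprod.
  by under eq_fun do rewrite mulrC; exact: mprod.
- apply/measurable_EFinP/measurable_funD; apply/measurable_EFinP; first exact: mprod.
  by under eq_fun do rewrite mulrC; exact: mprod.
- by move=> u _; rewrite lee_fin.
Qed.

End likelihood_ratio.

Section path_density.
Context {R : realType}.
Variable h : R.
Hypothesis h0 : 0 < h.
Local Notation mu := (@lebesgue_measure R).
Local Notation p := (bm_density h).

Definition weights (w : nat -> R -> R) :=
  (forall i, measurable_fun setT (w i)) /\ (forall i z, 0 <= w i z <= 1).

Definition pathq (h : R) w a n x y : R := fine (pathQ h w a n x y).

Implicit Types w : nat -> R -> R.

Lemma weights_ge0 w : weights w -> forall i z, 0 <= w i z.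
Proof. by case=> _ w01 i z; case/andP: (w01 i z). Qed.

Lemma pathqE w a n x y : weights w -> (pathq h w a n x y)%:E = pathQ h w a n x y.
Proof. by case=> mw w01; rewrite /pathq fineK// pathQ_fin. Qed.

Lemma pathq_ge0 w a n x y : weights w -> 0 <= pathq h w a n x y.
Proof. by move=> ww; rewrite fine_ge0// pathQ_ge0//; exact: weights_ge0. Qed.

Lemma measurable_pathql w a n y : weights w ->
  measurable_fun setT (fun x => pathq h w a n x y).
Proof.
move=> ww; apply/measurable_EFinP; rewrite /comp /=.
under eq_fun do rewrite pathqE//.
by apply: measurable_pathQ2 => //; [exact: ww.1|exact: weights_ge0].
Qed.

Lemma measurable_pathqr w a n x : weights w ->
  measurable_fun setT (fun y => pathq h w a n x y).
Proof.
move=> ww; apply/measurable_EFinP; rewrite /comp /=.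
under eq_fun do rewrite pathqE//.
by apply: measurable_pathQ2 => //; [exact: ww.1|exact: weights_ge0].
Qed.

(** Basic composition formula: the symmetrised integrands differ by [(p x a * p y b - p y a * p x b)
    * (f a * g b - f b * g a)], and both factors are nonnegative for [a <= b] and nonpositive for
    [b <= a]. *)
Lemma lr_step (f g : R -> R) (F G : R -> R) :
  measurable_fun setT f -> measurable_fun setT g ->
  (forall x, 0 <= f x) -> (forall x, 0 <= g x) -> ratio_ndecr f g ->
  (forall x, (F x)%:E = \int[mu]_z (p x z * f z)%:E)%E ->
  (forall x, (G x)%:E = \int[mu]_z (p x z * g z)%:E)%E -> ratio_ndecr F G.
Proof.
move=> mf mg f0 g0 fg FE GE x y xy; rewrite -lee_fin !EFinM !FE !GE.
have mpf (k : R -> R) x' : measurable_fun setT k ->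
  measurable_fun setT (fun z => p x' z * k z).
  by move=> mk; exact: (@measurable_funM _ _ R setT (p x') k (measurable_bm_densityl _ _)
    mk).
apply: integralM_le; (try exact: mpf);
  try by move=> z; rewrite mulr_ge0// bm_density_ge0.
move=> a b.
have -> : p y a * f a * (p x b * g b) + p y b * f b * (p x a * g a) =
  (p y a * p x b) * (f a * g b) + (p y b * p x a) * (f b * g a) by ring.
have -> : p x a * f a * (p y b * g b) + p x b * f b * (p y a * g a) =
  (p x a * p y b) * (f a * g b) + (p x b * p y a) * (f b * g a) by ring.
have [ab|/ltW ba] := leP a b.
  have := bm_density_TP2 h0 xy ab; have := fg _ _ ab.
  by nra.
have := bm_density_TP2 h0 xy ba; have := fg _ _ ba.
by nra.
Qed.

(** One [lr_step] per weighted point, starting from the last kernel, which both sides share. *)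
Lemma lr_pathql w w' a n y : weights w -> weights w' ->
  (forall i, (a <= i < a + n)%N -> ratio_ndecr (w i) (w' i)) ->
  ratio_ndecr (fun x => pathq h w a n x y) (fun x => pathq h w' a n x y).
Proof.
move=> ww ww'; elim: n a => [|n IH] a lrw; first exact: lr_refl.
have E v (wv : weights v) x : ((pathq h v a n.+1 x y)%:E =
    \int[mu]_z (p x z * (v a z * pathq h v a.+1 n z y))%:E)%E.
  rewrite pathqE//=; apply: eq_integral => z _.
  by rewrite -pathqE// -EFinM mulrA.
apply: (lr_step _ _ _ _ _ (E _ ww) (E _ ww')).
- by apply: measurable_funM; [exact: ww.1|exact: measurable_pathql].
- by apply: measurable_funM; [exact: ww'.1|exact: measurable_pathql].
- by move=> x; rewrite mulr_ge0 ?pathq_ge0 ?weights_ge0.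
- by move=> x; rewrite mulr_ge0 ?pathq_ge0 ?weights_ge0.
- apply: lrM.
  + exact: weights_ge0.
  + exact: weights_ge0.
  + by move=> x; rewrite pathq_ge0.
  + by move=> x; rewrite pathq_ge0.
  + by apply: lrw; lia.
  + by apply: IH => i ia; apply: lrw; lia.
Qed.

(** The last kernel is peeled off with [pathQ_cat]; its symmetry puts the integral in the form
    required by [lr_step]. *)
Lemma lr_pathqr w w' a n x : weights w -> weights w' ->
  (forall i, (a <= i < a + n)%N -> ratio_ndecr (w i) (w' i)) ->
  ratio_ndecr (pathq h w a n x) (pathq h w' a n x).
Proof.
move=> ww ww'; elim: n => [|n IH] lrw; first exact: lr_refl.
have E v (wv : weights v) y : ((pathq h v a n.+1 x y)%:E =
    \int[mu]_z (p y z * (v (a + n)%N z * pathq h v a n x z))%:E)%E.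
  rewrite pathqE// -addn1 pathQ_cat//; [|exact: wv.1|exact: weights_ge0].
  apply: eq_integral => z _.
  by rewrite /= -pathqE// -!EFinM bm_densityC//; congr EFin; ring.
apply: (lr_step _ _ _ _ _ (E _ ww) (E _ ww')).
- by apply: measurable_funM; [exact: ww.1|exact: measurable_pathqr].
- by apply: measurable_funM; [exact: ww'.1|exact: measurable_pathqr].
- by move=> z; rewrite mulr_ge0 ?pathq_ge0 ?weights_ge0.
- by move=> z; rewrite mulr_ge0 ?pathq_ge0 ?weights_ge0.
- apply: lrM.
  + exact: weights_ge0.
  + exact: weights_ge0.
  + by move=> z; rewrite pathq_ge0.
  + by move=> z; rewrite pathq_ge0.
  + by apply: lrw; lia.
  + by apply: IH => i ia; apply: lrw; lia.
Qed.

End path_density.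

(** * Integration over grid paths *)

Section tuple_integral.
Context {R : realType}.
Local Notation mu := (@lebesgue_measure R).
Local Open Scope ereal_scope.

(** Integration against the unnormalised law of the interior grid values of a bridge from [x] to
    [lam]. The integrand is arbitrary, whereas [pathQ] only integrates products of one-point
    weights. *)
Fixpoint tupI (h lam : R) n (x : R) : (n.-tuple R -> \bar R) -> \bar R :=
  match n return (n.-tuple R -> \bar R) -> \bar R with
  | 0%N => fun F => (bm_density h x lam)%:E * F [tuple]
  | n'.+1 => fun F => \int[mu]_z
      ((bm_density h x z)%:E * tupI h lam z (fun t => F [tuple of z :: t]))
  end.

Variables (h lam : R).
Hypothesis h0 : (0 < h)%R.
Local Notation p := (bm_density h).

Lemma tupI_ge0 n x (F : n.-tuple R -> \bar R) : (forall t, 0 <= F t) ->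
  0 <= tupI h lam x F.
Proof.
elim: n x F => [|n IH] x F F0 /=; first by rewrite mule_ge0// lee_fin bm_density_ge0.
apply: integral_ge0 => z _; rewrite mule_ge0 ?lee_fin ?bm_density_ge0//.
by apply: IH => t.
Qed.

Lemma eq_tupI n x (F G : n.-tuple R -> \bar R) : F =1 G ->
  tupI h lam x F = tupI h lam x G.
Proof. by move=> FG; congr tupI; exact/funext. Qed.

Lemma measurable_tupI n d (T : measurableType d) (F : T * n.-tuple R -> \bar R)
    (f : T -> R) :
  measurable_fun setT F -> (forall u, 0 <= F u) -> measurable_fun setT f ->
  measurable_fun setT (fun t => tupI h lam (f t) (fun s => F (t, s))).
Proof.
elim: n d T F f => [|n IH] d T F f mF F0 mf /=.
  apply: emeasurable_funM.
    by apply/measurable_EFinP; apply: (measurable_bm_density h0 mf).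
  apply: (measurableT_comp mF).
  exact: measurable_fun_pair.
apply: (measurable_fun_fubini_tonelli_F (m2 := mu) (fun u : T * R =>
   (bm_density h (f u.1) u.2)%:E *
   tupI h lam u.2 (fun s => F (u.1, [tuple of u.2 :: s])))).
- apply: emeasurable_funM.
    apply/measurable_EFinP.
    by apply: measurable_bm_density => //; apply: measurableT_comp.
  apply: (IH _ _ (fun v : (T * R) * n.-tuple R => F (v.1.1, [tuple of v.1.2 :: v.2]))
     (fun u : T * R => u.2)) => //.
  + apply: (measurableT_comp mF); apply: measurable_fun_pair.
      exact: measurableT_comp.
    apply: measurable_cons => //; exact: measurableT_comp.
  + exact: measurable_snd.
- by move=> u /=; rewrite mule_ge0 ?tupI_ge0// lee_fin bm_density_ge0.
Qed.

Lemma measurable_tupI_cons n (F : n.+1.-tuple R -> \bar R) :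
  measurable_fun setT F -> (forall u, 0 <= F u) ->
  measurable_fun [set: measurableTypeR R]
    (fun z => tupI h lam z (fun t => F [tuple of z :: t])).
Proof.
move=> mF F0.
apply: (@measurable_tupI n _ R (fun v => F [tuple of v.1 :: v.2]) id) => //.
by apply: (measurableT_comp mF); apply: measurable_cons.
Qed.

Lemma measurable_tupI_step n x (F : n.+1.-tuple R -> \bar R) :
  measurable_fun setT F -> (forall u, 0 <= F u) ->
  measurable_fun [set: measurableTypeR R]
    (fun z => (p x z)%:E * tupI h lam z (fun t => F [tuple of z :: t])).
Proof.
move=> mF F0; apply: emeasurable_funM; last exact: measurable_tupI_cons.
by apply/measurable_EFinP; exact: (measurable_bm_densityl h x).
Qed.

Lemma measurable_cons1 n z : measurable_fun setT (fun t : n.-tuple R => [tuple of z :: t]).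
Proof. exact: measurable_cons. Qed.

(** This makes [tup_measure] countably additive, so that laws of tuples can be identified as
    measures. *)
Lemma tupI_nneseries n x (F : nat -> n.-tuple R -> \bar R) :
  (forall k, measurable_fun setT (F k)) -> (forall k t, 0 <= F k t) ->
  tupI h lam x (fun t => \sum_(k <oo) F k t) = \sum_(k <oo) tupI h lam x (F k).
Proof.
elim: n x F => [|n IH] x F mF F0 /=.
  by rewrite nneseriesZl// => k _.
rewrite -integral_nneseries//.
- apply: eq_integral => z _; rewrite IH ?nneseriesZl//.
  + by move=> k _; exact: tupI_ge0.
  + by move=> k; apply: (measurableT_comp (mF k)); exact: measurable_cons1.
- by move=> k; exact: measurable_tupI_step.
- by move=> k z _; rewrite mule_ge0 ?lee_fin ?bm_density_ge0 ?tupI_ge0.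
Qed.

Lemma tupI_le n x (F G : n.-tuple R -> \bar R) :
  measurable_fun setT F -> measurable_fun setT G ->
  (forall t, 0 <= F t) -> (forall t, F t <= G t) ->
  tupI h lam x F <= tupI h lam x G.
Proof.
elim: n x F G => [|n IH] x F G mF mG F0 FG /=.
  by rewrite lee_wpmul2l// lee_fin bm_density_ge0.
have G0 t : 0 <= G t by exact: le_trans (FG t).
apply: ge0_le_integral => //.
- by move=> z _; rewrite mule_ge0 ?lee_fin ?bm_density_ge0 ?tupI_ge0.
- exact: measurable_tupI_step.
- exact: measurable_tupI_step.
- move=> z _; rewrite lee_wpmul2l ?lee_fin ?bm_density_ge0//.
  apply: IH => //; [apply: (measurableT_comp mF)|apply: (measurableT_comp mG)];
  exact: measurable_cons1.
Qed.

Lemma tupIZl n x c (F : n.-tuple R -> \bar R) : (0 <= c)%R ->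
  measurable_fun setT F -> (forall t, 0 <= F t) ->
  tupI h lam x (fun t => c%:E * F t) = c%:E * tupI h lam x F.
Proof.
move=> c0; elim: n x F => [|n IH] x F mF F0 /=; first by rewrite muleCA.
rewrite -ge0_integralZl_EFin//.
- apply: eq_integral => z _; rewrite IH//; first exact: muleCA.
  by apply: (measurableT_comp mF); exact: measurable_cons1.
- by move=> z _; rewrite mule_ge0 ?lee_fin ?bm_density_ge0 ?tupI_ge0.
- exact: measurable_tupI_step.
Qed.

Lemma measurable_dirac n (E : set (n.-tuple R)) : measurable E ->
  measurable_fun setT (fun t => \d_t E : \bar R).
Proof.
move=> mE; rewrite (_ : (fun _ => _) = EFin \o \1_E)//.
by apply/measurable_EFinP; exact: measurable_indic.
Qed.

Definition tup_measure n x (E : set (n.-tuple R)) := tupI h lam x (fun t => \d_t E).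

Let tup_measure0 n x : @tup_measure n x set0 = 0.
Proof.
rewrite /tup_measure; elim: n x => [|n IH] x /=; first by rewrite dirac0 mule0.
under eq_integral.
  move=> z _; rewrite (@eq_tupI _ _ _ (fun t => \d_t set0)).
    rewrite IH mule0; over.
  by move=> t; rewrite !dirac0.
by rewrite integral0.
Qed.

Let tup_measure_ge0 n x E : 0 <= @tup_measure n x E.
Proof. exact: tupI_ge0. Qed.

Let tup_measure_sigma_additive n x : semi_sigma_additive (@tup_measure n x).
Proof.
move=> F mF tF mUF.
rewrite [X in _ --> X](_ : _ = \sum_(i <oo) tup_measure x (F i)).
  by apply: is_cvg_ereal_nneg_natsum => k _; exact: tup_measure_ge0.
rewrite /tup_measure -tupI_nneseries//.
- by apply: eq_tupI => t; rewrite measure_semi_bigcup.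
- by move=> k; exact: measurable_dirac.
Qed.

Definition tuple_mass n x : {measure set (n.-tuple R) -> \bar R} :=
  HB.pack (@tup_measure n x) (isMeasure.Build _ _ _ (@tup_measure n x)
  (tup_measure0 n x) (tup_measure_ge0 x) (@tup_measure_sigma_additive n x)).

End tuple_integral.

Section tuple_law.
Context {R : realType}.
Local Notation mu := (@lebesgue_measure R).
Local Open Scope ereal_scope.

Definition rect a n (A : nat -> set R) : set (n.-tuple R) :=
  [set t | forall i, (i < n)%N -> A (a + i)%N (nth 0%R t i)].

Lemma measurable_nth n i : measurable_fun setT (fun t : n.-tuple R => nth 0%R t i).
Proof.
have [ilt|ige] := ltnP i n; last first.
  rewrite (_ : (fun t : n.-tuple R => _) = cst 0%R)//; apply/funext => t.
  by rewrite nth_default// size_tuple.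
rewrite (_ : (fun t : n.-tuple R => _) = (@tnth n R) ^~ (Ordinal ilt)).
  exact: measurable_tnth.
by apply/funext => t; rewrite (tnth_nth 0%R).
Qed.

Lemma measurable_rect a n A : (forall i, measurable (A i)) -> measurable (@rect a n A).
Proof.
move=> mA.
rewrite (_ : rect _ _ = \bigcap_(i in [set i | (i < n)%N])
    (fun t : n.-tuple R => nth 0%R t i) @^-1` A (a + i)%N).
  by apply: bigcap_measurableType => i _; rewrite -[X in measurable X]setTI;
    exact: measurable_nth.
by apply/seteqP; split.
Qed.

Lemma dirac_cons_rect a n A z (t : n.-tuple R) :
  \d_[tuple of z :: t] (@rect a n.+1 A) = ((\1_(A a) z : R)%:E * \d_t (@rect a.+1 n A))%E.
Proof.
rewrite !diracE !indicE -EFinM; congr EFin; rewrite -natrM mulnb; congr (nat_of_bool _)%:R.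
apply/idP/idP.
  move=> /set_mem zt; rewrite !mem_set//=.
    by move=> i ilt; rewrite addSnnS; exact: (zt i.+1 ilt).
  by have := zt 0%N isT; rewrite addn0.
move=> /andP[/set_mem Az /set_mem At]; apply/mem_set => -[|i] ilt /=.
  by rewrite addn0.
by rewrite -addSnnS; exact: At.
Qed.

Lemma tupI_rect h lam a n A x : (0 < h)%R -> (forall i, measurable (A i)) ->
  tupI h lam x (fun t => \d_t (@rect a n A)) = pathQ h (fun i => \1_(A i)) a n x lam.
Proof.
move=> h0 mA; elim: n a x => [|n IH] a x /=.
  by rewrite diracE mem_set ?mule1.
apply: eq_integral => z _.
under eq_tupI do rewrite dirac_cons_rect.
rewrite tupIZl//.
- by rewrite IH EFinM muleA.
- by apply: measurable_dirac; exact: measurable_rect.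
Qed.

Lemma sub_measurable_rect a n : @measurable _ (n.-tuple R) `<=`
  <<s [set X | exists2 A : nat -> set R, (forall i, measurable (A i)) & X = rect a A] >>.
Proof.
apply: smallest_sub; first exact: smallest_sigma_algebra.
case: n => [|n] X; first by rewrite big_ord0.
rewrite -bigcup_mkord_ord => -[i /= iltn [B mB <-]].
apply: sub_sigma_algebra; exists (fun j => if j == (a + i)%N then B else setT).
  by move=> j; case: ifP.
rewrite setTI; apply/seteqP; split => [t /= tB j jlt|t].
  case: eqP => // /addnI ->; move: tB.
  by rewrite (tnth_nth 0%R) inordK.
move=> /(_ i iltn) /=; rewrite eqxx.
by rewrite /preimage/= (tnth_nth 0%R) inordK.
Qed.

Lemma measure_tuple_unique n (m1 m2 : {measure set (n.-tuple R) -> \bar R}) a :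
  (forall A, (forall i, measurable (A i)) -> m1 (@rect a n A) = m2 (@rect a n A)) ->
  m1 setT < +oo -> forall E, measurable E -> m1 E = m2 E.
Proof.
move=> m12 m1T E mE.
pose G : set (set (n.-tuple R)) :=
  [set X | exists2 A : nat -> set R, (forall i, measurable (A i)) & X = rect a A].
have GT : G setT.
  exists (fun=> setT) => //; apply/seteqP; split => // t _ i _ //.
have Gm : G `<=` measurable by move=> _ [A mA ->]; exact: measurable_rect.
apply: (@g_sigma_algebra_measure_unique _ R _ G Gm (fun=> setT)) => //.
- by rewrite bigcup_const//; exists 0%N.
- move=> _ _ [A mA ->] [B mB ->]; exists (fun i => A i `&` B i).
    by move=> i; exact: measurableI.
  apply/seteqP; split => [t [tA tB] i ilt|t tAB]; first by split; [exact: tA|exact: tB].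
  by split => i ilt; have [] := tAB i ilt.
- by move=> _ [A mA ->]; exact: m12.
- exact: sub_measurable_rect.
Qed.

(** The law is prescribed on rectangles, but the events that locate an argmin are not rectangles;
    uniqueness of measures fills the gap. The constant [c] stands for the density of the end value,
    by which [bridge_fdd] is normalised. *)
Lemma tuple_lawE h lam d (T : measurableType d) (P : probability T R)
    (c : R) n a x (b : T -> n.-tuple R) : (0 < h)%R -> (0 <= c)%R ->
  measurable_fun setT b ->
  (forall A, (forall i, measurable (A i)) ->
    c%:E * P (b @^-1` (rect a A)) = pathQ h (fun i => \1_(A i)) a n x lam) ->
  forall E, measurable E -> c%:E * P (b @^-1` E) = tupI h lam x (fun t => \d_t E).
Proof.
move=> h0 c0 mb rectE E mE.
pose b' : {RV P >-> n.-tuple R} := HB.pack b (isMeasurableFun.Build _ _ _ _ _ mb).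
pose m1 : {measure set (n.-tuple R) -> \bar R} := mscale (NngNum c0) (distribution P b').
suff : m1 E = @tuple_mass R h lam h0 n x E by [].
apply: (@measure_tuple_unique n m1 (@tuple_mass R h lam h0 n x) a) => //.
- move=> A mA; have H := tupI_rect lam a n x h0 mA.
  transitivity (tupI h lam x (fun t => \d_t (@rect a n A))); last by [].
  by rewrite H -rectE.
- by rewrite /m1 /= /mscale/= probability_setT mule1 ltry.
Qed.

End tuple_law.

(** * Shifts and disintegration of integrals over grid paths *)

Section tilt.
Context {R : realType}.
Local Notation mu := (@lebesgue_measure R).
Variables (h lam : R).
Hypothesis h0 : 0 < h.
Local Notation p := (bm_density h).

Definition tshift (psi : nat -> R) a n (t : n.-tuple R) : n.-tuple R :=
  [tuple tnth t i + psi (a + i)%N | i < n].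

Lemma tshift_cons psi a n z (t : n.-tuple R) :
  tshift psi a [tuple of z :: t] = [tuple of (z + psi a) :: tshift psi a.+1 t].
Proof.
apply: eq_from_tnth => i; rewrite tnth_mktuple.
have [j ->|->] := unliftP ord0 i.
  by rewrite !tnthS tnth_mktuple addSnnS.
by rewrite !tnth0 addn0.
Qed.

Lemma measurable_tshift psi a n : measurable_fun setT (@tshift psi a n).
Proof.
apply/measurable_fun_tnthP => i.
rewrite (_ : _ \o _ = fun t => tnth t i + psi (a + i)%N); last first.
  by apply/funext => t /=; rewrite tnth_mktuple.
by apply: measurable_funD => //; exact: measurable_tnth.
Qed.

(* The exponent of the Cameron-Martin density for a shift with slope [s i] on
   the [i]-th grid interval, for a path through [x], the entries of [l] and
   [lam]. *)
Fixpoint tilt_exponent (s : nat -> R) b x (l : seq R) : R :=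
  if l is z :: l' then
    s b * (z - x) - s b ^+ 2 * h / 2 + tilt_exponent s b.+1 z l'
  else s b * (lam - x) - s b ^+ 2 * h / 2.

Lemma measurable_tilt_exponent s n b d (T : measurableType d) (f : T -> R)
    (g : T -> n.-tuple R) : measurable_fun setT f -> measurable_fun setT g ->
  measurable_fun setT (fun u => tilt_exponent s b (f u) (g u)).
Proof.
elim: n b f g => [|n IH] b f g mf mg.
  rewrite (_ : (fun _ => _) = fun u => s b * (lam - f u) - s b ^+ 2 * h / 2).
    apply: measurable_funB => //; apply: measurable_funM => //.
    exact: measurable_funB.
  by apply/funext => u; rewrite (tuple0 (g u)).
rewrite (_ : (fun _ => _) = fun u => s b * (tnth (g u) ord0 - f u) - s b ^+ 2 * h / 2
   + tilt_exponent s b.+1 (tnth (g u) ord0) [tuple of behead (g u)]).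
  have mg0 : measurable_fun setT (fun u => tnth (g u) ord0).
    by apply: (measurableT_comp (measurable_tnth ord0) mg).
  apply: measurable_funD.
    by apply: measurable_funB => //; apply: measurable_funM => //; apply: measurable_funB.
  apply: IH => //.
  exact: (measurableT_comp (@measurable_behead _ _ n) mg).
by apply/funext => u; rewrite [in LHS](tuple_eta (g u)).
Qed.

(** Discrete Cameron-Martin formula. The coordinates are translated one after the other, and
    [bm_density_tilt] turns each translated kernel into the original one times an exponential. The
    end value remains [lam] because [psi] vanishes at the last index. *)
Lemma tupI_tilt (psi : nat -> R) n b x (F : n.-tuple R -> \bar R) :
  measurable_fun setT F -> (forall t, 0 <= F t)%E -> psi (b + n).+1 = 0 ->
  let s i := (psi i.+1 - psi i) / h in
  tupI h lam x (fun t => F (tshift psi b.+1 t)) =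
  tupI h lam (x + psi b)
    (fun t => ((expR (tilt_exponent s b (x + psi b) t))%:E * F t)%E).
Proof.
move=> + + + s; have sh i : psi i.+1 = psi i + s i * h.
  by rewrite /s divfK ?gt_eqF// addrC subrK.
elim: n b x F => [|n IH] b x F mF F0 psi0 /=.
  rewrite tuple0 muleA -EFinM; congr ((_)%:E * _)%E.
  rewrite -bm_density_tilt// -(bm_density_shift h0 (psi b) x lam).
  by congr bm_density; move: (sh b); rewrite addn0 in psi0; rewrite psi0; lra.
pose K z := (((p (x + psi b) z) * expR (s b * (z - (x + psi b)) - s b ^+ 2 * h / 2))%:E *
  tupI h lam z (fun t : n.-tuple R => (expR (tilt_exponent s b.+1 z t))%:E * F [tuple of z :: t]))%E.
have mE z : measurable_fun setT (fun t : n.-tuple R =>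
    ((expR (tilt_exponent s b.+1 z t))%:E * F [tuple of z :: t])%E).
  apply: emeasurable_funM.
    apply/measurable_EFinP; apply: measurableT_comp => //.
    exact: measurable_tilt_exponent.
  by apply: (measurableT_comp mF); exact: measurable_cons1.
have mK : measurable_fun [set: measurableTypeR R] K.
  apply: emeasurable_funM.
    apply/measurable_EFinP; apply: measurable_funM.
      exact: (measurable_bm_densityl h).
    apply: measurableT_comp => //; apply: measurable_funB => //.
    by apply: measurable_funM => //; apply: measurable_funB.
  apply: (@measurable_tupI R h lam h0 n _ R (fun v => ((expR (tilt_exponent s b.+1 v.1 v.2))%:E * F [tuple of v.1 :: v.2])%E) id) => //.
    apply: emeasurable_funM.
      apply/measurable_EFinP; apply: measurableT_comp => //.
      exact: measurable_tilt_exponent.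
    by apply: (measurableT_comp mF); apply: measurable_cons.
  by move=> u; rewrite mule_ge0// lee_fin expR_ge0.
have K0 z : (0 <= K z)%E.
  rewrite mule_ge0 ?lee_fin ?mulr_ge0 ?bm_density_ge0 ?expR_ge0//.
  by apply: tupI_ge0 => // t; rewrite mule_ge0// lee_fin expR_ge0.
transitivity (\int[mu]_z K (z + psi b.+1)%R)%E.
  apply: eq_integral => z _; rewrite /K -bm_density_tilt//.
  have -> : z + psi b.+1 - s b * h = z + psi b by rewrite sh; ring.
  rewrite bm_density_shift//.
  under eq_tupI do rewrite tshift_cons.
  rewrite (IH b.+1 z (fun t => F [tuple of z + psi b.+1 :: t]))//.
  - by apply: (measurableT_comp mF); exact: measurable_cons1.
  - by rewrite -psi0 -addSnnS.
apply: (etrans (@ge0_integral_shift R (psi b.+1) K mK K0)); apply: eq_integral => z _.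
rewrite /K EFinM -muleA; congr (_ * _)%E; rewrite -tupIZl ?expR_ge0//; last first.
  by move=> t; rewrite mule_ge0// lee_fin expR_ge0.
by apply: eq_tupI => t /=; rewrite muleA -EFinM -expRD.
Qed.

Lemma tilt_exponent_const s c b x l : (forall j, (b <= j)%N -> s j = c) ->
  tilt_exponent s b x l = c * (lam - x) - (size l).+1%:R * (c ^+ 2 * h / 2).
Proof.
elim: l b x => [|z l IH] b x sc /=; rewrite (sc b)//; first by rewrite mul1r.
rewrite IH; first by rewrite -[in RHS]addn1 natrD; lra.
by move=> j bj; apply: sc; lia.
Qed.

(** On each stretch of constant slope the increments telescope, so the path enters only through its
    value at the kink. *)
Lemma tilt_exponent2 s c c' b k x l : (k < size l)%N ->
  (forall j, (b <= j <= b + k)%N -> s j = c) ->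
  (forall j, (b + k < j)%N -> s j = c') ->
  tilt_exponent s b x l = c * (nth 0 l k - x) + c' * (lam - nth 0 l k)
    - (k.+1%:R * c ^+ 2 + (size l - k)%:R * c' ^+ 2) * (h / 2).
Proof.
elim: l b k x => [//|z l IH] b k x /= ksize sc sc'.
rewrite (sc b); last by lia.
case: k => [|k] in ksize sc sc' *.
  rewrite (@tilt_exponent_const _ c'); last by move=> j bj; apply: sc'; lia.
  by rewrite subn0 /=; lra.
rewrite (IH _ k)//; last 2 first.
- by move=> j bj; apply: sc; lia.
- by move=> j bj; apply: sc'; lia.
by rewrite subSS -[in RHS](addn1 k.+1) natrD; lra.
Qed.

End tilt.

Section moving.
Context {R : realType}.
Local Notation mu := (@lebesgue_measure R).
Variables (h lam : R).
Hypothesis h0 : 0 < h.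
Local Notation p := (bm_density h).

Lemma tupI_prod (w : nat -> R -> R) a n x (c : R) : 0 <= c ->
  (forall i, measurable_fun setT (w i)) -> (forall i z, 0 <= w i z) ->
  tupI h lam x (fun t : n.-tuple R => (c * \prod_(i < n) w (a + i)%N (nth 0 t i))%:E) =
  (c%:E * pathQ h w a n x lam)%E.
Proof.
move=> + mw w0; elim: n a x c => [|n IH] a x c c0 /=.
  by rewrite big_ord0 mulr1 muleC.
rewrite -ge0_integralZl_EFin//.
- apply: eq_integral => z _.
  rewrite (_ : tupI h lam z _ = ((c * w a z)%:E * pathQ h w a.+1 n z lam)%E).
    by rewrite !muleA -!EFinM; congr (_%:E * _)%E; ring.
  rewrite -(IH a.+1 z (c * w a z)) ?mulr_ge0//; apply: eq_tupI => t.
  rewrite big_ord_recl/= addn0 mulrA; congr (_ * _)%:E.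
  by apply: eq_bigr => i _; rewrite /= addSnnS.
- by move=> z _; rewrite mule_ge0 ?pathQ_ge0// lee_fin mulr_ge0// bm_density_ge0.
- apply: emeasurable_funM; last exact: measurable_pathQ2.
  by apply/measurable_EFinP; apply: measurable_funM;
    [exact: measurable_bm_densityl|exact: mw].
Qed.

(* Disintegration with respect to the [k]-th coordinate, when the weight of
   every other coordinate is allowed to depend on that coordinate. *)
Lemma tupI_moving (G : nat -> R * R -> R) k m a x (g : R -> R) :
  (forall i, measurable_fun setT (G i)) -> (forall i u, 0 <= G i u) ->
  measurable_fun setT g -> (forall y, 0 <= g y) ->
  tupI h lam x (fun t : (k + m.+1).-tuple R => (g (nth 0 t k) *
    \prod_(i < k + m.+1) G (a + i)%N (nth 0 t k, nth 0 t i))%:E) =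
  (\int[mu]_y ((g y * G (a + k)%N (y, y))%:E *
    (pathQ h (fun i z => G i (y, z)) a k x y *
     pathQ h (fun i z => G i (y, z)) (a + k).+1 m y lam)))%E.
Proof.
move=> mG G0; elim: k a x g => [|k IH] a x g mg g0.
  transitivity (\int[mu]_y ((p x y)%:E * tupI h lam y (fun t : m.-tuple R =>
    (g y * \prod_(i < m.+1) G (a + i)%N (y, nth 0 (y :: t) i))%:E)))%E; first by [].
  apply: eq_integral => y _.
  rewrite (_ : tupI h lam y _ = ((g y * G a (y, y))%:E *
     pathQ h (fun i z => G i (y, z)) a.+1 m y lam)%E).
    by rewrite addn0 muleCA.
  rewrite -tupI_prod ?mulr_ge0//.
    apply: eq_tupI => t.
    rewrite big_ord_recl/= addn0 mulrA; congr (_ * _)%:E.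
    by apply: eq_bigr => i _; rewrite /= addSnnS.
  by move=> i; apply: (measurableT_comp (mG i)); exact: measurable_fun_pair.
pose W z y := ((g y * G a (y, z) * G (a + k.+1)%N (y, y))%:E *
    (pathQ h (fun i z => G i (y, z)) a.+1 k z y *
     pathQ h (fun i z => G i (y, z)) (a + k.+1).+1 m y lam))%E.
have mW : measurable_fun setT (fun u : R * R => W u.1 u.2).
  apply: emeasurable_funM.
    apply/measurable_EFinP; apply: measurable_funM; last first.
      apply: (measurableT_comp (mG _)); exact: measurable_fun_pair.
    apply: measurable_funM; first exact: measurableT_comp.
    by apply: (measurableT_comp (mG _)); apply: measurable_fun_pair.
  apply: emeasurable_funM.
    apply: (@measurable_pathQ R h h0 k _ _ (fun i (v : (R * R) * R) => G i (v.1.2, v.2))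
      a.+1 fst snd) => //.
    move=> i; apply: (measurableT_comp (mG i)); apply: measurable_fun_pair => //.
    exact: measurableT_comp.
  apply: (@measurable_pathQ R h h0 m _ _ (fun i (v : (R * R) * R) => G i (v.1.2, v.2))
    (a + k.+1).+1 snd (fun=> lam)) => //.
  move=> i; apply: (measurableT_comp (mG i)); apply: measurable_fun_pair => //.
  exact: measurableT_comp.
have W0 z y : (0 <= W z y)%E.
  by rewrite mule_ge0 ?mule_ge0 ?pathQ_ge0// lee_fin !mulr_ge0.
transitivity (\int[mu]_z \int[mu]_y ((p x z)%:E * W z y))%E.
  apply: eq_integral => z _.
  rewrite ge0_integralZl_EFin ?bm_density_ge0//; last first.
    have mz : measurable_fun setT (fun y : R => (z, y)) by exact: measurable_fun_pair.
    exact: (measurableT_comp mW mz).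
  congr (_ * _)%E.
  transitivity (tupI h lam z (fun t : (k + m.+1).-tuple R => ((g (nth 0 t k)
    * G a (nth 0 t k, z)) *
    \prod_(i < k + m.+1) G (a.+1 + i)%N (nth 0 t k, nth 0 t i))%:E)).
    apply: eq_tupI => t /=.
    rewrite big_ord_recl/= addn0 mulrA; congr (_ * _)%:E.
    by apply: eq_bigr => i _; rewrite /= addSnnS.
  rewrite (IH a.+1 z (fun y => g y * G a (y, z))).
  - by apply: eq_integral => y _; rewrite /W addSnnS.
  - apply: measurable_funM => //; apply: (measurableT_comp (mG _)).
    exact: measurable_fun_pair.
  - by move=> y; rewrite mulr_ge0.
rewrite (fubini_tonelli (m1 := mu) (m2 := mu)
  (fun u : R * R => ((p x u.1)%:E * W u.1 u.2)%E)).
- apply: eq_integral => y _ /=.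
  pose C := ((g y * G (a + k.+1)%N (y, y))%:E * pathQ h (fun i z => G i (y, z))
    (a + k.+1).+1 m y lam)%E.
  transitivity (\int[mu]_z (C * ((p x z * G a (y, z))%:E * pathQ h (fun i z => G i (y,
    z)) a.+1 k z y)))%E.
    apply: eq_integral => z _; rewrite /W /C.
    rewrite [RHS]muleACA -EFinM [in RHS](muleC (pathQ _ _ _ _ _ _)) muleA -EFinM.
    by congr (_%:E * _)%E; ring.
  rewrite ge0_integralZl//.
  + by rewrite /C -muleA; congr (_ * _)%E; exact: muleC.
  + apply: emeasurable_funM.
      apply/measurable_EFinP; apply: measurable_funM.
        exact: (measurable_bm_densityl h x).
      by apply: (measurableT_comp (mG a)); exact: measurable_fun_pair.
    apply: (@measurable_pathQ R h h0 k _ R (fun i (v : R * R) => G i (y, v.2))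
      a.+1 id (fun=> y)) => //.
    move=> i; apply: (measurableT_comp (mG i)); apply: measurable_fun_pair => //.
  + by move=> z _; rewrite mule_ge0 ?pathQ_ge0// lee_fin mulr_ge0// bm_density_ge0.
  + by rewrite /C mule_ge0 ?pathQ_ge0// lee_fin mulr_ge0.
- apply: emeasurable_funM => //.
  apply/measurable_EFinP.
  exact: (measurableT_comp (measurable_bm_densityl h x) measurable_fst).
- by move=> u; rewrite mule_ge0// lee_fin bm_density_ge0.
Qed.

End moving.

(** * The Vervaat transform on a grid *)

Section discrete_vervaat.
Context {R : realType}.
Local Notation mu := (@lebesgue_measure R).

Definition gridpath (lam : R) (t : seq R) i := nth 0 (0 :: rcons t lam) i.

Definition grid_first_argmin (N : nat) (b : nat -> R) k :=
  (forall i, (i < k)%N -> b k < b i) /\ (forall i, (i <= N)%N -> b k <= b i).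

Definition grid_vervaat (N : nat) (b : nat -> R) k i :=
  if (i + k <= N)%N then b (i + k)%N - b k else b (i + k - N)%N + b N - b k.

Definition grid_vervaat_in N (A : nat -> set R) k (b : nat -> R) :=
  grid_first_argmin N b k /\
  forall i, (0 < i < N)%N -> A i (grid_vervaat N b k i).

(* The path is cut at its first argmin [k] and [j = N - k].  After the cut it
   stays at or above its minimum, whence [>= 0] up to [j]; before the cut it is
   strictly above it, whence [> lam] from [j] on. *)
Definition cut_set (lam : R) (A : nat -> set R) j i : set R :=
  A i `&` (if (i <= j)%N then `[0, +oo[%classic else `]lam, +oo[%classic).

Variables (h lam : R).
Hypothesis h0 : 0 < h.
Hypothesis lam0 : lam < 0.

Lemma measurable_vset A j i : (forall i, measurable (A i)) ->
  measurable (cut_set lam A j i).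
Proof. by move=> mA; apply: measurableI => //; case: ifP. Qed.

Lemma gridpath0 t : gridpath lam t 0 = 0. Proof. by []. Qed.

Lemma gridpathS n (t : n.-tuple R) i : (i < n)%N -> gridpath lam t i.+1 = nth 0 t i.
Proof. by move=> ilt; rewrite /gridpath/= nth_rcons size_tuple ilt. Qed.

Lemma gridpath_end n (t : n.-tuple R) : gridpath lam t n.+1 = lam.
Proof. by rewrite /gridpath/= nth_rcons size_tuple ltnn eqxx. Qed.

Definition vervaat_tuples n A k : set (n.-tuple R) :=
  [set t | grid_vervaat_in n.+1 A k (gridpath lam t)].

Lemma vsetP A j i z : cut_set lam A j i z <->
  A i z /\ (if (i <= j)%N then 0 <= z else lam < z).
Proof. by rewrite /cut_set; case: ifP => _ /=; rewrite in_itv/= andbT. Qed.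

(** When the argmin is the last index, the transform is the path itself, and the condition on the
    cut says that the path stays above its end value. The disintegration at an interior coordinate
    does not cover this case. *)
Lemma dV_last n A : @vervaat_tuples n A n.+1 = rect 1 (cut_set lam A 0).
Proof.
apply/seteqP; split => [t [[arg1 arg2] tA] i ilt|t tA].
  apply/vsetP; rewrite add1n; split => /=.
    have := tA i.+1; rewrite /grid_vervaat.
    rewrite (_ : (i.+1 + n.+1 <= n.+1)%N = false); last by apply/negbTE; lia.
    by rewrite addnK gridpath_end gridpathS// addrK; apply; lia.
  by have := arg1 i.+1; rewrite gridpath_end gridpathS//; apply; lia.
have tA' i : (i < n)%N -> A i.+1 (nth 0 t i) /\ lam < nth 0 t i.
  by move=> ilt; have /vsetP := tA i ilt.
split; first split => [i ilt|i ile]; rewrite ?gridpath_end.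
- case: i ilt => [|i] ilt; first by rewrite gridpath0.
  by rewrite gridpathS//; exact: (tA' i ilt).2.
- have [ilt|] := ltnP i n.+1; last first.
    by move=> nlt; rewrite (_ : i = n.+1) ?gridpath_end ?lexx//; lia.
  case: i ilt ile => [|i] ilt ile; first by rewrite gridpath0 (ltW lam0).
  by rewrite gridpathS//; exact/ltW/(tA' i ilt).2.
- move=> [//|i] ilt; rewrite /grid_vervaat.
  rewrite (_ : (i.+1 + n.+1 <= n.+1)%N = false); last by apply/negbTE; lia.
  rewrite addnK gridpath_end gridpathS; last by lia.
  by rewrite addrK; apply: (tA' i _).1; lia.
Qed.

(** Here [u.1] is the height of the path at its cut [k + 1] and [u.2] its height at [i]. Indices
    before the cut are sent to [i + j], those after it to [i - (k + 1)]. The cut is sent to time 0,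
    where no condition is imposed; its slot carries instead the condition at the splice [j], the
    common image of the two end points of the path. *)
Definition vervaat_weight A k m i (u : R * R) : R :=
  let j := m.+1 in
  if (i < k.+1)%N then \1_(cut_set lam A j (i + j)) (u.2 + lam - u.1)
  else if i == k.+1 then \1_(cut_set lam A j j) (lam - u.1)
  else \1_(cut_set lam A j (i - k.+1)) (u.2 - u.1).

Lemma dV_prod k m A (t : (k + m.+1).-tuple R) :
  \d_t (@vervaat_tuples (k + m.+1) A k.+1) =
  (1 * \prod_(i < k + m.+1) vervaat_weight A k m (1 + i) (nth 0 t k,
    nth 0 t i))%:E :> \bar R.
Proof.
set n := (k + m.+1)%N.
have klt : (k < n)%N by rewrite /n; lia.
rewrite mul1r diracE.
have -> : \prod_(i < n) vervaat_weight A k m (1 + i) (nth 0 t k, nth 0 t i) =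
    [forall i : 'I_n, vervaat_weight A k m (1 + i) (nth 0 t k, nth 0 t i) != 0]%:R.
  have [/forallP H|/forallPn [i /negPn/eqP H]] :=
    boolP [forall i : 'I_n, vervaat_weight A k m (1 + i) (nth 0 t k, nth 0 t i) != 0].
    apply: big1 => i _; have := H i; rewrite /vervaat_weight.
    by case: ifP => _; [|case: ifP => _]; rewrite indicE; case: (_ \in _) => //;
      rewrite eqxx.
  by rewrite (bigD1 i)//= H mul0r.
congr ((nat_of_bool _)%:R)%:E.
have wE i : (i < n)%N -> vervaat_weight A k m i.+1 (nth 0 t k, nth 0 t i) != 0 <->
   (if (i < k)%N then cut_set lam A m.+1 (i.+1 + m.+1) (nth 0 t i + lam - nth 0 t k)
   else if i == k then cut_set lam A m.+1 m.+1 (lam - nth 0 t k)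
   else cut_set lam A m.+1 (i - k) (nth 0 t i - nth 0 t k)).
  move=> ilt; rewrite /vervaat_weight/= ltnS eqSS subSS.
  have iE (X : set R) z : (\1_X z != 0 :> R) <-> X z.
    rewrite indicE; split=> [|Xz]; last by rewrite mem_set// oner_eq0.
    by case: (boolP (z \in X)) => [/set_mem//|_]; rewrite eqxx.
  by case: ifP => _; [|case: ifP => _]; exact: iE.
have Ek : gridpath lam t k.+1 = nth 0 t k by exact: gridpathS.
apply/idP/forallP => [/set_mem [[arg1 arg2] tA] i|H].
  rewrite add1n; apply/(wE i (ltn_ord i)).
  have := ltn_ord i; move: {i}(nat_of_ord i) => i ilt.
  have Ei : gridpath lam t i.+1 = nth 0 t i by exact: gridpathS.
  rewrite -Ek -Ei; case: ltnP => [ik|ki]; [|case: eqP => ik].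
  - apply/vsetP; split.
      have := tA (i.+1 + m.+1)%N; rewrite /grid_vervaat.
      rewrite (_ : (i.+1 + m.+1 + k.+1 <= n.+1)%N = false); last by apply/negbTE;
        rewrite /n; lia.
      rewrite (_ : (i.+1 + m.+1 + k.+1 - n.+1 = i.+1)%N); last by rewrite /n; lia.
      by rewrite gridpath_end; apply; rewrite /n; lia.
    rewrite (_ : (i.+1 + m.+1 <= m.+1)%N = false); last by apply/negbTE; lia.
    by have := arg1 i.+1; rewrite ltnS => /(_ ik); lra.
  - apply/vsetP; split.
      have := tA m.+1; rewrite /grid_vervaat.
      rewrite (_ : (m.+1 + k.+1 <= n.+1)%N = true); last by rewrite /n; lia.
      rewrite (_ : (m.+1 + k.+1 = n.+1)%N); last by rewrite /n; lia.
      by rewrite gridpath_end; apply; rewrite /n; lia.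
    by rewrite leqnn; have := arg2 n.+1 (leqnn _); rewrite gridpath_end; lra.
  - apply/vsetP; split.
      have := tA (i - k)%N; rewrite /grid_vervaat.
      rewrite (_ : (i - k + k.+1 <= n.+1)%N = true); last by rewrite /n; lia.
      rewrite (_ : (i - k + k.+1 = i.+1)%N); last by rewrite /n; lia.
      by apply; rewrite /n; move: ilt; rewrite /n; lia.
    rewrite (_ : (i - k <= m.+1)%N = true); last by move: ilt; rewrite /n; lia.
    by have := arg2 i.+1; rewrite /= => /(_ _); rewrite subr_ge0; apply; lia.
have H1 i : (i < k)%N -> A (i.+1 + m.+1)%N (nth 0 t i + lam - nth 0 t k)
  /\ nth 0 t k < nth 0 t i.
  move=> ik; have iltn : (i < n)%N by lia.
  have := H (Ordinal iltn); rewrite add1n => /(wE i iltn); rewrite ik => /vsetP[].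
  rewrite (_ : (i.+1 + m.+1 <= m.+1)%N = false); last by apply/negbTE; lia.
  by move=> ? ?; split => //; lra.
have [H2 H2'] : A m.+1 (lam - nth 0 t k) /\ nth 0 t k <= lam.
  have := H (Ordinal klt); rewrite add1n => /(wE k klt); rewrite ltnn eqxx => /vsetP[].
  by rewrite leqnn subr_ge0.
have H3 i : (k < i < n)%N -> A (i - k)%N (nth 0 t i - nth 0 t k) /\ nth 0 t k <= nth 0 t i.
  move=> /andP[ki iltn].
  have := H (Ordinal iltn); rewrite add1n => /(wE i iltn).
  rewrite (_ : (i < k)%N = false); last by apply/negbTE; lia.
  rewrite (_ : (i == k) = false); last by apply/negbTE; lia.
  move=> /vsetP[]; rewrite (_ : (i - k <= m.+1)%N = true); last by move: iltn;
    rewrite /n; lia.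
  by rewrite subr_ge0.
apply/mem_set; split; first split => i ilt; rewrite ?Ek.
- case: i ilt => [|i] ilt; first by rewrite gridpath0; exact: le_lt_trans H2' lam0.
  by rewrite gridpathS; [exact: (H1 i ilt).2|lia].
- case: i ilt => [|i] ilt; first by rewrite gridpath0; exact/ltW/(le_lt_trans H2' lam0).
  have [ilt'|] := ltnP i n; last first.
    by move=> ni; rewrite (_ : i = n) ?(gridpath_end t)//; lia.
  rewrite gridpathS//; have [ik|ki|->//] := ltngtP i k.
    exact/ltW/(H1 i ik).2.
  by apply: (H3 i _).2; rewrite ki.
- move=> i i0; rewrite /grid_vervaat Ek; case: ifPn => [ikn|].
    have [im|im|im] := ltngtP i m.+1.
    + have -> : (i + k.+1 = (i + k).+1)%N by lia.
      rewrite gridpathS; last by rewrite /n; lia.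
      have [|+ _] := H3 (i + k)%N; first by rewrite /n; lia.
      by rewrite addnK.
    + by move: ikn; rewrite /n; lia.
    + rewrite im (_ : (m.+1 + k.+1 = n.+1)%N); last by rewrite /n; lia.
      by rewrite gridpath_end.
  rewrite -ltnNge => ikn.
  have -> : (i + k.+1 - n.+1 = (i + k - n.+1).+1)%N by lia.
  have ik' : (i + k - n.+1 < k)%N by lia.
  rewrite gridpath_end gridpathS; last by lia.
  have [+ _] := H1 _ ik'; rewrite (_ : ((i + k - n.+1).+1 + m.+1)%N = i)//.
  by move: ikn i0; rewrite /n; lia.
Qed.

Lemma measurable_dVweight A k m i : (forall i, measurable (A i)) ->
  measurable_fun setT (vervaat_weight A k m i).
Proof.
move=> mA; rewrite /vervaat_weight.
have ind X (f : R * R -> R) : measurable X -> measurable_fun setT f ->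
    measurable_fun setT (fun u => \1_X (f u) : R).
  by move=> mX mf; apply: (measurableT_comp _ mf); exact: measurable_indic.
case: (i < k.+1)%N; [|case: (i == k.+1)%N]; apply: ind; try exact: measurable_vset.
- by apply: measurable_funB => //; apply: measurable_funD.
- exact: measurable_funB.
- exact: measurable_funB.
Qed.

(** Vervaat's exchange. Given the value [y] at the cut, the weight of the path factorises into a
    piece before it and a piece after it. Translated and put in the other order, these pieces form a
    path from 0 to [lam] with value [lam - y] at the splice, so the integral over [y] becomes the
    integral over that value, and [pathQ_cat] glues the pieces. *)
Lemma dV_pathQ n A k : (0 < k <= n.+1)%N -> (forall i, measurable (A i)) ->
  tupI h lam 0 (fun t => \d_t (@vervaat_tuples n A k)) =
  pathQ h (fun i => \1_(cut_set lam A (n.+1 - k) i)) 1 n 0 lam.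
Proof.
move=> + mA; have mvA j i := @measurable_vset A j i mA.
case: k => [//|k] /=; rewrite ltnS leq_eqVlt => /orP[/eqP ->|kn].
  by rewrite subnn dV_last tupI_rect.
have [m nE] : exists m, n = (k + m.+1)%N by exists (n - k).-1; lia.
rewrite {}nE in kn *; under eq_tupI do rewrite dV_prod.
have -> : ((k + m.+1).+1 - k.+1 = m.+1)%N by lia.
set vw := fun i => \1_(cut_set lam A m.+1 i) : R -> R.
have mvw i : measurable_fun setT (vw i) by apply: measurable_indic.
have vw0 i z : 0 <= vw i z by rewrite /vw indicE.
have G0 i u : 0 <= vervaat_weight A k m i u.
  by rewrite /vervaat_weight; case: ifP => _; [|case: ifP => _]; rewrite indicE.
rewrite (@tupI_moving R h lam h0 (vervaat_weight A k m) k m 1 0 (fun=> 1))//; last first.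
  by move=> i; exact: measurable_dVweight.
pose H z := ((vw m.+1 z)%:E * (pathQ h vw 1 m 0 z * pathQ h vw m.+2 k z lam))%E.
transitivity (\int[mu]_y H (lam - y)%R)%E.
  apply: eq_integral => y _.
  rewrite /H mul1r add1n; congr ((_)%:E * _)%E.
    by rewrite /vervaat_weight ltnn eqxx.
  rewrite muleC; congr (_ * _)%E.
    transitivity (pathQ h (fun i z => vw (i - k.+1)%N (z - y)) k.+2 m y lam).
      apply: eq_pathQ => i z im; rewrite /vervaat_weight.
      rewrite (_ : (k.+2 + i < k.+1)%N = false); last by apply/negbTE; lia.
      by rewrite (_ : (k.+2 + i == k.+1)%N = false)//; apply/negbTE; lia.
    rewrite (pathQ_shift h0 y (w := fun i => vw (i - k.+1)%N))// subrr;
      apply: eq_pathQ => i z im.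
    by congr vw; lia.
  transitivity (pathQ h (fun i z => vw (i + m.+1)%N (z - (y - lam))) 1 k 0 y).
    apply: eq_pathQ => i z ik; rewrite /vervaat_weight.
    rewrite (_ : (1 + i < k.+1)%N = true)//.
    by rewrite /vw /=; congr (\1_ _ _); lra.
  rewrite (pathQ_shift h0 (y - lam) (w := fun i => vw (i + m.+1)%N))//.
  rewrite (_ : 0 - (y - lam) = lam - y); last by lra.
  rewrite (_ : y - (y - lam) = lam); last by lra.
  by apply: eq_pathQ => i z ik; congr vw; lia.
have mH : measurable_fun setT H.
  apply: emeasurable_funM; first exact/measurable_EFinP.
  by apply: emeasurable_funM; apply: measurable_pathQ2.
have H0 z : (0 <= H z)%E by rewrite !mule_ge0 ?lee_fin ?pathQ_ge0.
transitivity (\int[mu]_y H (- y + lam)%R)%E.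
  by apply: eq_integral => y _; rewrite addrC.
rewrite (ge0_integral_opp (f := fun u => H (u + lam)%R))//; last first.
  by apply: (measurableT_comp mH); exact: measurable_funD.
rewrite ge0_integral_shift//.
have -> : (k + m.+1 = m + k.+1)%N by lia.
by rewrite pathQ_cat.
Qed.

Lemma measurable_grid_vervaat d (T : measurableType d) (b : nat -> T -> R) N k i :
  (forall i, measurable_fun setT (b i)) ->
  measurable_fun setT (fun w => grid_vervaat N (b ^~ w) k i).
Proof.
move=> mb; rewrite /grid_vervaat; case: (i + k <= N)%N; first exact: measurable_funB.
by apply: measurable_funB => //; exact: measurable_funD.
Qed.

Lemma measurable_grid_vervaat_in d (T : measurableType d) (b : nat -> T -> R) N A k :
  (forall i, measurable_fun setT (b i)) -> (forall i, measurable (A i)) ->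
  measurable [set w | grid_vervaat_in N A k (b ^~ w)].
Proof.
move=> mb mA.
rewrite (_ : mkset _ = (\bigcap_(i in `I_k) [set w | b k w < b i w]) `&`
  (\bigcap_(i in `I_N.+1) [set w | b k w <= b i w]) `&`
  \bigcap_(i in [set i | (0 < i < N)%N])
    (fun w => grid_vervaat N (b ^~ w) k i) @^-1` A i); last first.
  apply/seteqP; split => [w [[H1 H2] H3]|w [[H1 H2] H3]].
    by split; [split|] => i; [exact: H1|exact: H2|exact: H3].
  by split; [split|] => i; [exact: H1|exact: H2|exact: H3].
have pre (f : T -> R) X : measurable_fun setT f -> measurable X -> measurable (f @^-1` X).
  by move=> mf mX; rewrite -[X in measurable X]setTI; exact: mf.
apply: measurableI; first apply: measurableI; apply: bigcap_measurableType => i _.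
- rewrite (_ : mkset _ = (fun w => b i w - b k w) @^-1` `]0, +oo[%classic).
    by apply: pre => //; exact: measurable_funB.
  by apply/seteqP; split => w; rewrite /= in_itv/= andbT subr_gt0.
- rewrite (_ : mkset _ = (fun w => b i w - b k w) @^-1` `[0, +oo[%classic).
    by apply: pre => //; exact: measurable_funB.
  by apply/seteqP; split => w; rewrite /= in_itv/= andbT subr_ge0.
- by apply: pre => //; exact: measurable_grid_vervaat.
Qed.

End discrete_vervaat.

(** * Comparison inequality on a grid *)

Section comparison.
Context {R : realType}.
Local Notation mu := (@lebesgue_measure R).

(** The hypothesis is that [X] is below [Y] in the strong set order. *)
Lemma lr_indic (X Y : set R) :
  (forall x y, x <= y -> Y x -> X y -> X x /\ Y y) ->
  ratio_ndecr (\1_X : R -> R) (\1_Y : R -> R).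
Proof.
move=> XY x y xy; rewrite !indicE.
case: (boolP (y \in X)) => [/set_mem Xy|_]; last by rewrite mul0r.
case: (boolP (x \in Y)) => [/set_mem Yx|_]; last by rewrite mulr0.
by have [? ?] := XY _ _ xy Yx Xy; rewrite !mem_set.
Qed.

Variables (h lam : R).
Hypothesis h0 : 0 < h.
Hypothesis lam0 : lam < 0.

Definition cut_weight A j i : R -> R := \1_(cut_set lam A j i).

Lemma weights_iw A j : (forall i, measurable (A i)) -> weights (cut_weight A j).
Proof.
move=> mA; split => i; first by apply: measurable_indic; exact: measurable_vset.
by move=> z; rewrite /cut_weight indicE; case: (_ \in _); rewrite lexx ler01.
Qed.

(** Delaying the cut from [j'] to [j] replaces the threshold [lam] by 0 at some indices, which is
    more demanding since [lam < 0]. *)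
Lemma iw_le A A' j j' i z : (A i `<=` A' i) -> ((i <= j')%N -> (i <= j)%N) ->
  cut_weight A j i z <= cut_weight A' j' i z.
Proof.
move=> AA' jj; rewrite /cut_weight !indicE.
case: (boolP (z \in _)) => [/set_mem/vsetP [Az jz]|_]; last by case: (_ \in _).
rewrite mem_set//; apply/vsetP; split; first exact: AA'.
case: ifPn => [/jj ij|_]; first by rewrite ij in jz.
by case: ifP jz => // _ /(lt_le_trans lam0).
Qed.

(** A later cut raises the threshold of a half-line from [lam] to 0, which favours high
    positions. *)
Lemma lr_iwT j j' i : ((i <= j)%N -> (i <= j')%N) ->
  ratio_ndecr (cut_weight (fun=> setT) j i) (cut_weight (fun=> setT) j' i).
Proof.
move=> jj; apply: lr_indic => x y xy /vsetP[_ Yx] /vsetP[_ Xy].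
split; apply/vsetP; split => //.
- case: ifPn => [/jj ij|_]; first by rewrite ij in Yx.
  by case: ifP Yx => // _ /(lt_le_trans lam0).
- by case: ifPn Yx => _ Yx; [exact: le_trans Yx xy|exact: lt_le_trans Yx xy].
Qed.

Variables (a b : nat).
Local Notation n := (a + b.+1)%N.
Variables (nu nt : nat).
Hypotheses (nu_a : (0 < nu <= a)%N) (nt_n : (a.+1 < nt <= n)%N).

(** The indices [nu], [a + 1] and [nt] are those of the times [u], [s] and [t]; [a] is thus the
    number of interior points before [s], and [b] the number of those after it. *)
Definition Aev (U C J : set R) i : set R :=
  if i == a.+1 then J else if i == nu then U else if i == nt then C else setT.

Lemma measurable_Aev U C J : measurable U -> measurable C -> measurable J ->
  forall i, measurable (Aev U C J i).
Proof. by move=> ? ? ? i; rewrite /Aev; case: ifP => // _; case: ifP => // _;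
  case: ifP. Qed.

(* For the cut [j], the weights of the part of the transformed path before,
   respectively after, the index [a.+1], given that it is at [x] there. *)
Definition bet U j x := pathq h (cut_weight (Aev U setT setT) j) 1 a 0 x.
Definition gam C j x := pathq h (cut_weight (Aev setT C setT) j) a.+2 b x lam.

Lemma Aev_bet U C J i : (0 < i <= a)%N -> Aev U C J i = Aev U setT setT i.
Proof.
move=> ia; rewrite /Aev; case: eqP => [|_]; first by lia.
by case: eqP => // _; case: eqP => // itn; lia.
Qed.

Lemma Aev_gam U C J i : (a.+1 < i)%N -> Aev U C J i = Aev setT C setT i.
Proof.
move=> ia; rewrite /Aev; case: eqP => [|_]; first by lia.
by case: eqP => // iu; lia.
Qed.

Lemma AevT i : Aev setT setT setT i = setT.
Proof. by rewrite /Aev !if_same. Qed.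

Lemma pathQ_Aev U C J j : measurable U -> measurable C -> measurable J ->
  pathQ h (cut_weight (Aev U C J) j) 1 n 0 lam =
  (\int[mu]_z (\1_(cut_set lam (fun=> J) j a.+1) z * bet U j z * gam C j z)%:E)%E.
Proof.
move=> mU mC mJ.
have ww := weights_iw j (measurable_Aev mU mC mJ).
rewrite pathQ_cat//; do ?[exact: ww.1|exact: weights_ge0].
apply: eq_integral => z _.
rewrite /bet /gam !EFinM -muleA !pathqE//; last 2 first.
- by apply: weights_iw => i; exact: measurable_Aev.
- by apply: weights_iw => i; exact: measurable_Aev.
congr ((_)%:E * (_ * _))%E.
- by rewrite add1n /cut_weight /cut_set /Aev eqxx.
- apply: eq_pathQ => i x ia; rewrite /cut_weight /cut_set (@Aev_bet U C J)//; lia.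
- apply: eq_pathQ => i x ia; rewrite add1n /cut_weight /cut_set (@Aev_gam U C J)//; lia.
Qed.

Section measurability.
Variables (U C : set R) (mU : measurable U) (mC : measurable C).

Lemma bet_ge0 j x : 0 <= bet U j x.
Proof. by apply: pathq_ge0 => //; apply: weights_iw => i; exact: measurable_Aev. Qed.

Lemma gam_ge0 j x : 0 <= gam C j x.
Proof. by apply: pathq_ge0 => //; apply: weights_iw => i; exact: measurable_Aev. Qed.

Lemma measurable_bet j : measurable_fun setT (bet U j).
Proof. by apply: measurable_pathqr => //; apply: weights_iw => i;
  exact: measurable_Aev. Qed.

Lemma measurable_gam j : measurable_fun setT (gam C j).
Proof. by apply: measurable_pathql => //; apply: weights_iw => i;
  exact: measurable_Aev. Qed.

(** Only the indices up to [a] enter, and for such cuts they all lie before the splice, under the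
    same threshold 0. *)
Lemma bet_const j j' : (a <= j)%N -> (a <= j')%N -> bet U j = bet U j'.
Proof.
move=> aj aj'; apply/funext => x; rewrite /bet /pathq; congr fine.
apply: eq_pathQ => i z ia; rewrite /cut_weight /cut_set.
have -> : (1 + i <= j)%N by lia.
by have -> : (1 + i <= j')%N by lia.
Qed.

Lemma gam_const j : (j <= a)%N -> gam C j = gam C 0.
Proof.
move=> ja; apply/funext => x; rewrite /gam /pathq; congr fine.
apply: eq_pathQ => i z ib; rewrite /cut_weight /cut_set.
by have -> : (a.+2 + i <= j)%N = false by apply/negbTE; lia.
Qed.

Lemma bet_eq0 j x : U `<=` `]-oo, 0[ -> (nu <= j)%N -> bet U j x = 0.
Proof.
move=> U0 uj; rewrite /bet /pathq (@pathQ_eq0 _ _ h0 _ _ _ _ _ nu)//.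
move=> z; rewrite /cut_weight indicE memNset// => /vsetP; rewrite uj /Aev.
have -> : (nu == a.+1) = false by apply/negbTE; lia.
by rewrite eqxx => -[/U0 /=]; rewrite in_itv/= ltNge => /negP.
Qed.

Lemma gam_eq0 j x : C `<=` `]-oo, 0[ -> (nt <= j)%N -> gam C j x = 0.
Proof.
move=> C0 tj; rewrite /gam /pathq (@pathQ_eq0 _ _ h0 _ _ _ _ _ nt)//; first by lia.
move=> z; rewrite /cut_weight indicE memNset// => /vsetP; rewrite tj /Aev.
have -> : (nt == a.+1) = false by apply/negbTE; lia.
have -> : (nt == nu) = false by apply/negbTE; lia.
by rewrite eqxx => -[/C0 /=]; rewrite in_itv/= ltNge => /negP.
Qed.

Lemma gam_le j j' x : (j' <= j)%N -> gam C j x <= gam C j' x.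
Proof.
move=> jj; rewrite -lee_fin /gam !pathqE; do ?[by apply: weights_iw => i;
  exact: measurable_Aev|by []].
have ww j1 : weights (cut_weight (Aev setT C setT) j1).
  by apply: weights_iw => i; exact: measurable_Aev.
apply: pathQ_le; do ?[by []|exact: (ww _).1|exact: (weights_ge0 (ww _))].
by move=> i z _; apply: iw_le => // ij; exact: leq_trans jj.
Qed.

Lemma bet_le j j' x : (j' <= j)%N -> bet U j x <= bet U j' x.
Proof.
move=> jj; rewrite -lee_fin /bet !pathqE; do ?[by apply: weights_iw => i;
  exact: measurable_Aev|by []].
have ww j1 : weights (cut_weight (Aev U setT setT) j1).
  by apply: weights_iw => i; exact: measurable_Aev.
apply: pathQ_le; do ?[by []|exact: (ww _).1|exact: (weights_ge0 (ww _))].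
by move=> i z _; apply: iw_le => // ij; exact: leq_trans jj.
Qed.

End measurability.

Lemma weights_T j : weights (cut_weight (Aev setT setT setT) j).
Proof. by apply: weights_iw => i; exact: measurable_Aev. Qed.

Lemma lr_gamT j j' : (j <= j')%N -> ratio_ndecr (gam setT j) (gam setT j').
Proof.
move=> jj; apply: lr_pathql => //; [exact: weights_T|exact: weights_T|].
move=> i _; rewrite (_ : Aev _ _ _ = fun=> setT); last by apply/funext => k; exact: AevT.
by apply: lr_iwT => ij; exact: leq_trans jj.
Qed.

Lemma lr_betT j j' : (j <= j')%N -> ratio_ndecr (bet setT j) (bet setT j').
Proof.
move=> jj; apply: lr_pathqr => //; [exact: weights_T|exact: weights_T|].
move=> i _; rewrite (_ : Aev _ _ _ = fun=> setT); last by apply/funext => k; exact: AevT.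
by apply: lr_iwT => ij; exact: leq_trans jj.
Qed.

(** An upper bound on the position at [t] favours low positions at [s]: a half-line unbounded below
    precedes the whole line in the strong set order. *)
Lemma lr_gamC (c : R) : ratio_ndecr (gam `]-oo, c[ 0) (gam setT 0).
Proof.
apply: lr_pathql => //; [by apply: weights_iw => i;
  exact: measurable_Aev|exact: weights_T|].
move=> i ia; apply: lr_indic => x y xy /vsetP[_ Yx] /vsetP[].
move=> Xy ly; rewrite (_ : (i <= 0)%N = false) in Yx ly *; last by apply/negbTE; lia.
split; apply/vsetP; rewrite ?AevT (_ : (i <= 0)%N = false)//; do ?[by apply/negbTE; lia].
split => //; move: Xy; rewrite /Aev; case: ifP => // _; case: ifP => // _;
  case: ifP => // _.
by rewrite /= !in_itv/= => /(le_lt_trans xy).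
Qed.

Definition vervaat_mass A := (\sum_(0 <= j < n.+1) pathQ h (cut_weight A j) 1 n 0 lam)%E.

Definition intJ (J : set R) (f : R -> R) := (\int[mu]_z (\1_J z * f z)%:E)%E.

Lemma measurable_intJ (J : set R) (f : R -> R) : measurable J ->
  measurable_fun setT f -> measurable_fun setT (fun z => (\1_J z * f z)%:E).
Proof.
by move=> mJ mf; apply/measurable_EFinP; apply: measurable_funM.
Qed.

Lemma intJ_ge0 J f : (forall z, 0 <= f z) -> (0 <= intJ J f)%E.
Proof. by move=> f0; apply: integral_ge0 => z _; rewrite lee_fin mulr_ge0// indicE. Qed.

Lemma intJ_le (J K : set R) (f g : R -> R) : measurable J -> measurable K ->
  measurable_fun setT f ->
  measurable_fun setT g -> (forall z, 0 <= f z) -> (forall z, 0 <= g z) -> J `<=` K ->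
  (forall z, J z -> f z <= g z) -> (intJ J f <= intJ K g)%E.
Proof.
move=> mJ mK mf mg f0 g0 JK fg; apply: ge0_le_integral => //.
- by move=> z _; rewrite lee_fin mulr_ge0// indicE.
- exact: measurable_intJ.
- exact: measurable_intJ.
move=> z _; rewrite lee_fin !indicE.
case: (boolP (z \in J)) => [/set_mem Jz|_]; last by rewrite mul0r mulr_ge0.
by rewrite mem_set ?mul1r ?fg//; exact: JK.
Qed.

Lemma intJZ (J : set R) (c : R) (f : R -> R) : measurable J -> measurable_fun setT f ->
  (forall z, 0 <= f z) -> 0 <= c -> (intJ J (fun z => (c * f z)%R) = c%:E * intJ J f)%E.
Proof.
move=> mJ mf f0 c0; rewrite /intJ -ge0_integralZl_EFin//.
- by apply: eq_integral => z _; rewrite -EFinM mulrCA.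
- by move=> z _; rewrite lee_fin mulr_ge0// indicE.
- exact: measurable_intJ.
Qed.

Lemma intJ_sum (J : set R) (f : nat -> R -> R) r : measurable J ->
  (forall j, measurable_fun setT (f j)) -> (forall j z, 0 <= f j z) ->
  (\sum_(j <- r) intJ J (f j) = intJ J (fun z => (\sum_(j <- r) f j z)%R))%E.
Proof.
move=> mJ mf f0; rewrite /intJ -ge0_integral_sum//.
- by apply: eq_integral => z _; rewrite sumEFin mulr_sumr.
- by move=> j; exact: measurable_intJ.
- by move=> j z _; rewrite lee_fin mulr_ge0// indicE.
Qed.

Lemma measurable_bg (U C : set R) j : measurable U -> measurable C ->
  measurable_fun setT (fun z => bet U j z * gam C j z).
Proof. by move=> mU mC; apply: measurable_funM;
  [exact: measurable_bet|exact: measurable_gam]. Qed.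

Lemma bg_ge0 (U C : set R) j z : measurable U -> measurable C -> 0 <= bet U j z * gam C j z.
Proof. by move=> mU mC; rewrite mulr_ge0 ?bet_ge0 ?gam_ge0. Qed.

(** On the positive half-line the two possible thresholds at [s] are both satisfied, so all cuts can
    be integrated over the same set [J]. *)
Lemma Vsum_intJ (U C J : set R) : measurable U -> measurable C -> measurable J ->
  J `<=` `]0, +oo[ ->
  vervaat_mass (Aev U C J) = intJ J (fun z => (\sum_(0 <= j < n.+1)
    bet U j z * gam C j z)%R).
Proof.
move=> mU mC mJ J0; rewrite -intJ_sum//; last 2 first.
- by move=> j; exact: measurable_bg.
- by move=> j z; exact: bg_ge0.
apply: eq_bigr => j _; rewrite pathQ_Aev//; apply: eq_integral => z _.
rewrite (_ : cut_set _ _ _ _ = J) ?mulrA//; apply/seteqP; split => [y /vsetP[]//|y Jy].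
have := J0 _ Jy; rewrite /= in_itv/= andbT => y0.
by apply/vsetP; split => //; case: ifP => _; [exact: ltW|exact: lt_trans y0].
Qed.

(** [Sb] collects the splices before [s]; [al] keeps only those before [u], the ones compatible with
    [V_u < 0]. *)
Definition Sb z := \sum_(0 <= j < a.+1) bet setT j z.
Definition al U z := \sum_(0 <= j < nu) bet U j z.

Lemma Sb_ge0 z : 0 <= Sb z.
Proof. by apply: sumr_ge0 => j _; exact: bet_ge0. Qed.

Lemma al_ge0 U z : measurable U -> 0 <= al U z.
Proof. by move=> mU; apply: sumr_ge0 => j _; exact: bet_ge0. Qed.

Lemma measurable_Sb : measurable_fun setT Sb.
Proof. by apply: measurable_sum => j; exact: measurable_bet. Qed.

Lemma measurable_al U : measurable U -> measurable_fun setT (al U).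
Proof. by move=> mU; apply: measurable_sum => j; exact: measurable_bet. Qed.

(** [bet] decreases with the cut, so its final value is at most its average over the first [a + 1]
    cuts. This is the source of the factor [t / s]. *)
Lemma Sb_bet z : a.+1%:R * bet setT n z <= Sb z.
Proof.
rewrite /Sb mulr_natl -[X in _ *+ X]subn0 -sumr_const_nat.
by apply: ler_sum_nat => j ja; apply: bet_le => //; lia.
Qed.

(** The cuts up to [a] give exactly [Sb z * gam]. Each of the [nt - (a + 1)] cuts from [a + 1] to
    [nt - 1] adds at most a fraction [1 / (a + 1)] of this, by [Sb_bet], and a cut from [nt] on
    contradicts [V_t < c]. The total factor is [1 + (nt - (a + 1)) / (a + 1)]. *)
Lemma sum_nu_le c z : c <= 0 ->
  \sum_(0 <= j < n.+1) bet setT j z * gam `]-oo, c[ j z <=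
  nt%:R / a.+1%:R * (Sb z * gam `]-oo, c[ 0 z).
Proof.
move=> c0; set C := `]-oo, c[%classic; have mC : measurable C by exact: measurable_itv.
rewrite (@big_cat_nat _ _ _ a.+1)//=; last by lia.
rewrite (@big_cat_nat _ _ _ nt a.+1)//=; [|lia|lia].
rewrite [X in _ + (_ + X)]big_nat_cond [X in _ + (_ + X)]big1 ?addr0; last first.
  move=> j /andP[/andP[tj _] _]; rewrite gam_eq0 ?mulr0//.
  by move=> x /=; rewrite !in_itv/= => /lt_le_trans; apply.
have -> : \sum_(0 <= j < a.+1) bet setT j z * gam C j z = Sb z * gam C 0 z.
  by rewrite /Sb mulr_suml; apply: eq_big_nat => j ja; rewrite gam_const//; lia.
have H : \sum_(a.+1 <= j < nt) bet setT j z * gam C j z <=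
    (nt - a.+1)%:R * (bet setT n z * gam C 0 z).
  rewrite mulr_natl -sumr_const_nat; apply: ler_sum_nat => j ja.
  rewrite (bet_const setT (j' := n)); [|lia|lia].
  by rewrite ler_wpM2l ?bet_ge0// gam_le.
apply: (le_trans (lerD (lexx _) H)).
have := Sb_bet z; have := @gam_ge0 C _ 0 z; move=> /(_ (measurable_itv _)).
move: (gam C 0 z) (Sb z) (bet setT n z) => g s b0 g0 sb.
rewrite natrB; last by lia.
have a0 : 0 < a.+1%:R :> R by rewrite ltr0n.
have ant : a.+1%:R <= nt%:R :> R by rewrite ler_nat; lia.
rewrite mulrAC ler_pdivlMr//.
have : (nt%:R - a.+1%:R) * (a.+1%:R * b0) * g <= (nt%:R - a.+1%:R) * s * g.
  by rewrite ler_wpM2r// ler_wpM2l// subr_ge0.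
by move: (a.+1%:R : R) (nt%:R : R) {a0 ant sb} => A T; nra.
Qed.

(** Between [a + 1] and [nt'], [bet] is constant and [gam] decreases with the cut, so each of these
    [nt' - a] cuts contributes at least the quantity that the hypothesis bounds from below. *)
Lemma sum_tot_ge nt' (k : R) z : (a < nt' <= n)%N -> 0 <= k ->
  k * (Sb z * gam setT 0 z) <= bet setT n z * gam setT nt' z ->
  (1 + (nt' - a)%:R * k) * (Sb z * gam setT 0 z) <=
  \sum_(0 <= j < n.+1) bet setT j z * gam setT j z.
Proof.
move=> nt'n k0 H.
rewrite (@big_cat_nat _ _ _ a.+1)//=; last by lia.
rewrite (@big_cat_nat _ _ _ nt'.+1 a.+1)//=; [|lia|lia].
have -> : \sum_(0 <= j < a.+1) bet setT j z * gam setT j z = Sb z * gam setT 0 z.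
  by rewrite /Sb mulr_suml; apply: eq_big_nat => j ja; rewrite gam_const//; lia.
rewrite mulrDl mul1r lerD2l.
have H2 : 0 <= \sum_(nt'.+1 <= j < n.+1) bet setT j z * gam setT j z.
  by apply: sumr_ge0 => j _; exact: bg_ge0.
apply: (@le_trans _ _ (\sum_(a.+1 <= j < nt'.+1) bet setT j z * gam setT j z)); last first.
  by rewrite lerDl.
rewrite -mulrA; apply: (le_trans (ler_wpM2l _ H)) => //.
rewrite mulr_natl -subSS -sumr_const_nat; apply: ler_sum_nat => j ja.
rewrite (bet_const setT (j := j) (j' := n)); [|lia|lia].
by rewrite ler_wpM2l ?bet_ge0// gam_le//; lia.
Qed.

Lemma sum_al (U C : set R) z : measurable U -> measurable C -> U `<=` `]-oo, 0[ ->
  \sum_(0 <= j < n.+1) bet U j z * gam C j z = al U z * gam C 0 z.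
Proof.
move=> mU mC U0; rewrite (@big_cat_nat _ _ _ nu)//=; last by lia.
rewrite [X in _ + X]big_nat_cond [X in _ + X]big1 ?addr0; last first.
  by move=> j /andP[/andP[uj _] _]; rewrite bet_eq0 ?mul0r.
by rewrite /al mulr_suml; apply: eq_big_nat => j ju; rewrite gam_const//; lia.
Qed.

Lemma lr_intJ (I J : set R) (f g A1 A2 : R -> R) :
  measurable I -> measurable J ->
  measurable_fun setT f -> measurable_fun setT g ->
  measurable_fun setT A1 -> measurable_fun setT A2 ->
  (forall z, 0 <= f z) -> (forall z, 0 <= g z) ->
  (forall z, 0 <= A1 z) -> (forall z, 0 <= A2 z) ->
  ratio_ndecr f g -> (forall x y, I x -> J y -> x <= y) ->
  (intJ J (fun z => (A1 z * f z)%R) * intJ I (fun z => (A2 z * g z)%R) <=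
   intJ J (fun z => (A1 z * g z)%R) * intJ I (fun z => (A2 z * f z)%R))%E.
Proof.
move=> mI mJ mf mg mA1 mA2 f0 g0 A10 A20 fg IJ.
have mi (K : set R) (u : R -> R) : measurable K -> measurable_fun setT u ->
    measurable_fun setT (fun z => \1_K z * u z).
  by move=> mK mu_; apply: measurable_funM.
have ineq x y : (\1_J y * (A1 y * f y)) * (\1_I x * (A2 x * g x)) <=
    (\1_J y * (A1 y * g y)) * (\1_I x * (A2 x * f x)).
  rewrite !indicE.
  case: (boolP (y \in J)) => [/set_mem Jy|_]; last by rewrite !mul0r.
  case: (boolP (x \in I)) => [/set_mem Ix|_]; last by rewrite !(mul0r, mulr0).
  rewrite !mul1r mulrACA [leRHS]mulrACA ler_wpM2l ?mulr_ge0//.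
  by rewrite [leRHS]mulrC fg// IJ.
apply: integralM_le; try by apply: mi => //; apply: measurable_funM.
- by move=> z; rewrite !mulr_ge0// indicE.
- by move=> z; rewrite !mulr_ge0// indicE.
- by move=> z; rewrite !mulr_ge0// indicE.
- by move=> z; rewrite !mulr_ge0// indicE.
- by move=> y x; rewrite lerD// ineq.
Qed.

(** There are at most [n + 1] late cuts and together they carry mass [eps * Phi] below [y0]; so a
    single late cut has, on average over [[0, y0]], at least a fraction [eps / (n + 1)] of the
    weight of the early cuts. This fraction increases with the height by the monotone likelihood
    ratios, hence the bound at every height above [y0]. *)
Lemma gam_domination nt' (y0 eps Phi : R) : (nt <= nt' <= n)%N ->
  0 < eps -> 0 < Phi ->
  ((eps * Phi)%:E <= \sum_(nt' <= j < n.+1)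
     pathQ h (cut_weight (Aev setT setT `]-oo, y0]) j) 1 n 0 lam)%E ->
  (vervaat_mass (Aev setT setT `]-oo, y0]) <= Phi%:E)%E ->
  forall y, y0 <= y ->
  eps / n.+1%:R * (Sb y * gam setT 0 y) <= bet setT n y * gam setT nt' y.
Proof.
move=> nt'n eps0 Phi0 H1 H2 y y0y.
pose J := `[0, y0]%classic : set R.
have mJ : measurable J by exact: measurable_itv.
have mSm : measurable_fun setT (fun z => Sb z * gam setT 0 z).
  by apply: measurable_funM; [exact: measurable_Sb|exact: measurable_gam].
have mbm : measurable_fun setT (fun z => bet setT n z * gam setT nt' z).
  by apply: measurable_funM; [exact: measurable_bet|exact: measurable_gam].
have Sm0 z : 0 <= Sb z * gam setT 0 z by rewrite mulr_ge0 ?Sb_ge0 ?gam_ge0.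
have bm0 z : 0 <= bet setT n z * gam setT nt' z by rewrite mulr_ge0 ?bet_ge0 ?gam_ge0.
have bS z : bet setT n z * gam setT nt' z <= Sb z * gam setT 0 z.
  rewrite ler_pM ?bet_ge0 ?gam_ge0//; last by rewrite gam_le.
  apply: le_trans (Sb_bet z); rewrite ler_peMl ?bet_ge0// ler1n//.
set X := intJ J (fun z => (bet setT n z * gam setT nt' z)%R).
set Z := intJ J (fun z => (Sb z * gam setT 0 z)%R).
have XZ : (X <= Z)%E by apply: intJ_le.
have ZPhi : (Z <= Phi%:E)%E.
  apply: le_trans H2; rewrite /vervaat_mass (@big_cat_nat _ _ _ a.+1)//=; last by lia.
  apply: (@le_trans _ _ (\sum_(0 <= j < a.+1) pathQ h (cut_weight (Aev setT setT `]-oo,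
    y0]) j) 1 n 0 lam)%E); last first.
    rewrite leeDl//; apply: sume_ge0 => j _.
    by apply: pathQ_ge0 => // i z; rewrite /cut_weight indicE.
  rewrite /Z (_ : (fun z => Sb z * gam setT 0 z) =
      fun z => \sum_(0 <= j < a.+1) bet setT j z * gam setT j z); last first.
    apply/funext => z; rewrite /Sb mulr_suml; apply: eq_big_nat => j ja.
    by rewrite (gam_const _ (j := j))//; lia.
  rewrite -intJ_sum//; last 2 first.
  - by move=> j; exact: measurable_bg.
  - by move=> j z; exact: bg_ge0.
  rewrite [leLHS]big_nat_cond [leRHS]big_nat_cond; apply: lee_sum => j /andP[ja _].
  rewrite pathQ_Aev//; apply: (@le_trans _ _ (intJ (cut_set lam (fun=> `]-oo,
    y0]%classic) j a.+1) (fun z => (bet setT j z * gam setT j z)%R))).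
    apply: intJ_le => //.
    - by apply: measurable_vset.
    - exact: measurable_bg.
    - exact: measurable_bg.
    - by move=> z; exact: bg_ge0.
    - by move=> z; exact: bg_ge0.
    - move=> z; rewrite /J/= in_itv/= => /andP[z0 zy]; apply/vsetP.
      rewrite (_ : (a.+1 <= j)%N = false); last by apply/negbTE; lia.
      by split; [rewrite /= in_itv/=|exact: lt_le_trans z0].
  by rewrite le_eqVlt; apply/orP; left; apply/eqP; apply: eq_integral => z _; rewrite mulrA.
have XN : ((eps * Phi)%:E <= n.+1%:R%:E * X)%E.
  apply: (le_trans H1).
  apply: (@le_trans _ _ (\sum_(nt' <= j < n.+1) X)%E).
    rewrite [leLHS]big_nat_cond [leRHS]big_nat_cond; apply: lee_sum => j /andP[ja _].
    rewrite pathQ_Aev//; apply: (@le_trans _ _ (intJ (cut_set lam (fun=> `]-oo,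
      y0]%classic) j a.+1) (fun z => (bet setT j z * gam setT j z)%R))).
      by rewrite le_eqVlt; apply/orP; left; apply/eqP; apply: eq_integral => z _;
        rewrite mulrA.
    apply: intJ_le => //.
    - by apply: measurable_vset.
    - exact: measurable_bg.
    - by move=> z; exact: bg_ge0.
    - move=> z /vsetP; rewrite (_ : (a.+1 <= j)%N = true); last by lia.
      by rewrite /J/= !in_itv/= => -[-> ->].
    - move=> z _; rewrite (bet_const setT (j := j) (j' := n)); [|lia|lia].
      by rewrite ler_wpM2l ?bet_ge0// gam_le//; lia.
  rewrite big_const_nat.
  have -> : forall m, iter m (fun y => X + y)%E 0%E = (m%:R%:E * X)%E.
    elim=> [|m IH]; first by rewrite mul0e.
    by rewrite iterS IH -[in RHS]add1n natrD EFinD ge0_muleDl ?lee_fin// mul1e.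
  rewrite lee_wpmul2r ?intJ_ge0//.
  by rewrite lee_fin ler_nat; lia.
have Zfin : Z \is a fin_num.
  by rewrite ge0_fin_numE ?intJ_ge0//; exact: le_lt_trans ZPhi (ltry _).
have Xfin : X \is a fin_num.
  by rewrite ge0_fin_numE ?intJ_ge0//; exact: le_lt_trans (le_trans XZ ZPhi) (ltry _).
(* The ratio at [y] is at least its average [X / Z] over [J], written without division. *)
have XZy : (X * (Sb y * gam setT 0 y)%:E <= Z * (bet setT n y * gam setT nt' y)%:E)%E.
  rewrite muleC [leRHS]muleC -!intJZ//; apply: intJ_le => //.
  - exact: measurable_funM.
  - exact: measurable_funM.
  - by move=> z; rewrite mulr_ge0.
  - by move=> z; rewrite mulr_ge0.
  - move=> z; rewrite /J/= in_itv/= => /andP[_ zy0].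
    have zy : z <= y by exact: le_trans y0y.
    have L1 : ratio_ndecr Sb (bet setT n).
      move=> u v uv; rewrite /Sb [leLHS]mulr_suml [leRHS]mulr_suml.
      apply: (@ler_sum_nat _ 0 a.+1 (fun j => bet setT j v * bet setT n u)
        (fun j => bet setT j u * bet setT n v)) => j ja.
      have jn : (j <= n)%N by clear -ja; lia.
      exact: (lr_betT jn uv).
    rewrite mulrC [leRHS]mulrC.
    have := lrM Sb_ge0 (bet_ge0 measurableT n) (gam_ge0 measurableT 0)
      (gam_ge0 measurableT nt') L1 (lr_gamT (leq0n nt')) zy.
    by rewrite [leLHS]mulrC.
move: XN XZ ZPhi XZy; rewrite -(fineK Xfin) -(fineK Zfin) -!EFinM !lee_fin.
move: (fine X) (fine Z) (Sm0 y) (bm0 y) => u v.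
move: (Sb y * _) (bet _ _ _ * _) => s t s0 t0 H3 H4 H5 H6.
have N0 : 0 < n.+1%:R :> R by rewrite ltr0n.
move: (n.+1%:R : R) N0 H3 => N N0 H3.
rewrite mulrAC ler_pdivrMr//.
have v0 : 0 < v by have : 0 < eps * Phi := mulr_gt0 eps0 Phi0; nra.
rewrite -(ler_pM2l v0).
have : eps * v <= N * u by apply: le_trans H3; rewrite ler_pM2l.
nra.
Qed.

(** Three bounds are combined: [a1] yields the factor [t / s], [a2] the gain from late splices, and
    [a3] says that, once the splice has occurred, [V_t < c] is less likely from the higher set [J]
    than from [I]. *)
Lemma grid_comparison nt' (y0 eps Phi c cu : R) (I J : set R) :
  (nt <= nt' <= n)%N -> 0 < eps -> 0 < Phi -> c <= 0 -> cu <= 0 ->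
  ((eps * Phi)%:E <= \sum_(nt' <= j < n.+1)
     pathQ h (cut_weight (Aev setT setT `]-oo, y0]) j) 1 n 0 lam)%E ->
  (vervaat_mass (Aev setT setT `]-oo, y0]) <= Phi%:E)%E ->
  measurable I -> measurable J -> I `<=` `]0, +oo[ -> J `<=` `]0, +oo[ ->
  (forall y, J y -> y0 <= y) -> (forall x y, I x -> J y -> x <= y) ->
  ((1 + (nt' - a)%:R / n.+1%:R * eps)%:E *
    (vervaat_mass (Aev setT `]-oo, c[ J) * vervaat_mass (Aev `]-oo, cu[ setT I)) <=
   (nt%:R / a.+1%:R)%:E *
    (vervaat_mass (Aev setT setT J) * vervaat_mass (Aev `]-oo, cu[ `]-oo, c[ I)))%E.
Proof.
have ant' : (nt <= nt' <= n)%N -> (a < nt' <= n)%N by clear -nt_n; lia.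
move=> nt'n eps0 Phi0 c0 cu0 H1 H2 mI mJ I0 J0 Jy0 IJ; move: (ant' nt'n) => {}ant'.
have dom := gam_domination nt'n eps0 Phi0 H1 H2.
have CU0 (u : R) : u <= 0 -> `]-oo, u[ `<=` (`]-oo, 0[%classic : set R).
  by move=> u0 x /=; rewrite !in_itv/= => /lt_le_trans; apply.
set C := `]-oo, c[%classic; set U := `]-oo, cu[%classic.
have mC : measurable C by exact: measurable_itv.
have mU : measurable U by exact: measurable_itv.
rewrite !Vsum_intJ//.
have sumU C' : measurable C' -> intJ I (fun z => (\sum_(0 <= j < n.+1)
  bet U j z * gam C' j z)%R) =
    intJ I (fun z => (al U z * gam C' 0 z)%R).
  by move=> mC'; congr intJ; apply/funext => z; rewrite sum_al//; exact: CU0.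
rewrite !sumU//.
have mS C' : measurable C' -> measurable_fun setT (fun z => Sb z * gam C' 0 z).
  by move=> mC'; apply: measurable_funM; [exact: measurable_Sb|exact: measurable_gam].
have S0 C' z : measurable C' -> 0 <= Sb z * gam C' 0 z.
  by move=> mC'; rewrite mulr_ge0 ?Sb_ge0 ?gam_ge0.
have k0 : 0 <= nt%:R / a.+1%:R :> R by rewrite divr_ge0.
have k0' : 0 <= 1 + (nt' - a)%:R / n.+1%:R * eps :> R.
  by rewrite addr_ge0// mulr_ge0 ?divr_ge0// ltW.
have a1 : (intJ J (fun z => (\sum_(0 <= j < n.+1) bet setT j z * gam C j z)%R) <=
    (nt%:R / a.+1%:R)%:E * intJ J (fun z => (Sb z * gam C 0 z)%R))%E.
  rewrite -intJZ//; [|exact: mS|by move=> z; exact: S0].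
  apply: intJ_le => //.
  - by apply: measurable_sum => j; exact: measurable_bg.
  - by apply: measurable_funM => //; exact: mS.
  - by move=> z; apply: sumr_ge0 => j _; exact: bg_ge0.
  - by move=> z; rewrite mulr_ge0// S0.
  - by move=> z _; exact: sum_nu_le.
have a2 : ((1 + (nt' - a)%:R / n.+1%:R * eps)%:E * intJ J (fun z => (Sb z * gam setT 0 z)%R) <=
    intJ J (fun z => (\sum_(0 <= j < n.+1) bet setT j z * gam setT j z)%R))%E.
  rewrite -intJZ//; [|exact: mS|by move=> z; exact: S0].
  apply: intJ_le => //.
  - by apply: measurable_funM => //; exact: mS.
  - by apply: measurable_sum => j; exact: measurable_bg.
  - by move=> z; rewrite mulr_ge0// S0.
  - by move=> z; apply: sumr_ge0 => j _; exact: bg_ge0.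
  - move=> z Jz.
    rewrite (_ : (nt' - a)%:R / n.+1%:R * eps = (nt' - a)%:R * (eps / n.+1%:R));
      last by rewrite mulrAC -mulrA.
    apply: sum_tot_ge; [exact: ant'| |exact/dom/Jy0].
    by rewrite divr_ge0// ltW.
have a3 := @lr_intJ I J (gam C 0) (gam setT 0) Sb (al U) mI mJ
  (measurable_gam (measurable_itv _) 0) (measurable_gam measurableT 0)
  measurable_Sb (measurable_al (measurable_itv _))
  (gam_ge0 (measurable_itv _) 0) (gam_ge0 measurableT 0) Sb_ge0
  (fun z => al_ge0 z (measurable_itv _)) (lr_gamC c) IJ.
have i0 C' : measurable C' -> (0 <= intJ I (fun z => (al U z * gam C' 0 z)%R))%E.
  by move=> mC'; apply: intJ_ge0 => z; rewrite mulr_ge0 ?al_ge0 ?gam_ge0.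
apply: (@le_trans _ _ ((1 + (nt' - a)%:R / n.+1%:R * eps)%:E * ((nt%:R / a.+1%:R)%:E *
   (intJ J (fun z => (Sb z * gam setT 0 z)%R)
     * intJ I (fun z => (al U z * gam C 0 z)%R)%R)))%E).
  rewrite lee_wpmul2l ?lee_fin//.
  apply: le_trans (lee_wpmul2r (i0 _ measurableT) a1) _.
  by rewrite -muleA lee_wpmul2l ?lee_fin.
rewrite muleCA lee_wpmul2l ?lee_fin// muleA lee_wpmul2r ?i0//.
Qed.

End comparison.

(** * The bridge on a grid *)

Section ae_measure.
Context {R : realType} d (T : measurableType d) (P : probability T R).

Lemma ae_le_measure (X Y : set T) : measurable X -> measurable Y ->
  {ae P, forall w, X w -> Y w} -> (P X <= P Y)%E.
Proof.
move=> mX mY [N [mN PN sN]].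
have XYN : X `<=` Y `|` N.
  move=> w Xw; have [Yw|nYw] := pselect (Y w); [by left|right].
  by apply: sN => /= /(_ Xw).
apply: (le_trans (le_measure P _ _ XYN)); rewrite ?inE//; first exact: measurableU.
apply: (le_trans (measureU2 _ mY mN)).
rewrite -[leRHS]adde0; apply: leeD => //.
by rewrite le_eqVlt; apply/orP; left; apply/eqP; exact: PN.
Qed.

Lemma ae_eq_measure (X Y : set T) : measurable X -> measurable Y ->
  {ae P, forall w, X w <-> Y w} -> P X = P Y.
Proof.
move=> mX mY XY; apply/eqP; rewrite eq_le; apply/andP; split; apply: ae_le_measure => //.
  by apply: filterS XY => w [].
by apply: filterS XY => w [].
Qed.

End ae_measure.

Section bridge_grid.
Context {R : realType} d (T : measurableType d) (P : probability T R).
Variables (lam : R) (B : R -> {RV P >-> R}).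
Hypotheses (lam0 : lam < 0) (HB : is_brownian_bridge lam B).

Local Notation Phi := (bm_density 1 0 lam).

Definition mesh (n : nat) : R := n.+1%:R^-1.
Definition gridtime (n i : nat) : R := i%:R / n.+1%:R.

Lemma mesh_gt0 n : 0 < mesh n. Proof. by rewrite invr_gt0. Qed.

Definition gridval n i (w : T) : R := B (gridtime n i) w.

Definition gridtuple n (w : T) : n.-tuple R := [tuple gridval n i.+1 w | i < n].

Lemma measurable_gridval n i : measurable_fun setT (gridval n i).
Proof. exact: measurable_funP. Qed.

Lemma measurable_gridtuple n : measurable_fun setT (@gridtuple n).
Proof.
apply/measurable_fun_tnthP => i.
rewrite (_ : _ \o _ = gridval n i.+1); last first.
  by apply/funext => w /=; rewrite tnth_mktuple.
exact: measurable_gridval.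
Qed.

Lemma nth_gridtuple n w i : (i < n)%N -> nth 0 (gridtuple n w) i = gridval n i.+1 w.
Proof. by move=> ilt; rewrite -(tnth_nth _ _ (Ordinal ilt)) tnth_mktuple. Qed.

(** The finite-dimensional laws take sets indexed by times; the grid index is recovered from a time
    by [Num.trunc], exactly on grid times. *)
Lemma bm_fdd_to_grid n (A : nat -> set R) k a x : (a + k = n)%N ->
  (forall i, measurable (A i)) ->
  bm_fdd_to lam (fun t => A (Num.trunc (t * n.+1%:R))) (gridtime n a) x
    [seq gridtime n i | i <- iota a.+1 k] =
  pathQ (mesh n) (fun i => \1_(A i)) a.+1 k x lam.
Proof.
move=> + mA; elim: k a x => [|k IH] a x akn /=.
  have -> : 1 - gridtime n a = mesh n; last by [].
  have -> : a = n by lia.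
  rewrite /gridtime /mesh -[X in X - _](@divff _ n.+1%:R)// -mulrBl -[n.+1]addn1 natrD.
  by rewrite addrAC subrr add0r mul1r.
rewrite [LHS]integral_mkcond; apply: eq_integral => z _.
rewrite patchE IH; last by lia.
have -> : gridtime n a.+1 - gridtime n a = mesh n.
  by rewrite /gridtime /mesh -mulrBl -[a.+1]addn1 natrD addrAC subrr add0r mul1r.
have -> : Num.trunc (gridtime n a.+1 * n.+1%:R) = a.+1.
  by rewrite /gridtime divfK// natrK.
rewrite indicE; case: ifPn => _; rewrite ?mulr1// mulr0 mul0e//.
Qed.

Lemma gridtime_lt n i j : (i < j)%N -> gridtime n i < gridtime n j.
Proof. by move=> ij; rewrite /gridtime ltr_pM2r ?invr_gt0// ltr_nat. Qed.

Lemma gridtime0 n : gridtime n 0 = 0.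
Proof. by rewrite /gridtime mul0r. Qed.

Lemma gridtime_end n : gridtime n n.+1 = 1.
Proof. by rewrite /gridtime divff. Qed.

Lemma path_gridtime n k a : (a + k = n)%N ->
  path <%R (gridtime n a) (rcons [seq gridtime n i | i <- iota a.+1 k] 1).
Proof.
elim: k a => [|k IH] a akn /=.
  by rewrite andbT -(gridtime_end n) gridtime_lt//; lia.
by rewrite gridtime_lt//= IH//; lia.
Qed.

Lemma bridge_rect n (A : nat -> set R) : (forall i, measurable (A i)) ->
  (Phi%:E * P (@gridtuple n @^-1` rect 1 A) =
   pathQ (mesh n) (fun i => \1_(A i)) 1 n 0 lam)%E.
Proof.
move=> mA; rewrite muleC.
have := bridge_fdd HB (ts := [seq gridtime n i | i <- iota 1 n])
  (A := fun t => A (Num.trunc (t * n.+1%:R))).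
rewrite -[in path _ 0 _](gridtime0 n) path_gridtime// => /(_ isT) /(_ (fun t => mA _)).
rewrite -[X in bm_fdd_to _ _ X](gridtime0 n) bm_fdd_to_grid// => <-.
congr (P _ * _)%E; rewrite big_map.
apply/seteqP; split => w.
  move=> wA; rewrite -bigcap_seq => i /=; rewrite mem_iota => i1n.
  rewrite /preimage/= divfK// natrK.
  have := wA i.-1; rewrite nth_gridtuple; last by lia.
  by rewrite add1n prednK; [apply; lia|lia].
rewrite -bigcap_seq => wA i ilt; rewrite nth_gridtuple//.
have := wA i.+1; rewrite /= mem_iota /preimage/= divfK// natrK.
by rewrite add1n; apply; lia.
Qed.

Lemma bridge_tuple n (E : set (n.-tuple R)) : measurable E ->
  (Phi%:E * P (@gridtuple n @^-1` E) =
   tupI (mesh n) lam 0 (fun t => (\d_t E)%E))%E.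
Proof.
apply: (@tuple_lawE R (mesh n) lam _ T P Phi n 1 0 (@gridtuple n)).
- exact: mesh_gt0.
- exact: bm_density_ge0.
- exact: measurable_gridtuple.
- exact: bridge_rect.
Qed.

Definition grid_vervaat_event n A k : set T :=
  [set w | (k <= n.+1)%N /\ grid_vervaat_in n.+1 A k (fun i => gridval n i w)].

Lemma measurable_gridEv n A k : (forall i, measurable (A i)) ->
  measurable (grid_vervaat_event n A k).
Proof.
move=> mA; rewrite /grid_vervaat_event; case: (k <= n.+1)%N; last first.
  by rewrite (_ : mkset _ = set0)//; apply/seteqP; split => // w [].
rewrite (_ : mkset _ = [set w | grid_vervaat_in n.+1 A k ((gridval n) ^~ w)]).
  by apply: measurable_grid_vervaat_in => // i; exact: measurable_gridval.
by apply/seteqP; split => [w []//|w wk]; split.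
Qed.

Lemma eq_grid_vervaat_in N A k (b b' : nat -> R) : (k <= N)%N ->
  (forall i, (i <= N)%N -> b i = b' i) ->
  grid_vervaat_in N A k b -> grid_vervaat_in N A k b'.
Proof.
move=> kN bb' [[H1 H2] H3]; split; first split.
- by move=> i ik; rewrite -!bb'//; [exact: H1|lia].
- by move=> i iN; rewrite -!bb'//; exact: H2.
- move=> i iN; have := H3 i iN; rewrite /grid_vervaat; case: ifP => ikN.
    by rewrite !bb'.
  by rewrite !bb'//; lia.
Qed.

Lemma gridpath_gridtuple n w i : B 1 w = lam -> (i <= n.+1)%N ->
  gridpath lam (gridtuple n w) i = gridval n i w.
Proof.
move=> B1; case: i => [|i] ilt;
  first by rewrite gridpath0 /gridval gridtime0 (bridge_start HB).
have [iltn|] := ltnP i n; first by rewrite gridpathS// nth_gridtuple.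
move=> ni; have -> : i = n by lia.
by rewrite gridpath_end /gridval gridtime_end.
Qed.

Lemma gridEv_mass n A k : (0 < k <= n.+1)%N -> (forall i, measurable (A i)) ->
  (Phi%:E * P (grid_vervaat_event n A k) = pathQ (mesh n) (cut_weight lam A (n.+1 - k))
    1 n 0 lam)%E.
Proof.
move=> kn mA.
have mdV : measurable (@vervaat_tuples R lam n A k).
  apply: (measurable_grid_vervaat_in (b := fun i (t : n.-tuple R) => gridpath lam t i))
    => //.
  case=> [|i]; first exact: measurable_cst.
  have [ilt|ige] := ltnP i n.
    rewrite (_ : (fun t : n.-tuple R => _) = fun t => nth 0 t i);
      first exact: measurable_nth.
    by apply/funext => t; rewrite gridpathS.
  rewrite (_ : (fun t : n.-tuple R => _) = cst (if i == n then lam else 0));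
    first exact: measurable_cst.
  apply/funext => t; rewrite /gridpath/= nth_rcons size_tuple ltnNge ige/=.
  by case: eqP.
rewrite -(dV_pathQ (mesh_gt0 n) lam0 kn mA) -bridge_tuple//; congr (_ * _)%E.
(* [gridpath] ends at [lam] by construction, the bridge only almost surely. *)
apply: ae_eq_measure.
- exact: measurable_gridEv.
- by rewrite -[X in measurable X]setTI; exact: measurable_gridtuple.
apply: filterS (bridge_end HB) => w B1; split => [[_ wk]|wk].
  apply: eq_grid_vervaat_in wk; first by lia.
  by move=> i iN; rewrite gridpath_gridtuple.
split; first by lia.
apply: eq_grid_vervaat_in wk; first by lia.
by move=> i iN; rewrite gridpath_gridtuple.
Qed.

(** Almost surely the path ends at [lam < 0], below its initial value. This disposes of the only cut
    that [dV_pathQ] leaves out. *)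
Lemma gridEv0 n A : (forall i, measurable (A i)) -> P (grid_vervaat_event n A 0) = 0%E.
Proof.
move=> mA; rewrite -(measure0 P); apply: ae_eq_measure => //.
  exact: measurable_gridEv.
apply: filterS (bridge_end HB) => w B1; split => // -[_ [[_ H] _]].
have := H n.+1 (leqnn _); rewrite /gridval gridtime_end gridtime0 (bridge_start HB) B1.
by rewrite leNgt lam0.
Qed.

Lemma trivIset_gridEv n A : trivIset setT (grid_vervaat_event n A).
Proof.
apply/trivIsetP => i j _ _ ij; apply/seteqP; split => // w [].
wlog ltij : i j ij / (i < j)%N.
  move=> H; have [|ji|ijE] := ltngtP i j; first exact: H.
    by move=> Hi Hj; apply: (H j i) => //; rewrite eq_sym.
  by rewrite ijE eqxx in ij.
move=> [iN [[_ H1] _]] [jN [[H2 _] _]].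
by have := H1 j jN; rewrite leNgt H2.
Qed.

(** An argmin index at most [K] is a splice index at least [n + 1 - K]; the bound serves to select
    late splices. *)
Definition grid_vervaat_events n A K : set T := \big[setU/set0]_(k < K.+1)
  grid_vervaat_event n A k.

Lemma gridEvUP n A K w : grid_vervaat_events n A K w <->
  exists2 k, (k <= K)%N & grid_vervaat_event n A k w.
Proof.
rewrite /grid_vervaat_events -bigcup_mkord; split => [[k kK wk]|[k kK wk]]; by exists k.
Qed.

Lemma measurable_gridEvU n A K : (forall i, measurable (A i)) ->
  measurable (grid_vervaat_events n A K).
Proof. by move=> mA; apply: bigsetU_measurable => k _; exact: measurable_gridEv. Qed.

Lemma gridEvU_mass n A K : (K <= n.+1)%N -> (forall i, measurable (A i)) ->
  (Phi%:E * P (grid_vervaat_events n A K) =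
  \sum_(n.+1 - K <= j < n.+1) pathQ (mesh n) (cut_weight lam A j) 1 n 0 lam)%E.
Proof.
move=> Kn mA; rewrite /grid_vervaat_events measure_bigsetU//; last 2 first.
- by move=> k; exact: measurable_gridEv.
- exact: trivIset_gridEv.
rewrite big_ord_recl [X in (X + _)%E](_ : _ = 0%E) ?add0e; last exact: gridEv0.
rewrite ge0_sume_distrr//.
rewrite (eq_bigr (fun i : 'I_K => pathQ (mesh n) (cut_weight lam A (n.+1 - i.+1))
  1 n 0 lam)); last first.
  move=> i _; apply: etrans (gridEv_mass _ mA); first by rewrite lift0.
  by have := ltn_ord i; lia.
rewrite -(big_mkord xpredT (fun i => pathQ (mesh n) (cut_weight lam A (n.+1 - i.+1))
  1 n 0 lam)).
rewrite [RHS](_ : _ = \sum_(0 + (n.+1 - K) <= j < n.+1)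
  pathQ (mesh n) (cut_weight lam A j) 1 n 0 lam)%E; last by rewrite add0n.
rewrite big_addn; have -> : (n.+1 - (n.+1 - K) = K)%N by lia.
rewrite [RHS]big_nat_rev/= add0n.
rewrite !big_mkord; apply: eq_bigr => i _.
by have := ltn_ord i => iK; congr (pathQ _ (cut_weight _ _ _) _ _ _ _); lia.
Qed.

End bridge_grid.

(** * Cameron-Martin shifts *)

Section cameron_martin.
Context {R : realType} d (T : measurableType d) (P : probability T R).
Variables (lam : R) (B : R -> {RV P >-> R}).
Hypotheses (lam0 : lam < 0) (HB : is_brownian_bridge lam B).
Local Notation Phi := (bm_density 1 0 lam).
Local Notation gridtime := (@gridtime R).
Local Notation mesh := (@mesh R).

(* The covariance of the standard bridge, hence an element of its
   Cameron-Martin space, piecewise linear with a kink at [w]. *)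
Definition green (w u : R) : R := Num.min u w - u * w.

Lemma green_le w u : u <= w -> green w u = u * (1 - w).
Proof. by move=> uw; rewrite /green min_l//; ring. Qed.

Lemma green_ge w u : w <= u -> green w u = w * (1 - u).
Proof. by move=> uw; rewrite /green min_r//; ring. Qed.

Definition cm_const (c K : R) : R := expR (- (`|c| * (K + `|lam|) + c ^+ 2)).

Lemma cm_const_gt0 c K : 0 < cm_const c K.
Proof. exact: expR_gt0. Qed.

(** The slopes are [c * (1 - w)] before the kink [w] and [- (c * w)] after it, so the exponent
    equals [c * (x - w * lam) - c ^+ 2 * w * (1 - w) / 2], with [x] the value of the path at the
    kink. The mesh has disappeared. *)
Lemma tilt_exponent_green n k0 (c K : R) (t : n.-tuple R)
    (psi := fun i => c * green (gridtime n k0) (gridtime n i)) :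
  (0 < k0 <= n)%N -> `|nth 0 t k0.-1| <= K ->
  - (`|c| * (K + `|lam|) + c ^+ 2) <=
  tilt_exponent (mesh n) lam (fun i => (psi i.+1 - psi i) / mesh n) 0 0 t.
Proof.
move=> k0n tK; set w := gridtime n k0.
have w0 : 0 <= w by rewrite /w /gridtime divr_ge0.
have w1 : w <= 1.
  by rewrite /w /gridtime ler_pdivrMr// mul1r ler_nat; lia.
have stepE i : gridtime n i.+1 - gridtime n i = mesh n.
  by rewrite /gridtime /mesh -mulrBl -[i.+1]addn1 natrD addrAC subrr add0r mul1r.
have mesh0 : mesh n != 0 by rewrite gt_eqF// mesh_gt0.
have gt_mono i j : (i <= j)%N -> gridtime n i <= gridtime n j.
  by rewrite leq_eqVlt => /orP[/eqP ->//|/gridtime_lt/ltW].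
have s1 i : (i < k0)%N -> (psi i.+1 - psi i) / mesh n = c * (1 - w).
  move=> ik; rewrite /psi !green_le; [|exact/gt_mono/ltnW|exact: gt_mono].
  by rewrite -mulrBr -mulrBl stepE [mesh n * _]mulrC mulrA mulfK.
have s2 i : (k0 <= i)%N -> (psi i.+1 - psi i) / mesh n = - (c * w).
  move=> ik; rewrite /psi !green_ge; [|exact: gt_mono|apply: gt_mono; lia].
  rewrite -mulrBr -mulrBr (_ : 1 - gridtime n i.+1 - (1 - gridtime n i) = - mesh n).
    by rewrite mulrN mulrN mulNr -mulrA mulfK.
  by rewrite -(stepE i); ring.
have km : (k0.-1 < size t)%N by rewrite size_tuple; lia.
rewrite (@tilt_exponent2 _ _ lam (mesh_gt0 n) _ (c * (1 - w)) (- (c * w)) 0 k0.-1)//;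
  last 2 first.
- by move=> j jk; apply: s1; lia.
- by move=> j jk; apply: s2; lia.
rewrite size_tuple prednK; last by lia.
have wE : k0%:R * (mesh n / 2) = w / 2 by rewrite mulrA.
have wE' : (n - k0.-1)%:R * (mesh n / 2) = (1 - w) / 2.
  have -> : (n - k0.-1 = n.+1 - k0)%N by lia.
  rewrite natrB; last by lia.
  by rewrite mulrA mulrBl /mesh divff.
have wE2 : (k0%:R * (c * (1 - w)) ^+ 2 + (n - k0.-1)%:R * (- (c * w)) ^+ 2) * (mesh n / 2)
    = c ^+ 2 * w * (1 - w) / 2.
  transitivity ((k0%:R * (mesh n / 2)) * (c * (1 - w)) ^+ 2 +
     ((n - k0.-1)%:R * (mesh n / 2)) * (c * w) ^+ 2); first by ring.
  by rewrite wE wE'; field.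
rewrite wE2 subr0; move: (nth 0 t k0.-1) tK => x xK.
have -> : c * (1 - w) * x + - (c * w) * (lam - x) - c ^+ 2 * w * (1 - w) / 2 =
  c * (x - w * lam) - c ^+ 2 * (w * (1 - w) / 2) by field.
have h1 : `|c * (x - w * lam)| <= `|c| * (K + `|lam|).
  rewrite normrM ler_wpM2l// (le_trans (ler_normB _ _))// lerD// normrM.
  by rewrite (ger0_norm w0) ler_piMl.
have h2 : c ^+ 2 * (w * (1 - w) / 2) <= c ^+ 2.
  by rewrite ler_piMr ?sqr_ge0//; nra.
have := ler_norm (- (c * (x - w * lam))); rewrite normrN.
by set u := c * (x - w * lam) in h1 *; set v := _ / 2 in h2 *; lra.
Qed.

(** The density of the shift depends on the path through its value at the kink alone, so bounding
    this value by [K] bounds the density from below by a constant valid for all [n]. *)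
Lemma cameron_martin n k0 c K (E : set (n.-tuple R)) : (0 < k0 <= n)%N ->
  measurable E ->
  ((cm_const c K)%:E *
    P [set w | E (gridtuple B n w) /\ (`|B (gridtime n k0) w| <= K)%R] <=
   P [set w | E [tuple (gridval B n i.+1 w +
                 c * green (gridtime n k0) (gridtime n i.+1))%R | i < n]])%E.
Proof.
move=> k0n mE; pose psi i := c * green (gridtime n k0) (gridtime n i).
have Phi0 : 0 < Phi by exact: bm_density_gt0.
have psi0 : psi 0%N = 0.
  by rewrite /psi gridtime0 green_le ?mul0r ?mulr0// /gridtime divr_ge0.
have psiN : psi n.+1 = 0.
  rewrite /psi gridtime_end green_ge ?subrr ?mulr0//.
  by rewrite /gridtime ler_pdivrMr// mul1r ler_nat; lia.
have setE : [set w | E [tuple gridval B n i.+1 w + psi i.+1 | i < n]] =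
    gridtuple B n @^-1` (@tshift R psi 1 n @^-1` E).
  apply/seteqP; split => w; rewrite /preimage/=; congr E; apply: eq_from_tnth => i;
  by rewrite !tnth_mktuple.
rewrite setE.
pose EK := E `&` [set t : n.-tuple R | `|nth 0 t k0.-1| <= K].
have mEK : measurable EK.
  apply: measurableI => //.
  rewrite (_ : mkset _ = (fun t : n.-tuple R => nth 0 t k0.-1) @^-1` `[- K, K]%classic).
    by rewrite -[X in measurable X]setTI; exact: measurable_nth.
  by apply/seteqP; split => t; rewrite /preimage/= in_itv/= ler_norml.
have -> : [set w | E (gridtuple B n w) /\ `|B (gridtime n k0) w|
  <= K] = gridtuple B n @^-1` EK.
  have e w : nth 0 (gridtuple B n w) k0.-1 = B (gridtime n k0) w.
    by rewrite nth_gridtuple; [rewrite prednK//; lia|lia].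
  by apply/seteqP; split => w; rewrite /preimage/EK/= e.
rewrite -(@lee_pmul2l _ Phi%:E)//.
have msE : measurable (@tshift R psi 1 n @^-1` E).
  by rewrite -[X in measurable X]setTI; exact: measurable_tshift.
rewrite muleCA !(bridge_tuple lam0 HB)//.
rewrite [leRHS](@eq_tupI R (mesh n) lam n 0 _ (fun t => \d_(tshift psi 1 t) E)%E);
  last first.
  by move=> t; rewrite !diracE.
have := @tupI_tilt R (mesh n) lam (mesh_gt0 n) psi n 0 0 (fun t => \d_t E)%E
  (measurable_dirac mE) (fun t => measure_ge0 _ E) psiN => ->; rewrite psi0 addr0.
rewrite -tupIZl ?mesh_gt0//; [|exact: expR_ge0|exact: measurable_dirac].
apply: tupI_le; first exact: mesh_gt0.
- by apply: emeasurable_funM => //; exact: measurable_dirac.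
- apply: emeasurable_funM; last exact: measurable_dirac.
  apply/measurable_EFinP; apply: measurableT_comp => //.
  by apply: measurable_tilt_exponent.
- by move=> t; rewrite mule_ge0// lee_fin expR_ge0.
- move=> t; rewrite !diracE -!EFinM lee_fin.
  case: (boolP (t \in EK)) => [/set_mem [Et tK]|_];
    last by rewrite mulr0 mulr_ge0 ?expR_ge0.
  by rewrite mem_set// !mulr1 ler_expR; exact: tilt_exponent_green.
Qed.

End cameron_martin.

(** * Uniqueness of the minimum *)

Section limits_of_events.
Context {R : realType} d (T : measurableType d) (P : probability T R).

Definition pr (A : set T) : R := fine (P A).

Lemma prE A : measurable A -> (pr A)%:E = P A.
Proof. by move=> mA; rewrite /pr fineK// fin_num_measure. Qed.

Lemma pr_ge0 A : 0 <= pr A.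
Proof. exact/fine_ge0/measure_ge0. Qed.

Lemma pr_setC A : measurable A -> pr (~` A) = 1 - pr A.
Proof.
move=> mA; apply: EFin_inj; rewrite prE; last exact: measurableC.
by rewrite probability_setC// -prE.
Qed.

(** Fatou's lemma for events, with an error term so that it combines with other eventual
    conditions. *)
Lemma pr_liminf (D : set T) (X : nat -> set T) (eps : R) :
  measurable D -> (forall n, measurable (X n)) ->
  {ae P, forall w, D w -> \forall n \near \oo, X n w} -> 0 < eps ->
  \forall n \near \oo, pr D <= pr (X n) + eps.
Proof.
move=> mD mX DX eps0.
pose E n := \bigcap_(m in [set m | (n <= m)%N]) X m.
have mE n : measurable (E n) by apply: bigcap_measurableType => // m _.
have ndE : nondecreasing_seq E.
  by move=> m n mn; apply/subsetPset => w Ew k nk; apply: Ew; exact: leq_trans nk.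
have mUE : measurable (\bigcup_n E n) by exact: bigcup_measurable.
have DE : (P D <= P (\bigcup_n E n))%E.
  apply: ae_le_measure => //; apply: filterS DX => w H /H [n _ nX].
have cvE : (P \o E) x @[x --> \oo] --> (pr (\bigcup_n E n))%:E.
  by rewrite prE//; exact: nondecreasing_cvg_mu.
have lt : pr (\bigcup_n E n) - eps < pr (\bigcup_n E n) by rewrite ltrBlDr ltrDl.
have Hlt := cvgr_gt _ (fine_cvg cvE) _ lt; near=> n.
have /ltW : pr (\bigcup_n E n) - eps < fine (P (E n)) by near: n; exact: Hlt.
rewrite lerBlDr => H.
apply: (@le_trans _ _ (pr (\bigcup_n E n))); first by rewrite -lee_fin !prE.
apply: le_trans H _; rewrite lerD2r -lee_fin.
have -> : fine (P (E n)) = pr (E n) by [].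
rewrite !prE// le_measure ?inE//.
by move=> w; apply => /=.
Unshelve. all: end_near. Qed.

Lemma pr_limsup (D : set T) (X : nat -> set T) (eps : R) :
  measurable D -> (forall n, measurable (X n)) ->
  {ae P, forall w, \forall n \near \oo, X n w -> D w} -> 0 < eps ->
  \forall n \near \oo, pr (X n) <= pr D + eps.
Proof.
move=> mD mX XD eps0.
have := @pr_liminf (~` D) (fun n => ~` X n) eps (measurableC mD)
  (fun n => measurableC (mX n)) _ eps0.
rewrite pr_setC// => H.
have {}H : \forall n \near \oo, 1 - pr D <= pr (~` X n) + eps.
  apply: H; apply: filterS XD => w + nDw; apply: filterS => n XDn /XDn; exact: nDw.
by apply: filterS H => n; rewrite pr_setC//; lra.
Qed.

Lemma pr_cvg (D : set T) (X : nat -> set T) (eps : R) :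
  measurable D -> (forall n, measurable (X n)) ->
  {ae P, forall w, \forall n \near \oo, X n w <-> D w} -> 0 < eps ->
  \forall n \near \oo, `|pr (X n) - pr D| <= eps.
Proof.
move=> mD mX XD eps0; near=> n; rewrite ler_distl lerBlDr; apply/andP; split.
  near: n; apply: pr_liminf => //; apply: filterS XD => w H Dw.
  by apply: filterS H => n -[_]; exact.
near: n; apply: pr_limsup => //; apply: filterS XD => w H.
by apply: filterS H => n -[].
Unshelve. all: end_near. Qed.

End limits_of_events.

Section near_ties.
Context {R : realType}.

(** The minima over [S1] and [S2] agree up to [delta], put as a finite combination of comparisons
    between two values, whence measurability. *)
Definition near_tie N (S1 S2 : pred nat) (delta : R) (x : nat -> R) :=
  (forall i, (i <= N)%N -> S1 i -> exists j, [/\ (j <= N)%N, S2 j & x j <= x i + delta]) /\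
  (forall j, (j <= N)%N -> S2 j -> exists i, [/\ (i <= N)%N, S1 i & x i <= x j + delta]).

(** Passing from [c] to [c'] raises the minimum over [S2], relative to that over [S1], by at least
    [(c' - c) * (be - al)], which exceeds the two tolerances together. *)
Lemma near_tie_disjoint N (S1 S2 : pred nat) (delta : R) (x psi : nat ->
  R) (c c' al be : R) i0 :
  (i0 <= N)%N -> S1 i0 ->
  (forall i, (i <= N)%N -> S1 i -> psi i <= al) ->
  (forall i, (i <= N)%N -> S2 i -> be <= psi i) ->
  2 * delta < (c' - c) * (be - al) -> c <= c' ->
  near_tie N S1 S2 delta (fun i => x i + c * psi i) ->
  near_tie N S1 S2 delta (fun i => x i + c' * psi i) -> False.
Proof.
move=> i0N S10 psi1 psi2 dc cc' [_ H] [H' _].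
pose y (i : 'I_N.+1) := x i + c * psi i.
have i0N' : (i0 < N.+1)%N by [].
case: (@arg_minP _ _ _ (Ordinal i0N') (fun i : 'I_N.+1 => S1 i) y S10) => i S1i ymin.
have iN : (i <= N)%N by rewrite -ltnS.
have [j [jN S2j xj]] := H' i iN S1i.
have [i' [i'N S1i' xi']] := H j jN S2j.
have i'N' : (i' < N.+1)%N by [].
have := ymin (Ordinal i'N') S1i'; rewrite /y /= leNgt => /negP; apply.
have h1 := psi1 i iN S1i; have h2 := psi2 j jN S2j.
have : (c' - c) * (be - al) <= (c' - c) * (psi j - psi i).
  by rewrite ler_wpM2l ?subr_ge0// lerB.
nra.
Qed.

Lemma measurable_near_tie d (T : measurableType d) (b : nat -> T ->
  R) N (S1 S2 : pred nat) (delta : R) :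
  (forall i, measurable_fun setT (b i)) ->
  measurable [set w | near_tie N S1 S2 delta (b ^~ w)].
Proof.
move=> mb.
have mle i j : measurable [set w | b j w <= b i w + delta].
  rewrite (_ : mkset _ = (fun w => b i w + delta - b j w) @^-1` `[0, +oo[%classic).
    rewrite -[X in measurable X]setTI.
    by apply: measurable_funB => //; exact: measurable_funD.
  by apply/seteqP; split => w; rewrite /= in_itv/= andbT subr_ge0.
have half (S S' : pred nat) : measurable [set w | forall i, (i <= N)%N -> S i ->
    exists j, [/\ (j <= N)%N, S' j & b j w <= b i w + delta]].
  rewrite (_ : mkset _ = \bigcap_(i in [set i | (i <= N)%N /\ S i])
     \bigcup_(j in [set j | (j <= N)%N /\ S' j]) [set w | b j w <= b i w + delta]).
    apply: bigcap_measurableType => i _; apply: bigcup_measurable => j _; exact: mle.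
  apply/seteqP; split => w H.
    by move=> i [iN Si]; have [j [jN Sj bj]] := H i iN Si; exists j.
  by move=> i iN Si; have [j [jN Sj] bj] := H i (conj iN Si); exists j.
exact: (measurableI _ _ (half S1 S2) (half S2 S1)).
Qed.

Context d (T : measurableType d) (P : probability T R).
Variables (lam : R) (B : R -> {RV P >-> R}).
Hypotheses (lam0 : lam < 0) (HB : is_brownian_bridge lam B).

Lemma measurable_gridpath n i : measurable_fun setT (fun t : n.-tuple R => gridpath lam t i).
Proof.
case: i => [|i]; first exact: measurable_cst.
have [ilt|ige] := ltnP i n.
  rewrite (_ : (fun t : n.-tuple R => _) = fun t => nth 0 t i); first exact: measurable_nth.
  by apply/funext => t; rewrite gridpathS.
rewrite (_ : (fun t : n.-tuple R => _) = cst (if i == n then lam else 0));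
  first exact: measurable_cst.
apply/funext => t; rewrite /gridpath/= nth_rcons size_tuple ltnNge ige/=.
by case: eqP.
Qed.

(* The near-tie events for the paths shifted by [j / q] times [green] are
   disjoint, and each retains a fixed fraction of the probability. *)
Lemma near_tie_prob n k0 (S1 S2 : pred nat) (delta al be K : R) q i0 : (0 < k0 <= n)%N ->
  (0 < q)%N ->
  (i0 <= n.+1)%N -> S1 i0 ->
  (forall i, (i <= n.+1)%N -> S1 i -> green (gridtime n k0) (gridtime n i) <= al) ->
  (forall i, (i <= n.+1)%N -> S2 i -> be <= green (gridtime n k0) (gridtime n i)) ->
  al < be -> 2 * delta < (be - al) / q%:R -> 0 <= K ->
  pr P [set w | near_tie n.+1 S1 S2 delta (gridpath lam (gridtuple B n w)) /\
     `|B (gridtime n k0) w| <= K] <= (q%:R * cm_const lam 1 K)^-1.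
Proof.
move=> k0n q0 i0n S10 g1 g2 albe dq K0.
set X := mkset _.
pose psi i : R := green (gridtime n k0) (gridtime n i).
pose E : set (n.-tuple R) := [set t | near_tie n.+1 S1 S2 delta (gridpath lam t)].
have mE : measurable E.
  by apply: (measurable_near_tie (b := fun i (t : n.-tuple R) => gridpath lam t i)) => i;
    exact: measurable_gridpath.
pose b c w := [tuple gridval B n i.+1 w + c * psi i.+1 | i < n].
have mb c : measurable_fun setT (b c).
  apply/measurable_fun_tnthP => i.
  rewrite (_ : _ \o _ = fun w => gridval B n i.+1 w + c * psi i.+1); last first.
    by apply/funext => w /=; rewrite tnth_mktuple.
  by apply: measurable_funD => //; exact: measurable_gridval.
have psi0 : psi 0%N = 0 by rewrite /psi gridtime0 green_le ?mul0r// /gridtime divr_ge0.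
have psiN : psi n.+1 = 0.
  rewrite /psi gridtime_end green_ge ?subrr ?mulr0//.
  by rewrite /gridtime ler_pdivrMr// mul1r ler_nat; lia.
have bE c w i : (i <= n.+1)%N ->
    gridpath lam (b c w) i = gridpath lam (gridtuple B n w) i + c * psi i.
  case: i => [|i] ilt; first by rewrite !gridpath0 psi0 mulr0 addr0.
  have [iltn|ni] := ltnP i n.
    by rewrite !gridpathS// -!(tnth_nth _ _ (Ordinal iltn)) !tnth_mktuple.
  by rewrite (_ : i = n); [rewrite !gridpath_end psiN mulr0 addr0|lia].
pose F j := [set w | E (b (j%:R / q%:R) w)].
have mF j : measurable (F j).
  by rewrite /F -[X in measurable X]setTI; exact: mb.
have tF : trivIset setT F.
  apply/trivIsetP => i j _ _ ij; apply/seteqP; split => // w [].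
  wlog ltij : i j ij / (i < j)%N.
    move=> H; have [|ji|ijE] := ltngtP i j; first exact: H.
      by move=> Hi Hj; apply: (H j i) => //; rewrite eq_sym.
    by rewrite ijE eqxx in ij.
  have ext c w' : E (b c w') -> near_tie n.+1 S1 S2 delta
      (fun i => gridpath lam (gridtuple B n w') i + c * psi i).
    move=> [H1 H2]; split => k kN Sk.
      have [l [lN Sl le]] := H1 k kN Sk; exists l; split => //.
      by move: le; rewrite !bE.
    have [l [lN Sl le]] := H2 k kN Sk; exists l; split => //.
    by move: le; rewrite !bE.
  move=> /ext Hi /ext Hj.
  apply: (near_tie_disjoint i0n S10 g1 g2 _ _ Hi Hj); last first.
    by rewrite ler_wpM2r ?invr_ge0// ler_nat ltnW.
  have ij1 : q%:R^-1 <= j%:R / q%:R - i%:R / q%:R :> R.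
    by rewrite -mulrBl ler_peMl ?invr_ge0// lerBrDr addrC natr1 ler_nat.
  by apply: lt_le_trans dq _; rewrite mulrC ler_wpM2r// subr_ge0 ltW.
have mX1 : measurable [set w | near_tie n.+1 S1 S2 delta (gridpath lam (gridtuple B n w))].
  apply: (measurable_near_tie (b := fun i w => gridpath lam (gridtuple B n w) i)) => i.
  have mg := @measurable_gridtuple _ _ _ _ B n.
  have mp := @measurable_gridpath n i.
  exact: (measurableT_comp mp mg).
have mX2 : measurable [set w | `|B (gridtime n k0) w| <= K].
  rewrite (_ : mkset _ = B (gridtime n k0) @^-1` `[- K, K]%classic).
    by rewrite -[X in measurable X]setTI; exact: measurable_funP.
  by apply/seteqP; split => t; rewrite /preimage/= in_itv/= ler_norml.
have mX : measurable X by exact: measurableI.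
(* All the shifts have size at most 1, and [cm_const] decreases with the size, so its value at 1
   serves for all of them. *)
have lowF j : (j < q)%N -> cm_const lam 1 K * pr P X <= pr P (F j).
  move=> jq; apply: (@le_trans _ _ (cm_const lam (j%:R / q%:R) K * pr P X)).
    rewrite ler_wpM2r ?pr_ge0// ler_expR lerN2.
    have j0 : 0 <= j%:R / q%:R :> R by rewrite divr_ge0.
    have j1 : j%:R / q%:R <= 1 :> R.
      by rewrite ler_pdivrMr ?ltr0n// mul1r ler_nat ltnW.
    rewrite (ger0_norm j0) normr1 expr1n lerD//; last first.
      by rewrite expr_le1.
    by rewrite ler_wpM2r// addr_ge0.
  rewrite -lee_fin EFinM !prE//.
  exact: (@cameron_martin R d T P lam B lam0 HB n k0 (j%:R / q%:R) K E k0n mE).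
have sumF : \sum_(j < q) pr P (F j) <= 1.
  rewrite -lee_fin -sumEFin; under eq_bigr do rewrite prE//.
  rewrite -measure_bigsetU//; apply: probability_le1.
  by apply: bigsetU_measurable.
rewrite -[leRHS]mul1r ler_pdivlMr ?mulr_gt0 ?ltr0n ?cm_const_gt0//.
apply: le_trans sumF; rewrite mulrC -mulrA.
rewrite mulr_natl -[X in _ *+ X](card_ord q) -sumr_const.
by apply: ler_sum => j _; exact: lowF.
Qed.

End near_ties.

Section continuous_paths.
Context {R : realType}.
Implicit Types (f : R -> R) (x y t : R).

Definition cont01 f := forall x, 0 <= x <= 1 -> forall e : R, 0 < e ->
  exists2 del : R, 0 < del & forall y, 0 <= y <= 1 -> `|x - y| < del -> `|f x - f y| < e.

Lemma cont01P f : {within `[0, 1], continuous f} -> cont01 f.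
Proof.
move=> /subspace_continuousP cf x x01 e e0.
have /cvgrPdist_lt /(_ e e0) := cf x x01.
rewrite /within => /nbhs_ballP[del /= del0 H].
by exists del => // y y01 xy; apply: H.
Qed.

Lemma argmin_itv f a b : {within `[0, 1], continuous f} -> 0 <= a -> a <= b -> b <= 1 ->
  exists2 c, a <= c <= b & forall t, a <= t <= b -> f c <= f t.
Proof.
move=> cf a0 ab b1.
have [|c cab cmin] := @EVT_min R f a b ab.
  apply: continuous_subspaceW cf; apply: subset_itv; rewrite ?bnd_simp//.
by exists c => // t tab; apply: cmin; rewrite in_itv.
Qed.

Lemma first_argminP f : {within `[0, 1], continuous f} -> argmin01 f (first_argmin f).
Proof.
move=> cf; have cf' := cont01P cf.
have [c c01 cmin] := argmin_itv cf (lexx 0) ler01 (lexx 1).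
have ac : argmin01 f c by [].
have lb0 : lbound (argmin01 f) 0 by move=> t [] /andP[].
have hi : has_inf (argmin01 f) by split; [exists c|exists 0].
set tau := first_argmin f.
have tau0 : 0 <= tau by apply: lb_le_inf => //; exists c.
have tauc s : argmin01 f s -> tau <= s by move=> as_; apply: ge_inf => //; case: hi.
have tau1 : tau <= 1 by apply: le_trans (tauc _ ac) _; case/andP: c01.
have tau01 : 0 <= tau <= 1 by rewrite tau0.
split => // s s01; rewrite leNgt; apply/negP => lt.
have [del del0 H] := cf' _ tau01 (f tau - f s) ltac:(by rewrite subr_gt0).
have [e [e01 emin] elt] := inf_adherent del0 hi.
have te := tauc e (conj e01 emin).
have := H e e01; rewrite distrC ger0_norm ?subr_ge0// ltrBlDr addrC => /(_ elt).
have := emin s s01; have := ler_norm (f tau - f e); lra.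
Qed.

Lemma first_argmin_itv f : {within `[0, 1], continuous f} -> 0 <= first_argmin f <= 1.
Proof. by move/first_argminP => -[]. Qed.

Lemma first_argmin_le f s : argmin01 f s -> first_argmin f <= s.
Proof.
by move=> as_; apply: ge_inf => //; exists 0 => t [] /andP[].
Qed.

Definition cyclic_shift f (tau t : R) : R :=
  if t <= 1 - tau then f (tau + t) - f tau else f (tau + t - 1) + f 1 - f tau.

Definition clamp x : R := Num.max 0 (Num.min x 1).

Lemma clamp_itv x : 0 <= clamp x <= 1.
Proof. by rewrite /clamp le_max lexx/= ge_max ler01/= ge_min lexx orbT. Qed.

Lemma clamp_lip x y : `|clamp x - clamp y| <= `|x - y|.
Proof.
have h1 := ler_norm (x - y); have h2 := ler_norm (y - x); rewrite distrC in h2.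
rewrite /clamp ler_norml.
by case: (leP x 1) => ?; case: (leP y 1) => ?; case: (leP 0 x) => ?; case: (leP 0 y) => ?;
  rewrite ?ler01 ?ltr01 ?(max_r _) ?(max_l _)//; apply/andP; split; lra.
Qed.

(** Clamping sends one of the two arguments to an end point, where [f] is 0 or [f 1]. The two
    branches merge into one expression, from which continuity in [tau] is read off also at the
    junction. *)
Lemma cyclic_shiftE f tau t : f 0 = 0 -> 0 <= tau <= 1 -> 0 <= t <= 1 ->
  cyclic_shift f tau t = f (clamp (tau + t)) + f (clamp (tau + t - 1)) - f tau.
Proof.
move=> f0 /andP[tau0 tau1] /andP[t0 t1]; rewrite /cyclic_shift lerBrDl.
case: leP => tt; rewrite /clamp.
  have -> : Num.min (tau + t) 1 = tau + t by rewrite min_l.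
  have -> : Num.min (tau + t - 1) 1 = tau + t - 1 by rewrite min_l//; lra.
  rewrite [Num.max _ _]max_r; last lra.
  rewrite max_l; last lra.
  by rewrite f0 addr0.
have -> : Num.min (tau + t) 1 = 1 by rewrite min_r// ltW.
have -> : Num.min (tau + t - 1) 1 = tau + t - 1 by rewrite min_l//; lra.
rewrite max_r// [Num.max _ _]max_r; last lra.
by rewrite [f _ + f 1]addrC.
Qed.

Lemma cyclic_shift_cont f tau t : {within `[0, 1], continuous f} -> f 0 = 0 ->
  0 <= tau <= 1 -> 0 <= t <= 1 -> forall e : R, 0 < e ->
  exists2 del : R, 0 < del & forall tau', 0 <= tau' <= 1 -> `|tau - tau'| < del ->
    `|cyclic_shift f tau t - cyclic_shift f tau' t| < e.
Proof.
move=> /cont01P cf f0 tau01 t01 e e0.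
have e3 : 0 < e / 3 by rewrite divr_gt0.
have [d1 d10 H1] := cf _ (clamp_itv (tau + t)) _ e3.
have [d2 d20 H2] := cf _ (clamp_itv (tau + t - 1)) _ e3.
have [d3 d30 H3] := cf _ tau01 _ e3.
exists (Num.min d1 (Num.min d2 d3)); first by rewrite !lt_min d10 d20.
move=> tau' tau'01; rewrite !lt_min => /and3P[l1 l2 l3].
rewrite !cyclic_shiftE//.
have h1 := H1 (clamp (tau' + t)) (clamp_itv _).
have {}h1 := h1 (le_lt_trans (clamp_lip _ _) _).
rewrite (_ : tau + t - (tau' + t) = tau - tau') in h1; last by ring.
have h2 := H2 (clamp (tau' + t - 1)) (clamp_itv _).
have {}h2 := h2 (le_lt_trans (clamp_lip _ _) _).
rewrite (_ : tau + t - 1 - (tau' + t - 1) = tau - tau') in h2; last by ring.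
have h3 := H3 tau' tau'01 l3.
move: (h1 l1) (h2 l2) h3; rewrite !ltr_norml => /andP[? ?] /andP[? ?] /andP[? ?].
apply/andP; split; lra.
Qed.

End continuous_paths.

Section dyadic.
Context {R : realType}.
Local Notation gridtime := (@gridtime R).

(* [lev m] interior points cut [0, 1] into [2 ^ m] intervals. *)
Definition lev m := (2 ^ m).-1.
Lemma levS m : (lev m).+1 = (2 ^ m)%N.
Proof. by rewrite prednK// expn_gt0. Qed.

Definition dy m i : R := gridtime (lev m) i.

Lemma dyE m i : dy m i = i%:R / (2 ^ m)%:R.
Proof. by rewrite /dy /gridtime levS. Qed.

Lemma pow2_gt0 m : 0 < (2 ^ m)%:R :> R.
Proof. by rewrite ltr0n expn_gt0. Qed.

Lemma dy_ge0 m i : 0 <= dy m i.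
Proof. by rewrite dyE divr_ge0. Qed.

Lemma dy_le1 m i : (dy m i <= 1) = (i <= 2 ^ m)%N.
Proof. by rewrite dyE ler_pdivrMr ?pow2_gt0// mul1r ler_nat. Qed.

Lemma dy_itv m i : (i <= 2 ^ m)%N -> 0 <= dy m i <= 1.
Proof. by move=> im; rewrite dy_ge0 dy_le1. Qed.

Lemma ler_dy m i j : (dy m i <= dy m j) = (i <= j)%N.
Proof. by rewrite !dyE ler_pM2r ?invr_gt0 ?pow2_gt0// ler_nat. Qed.

Lemma ltr_dy m i j : (dy m i < dy m j) = (i < j)%N.
Proof. by rewrite !dyE ltr_pM2r ?invr_gt0 ?pow2_gt0// ltr_nat. Qed.

Lemma dyD m i j : dy m (i + j) = dy m i + dy m j.
Proof. by rewrite !dyE natrD mulrDl. Qed.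

Lemma dy_end m : dy m (2 ^ m) = 1.
Proof. by rewrite dyE divff// gt_eqF// pow2_gt0. Qed.

Lemma dyB m i j : (j <= i)%N -> dy m (i - j) = dy m i - dy m j.
Proof. by move=> ji; rewrite !dyE natrB// mulrBl. Qed.

Lemma dy0 m : dy m 0 = 0. Proof. by rewrite dyE mul0r. Qed.

Lemma dy_refine m m' i : (m <= m')%N -> dy m i = dy m' (i * 2 ^ (m' - m)).
Proof.
move=> mm'; rewrite !dyE; apply/eqP.
have nz k : (2 ^ k)%:R != 0 :> R by rewrite gt_eqF// pow2_gt0.
by rewrite eqr_div// -!natrM -mulnA -expnD subnK.
Qed.

Definition dyfl m (x : R) := Num.trunc (x * (2 ^ m)%:R).

Lemma dyflP m x : 0 <= x -> dy m (dyfl m x) <= x < dy m (dyfl m x).+1.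
Proof.
move=> x0; have := @truncn_itv R (x * (2 ^ m)%:R) (mulr_ge0 x0 (ltW (pow2_gt0 m))).
by rewrite !dyE ler_pdivrMr ?pow2_gt0// ltr_pdivlMr ?pow2_gt0.
Qed.

Lemma dyfl_dist m x : 0 <= x -> `|x - dy m (dyfl m x)| < dy m 1.
Proof.
move=> x0; have /andP[h1 h2] := dyflP m x0.
rewrite ger0_norm ?subr_ge0// ltrBlDr -dyD add1n//.
Qed.

Lemma dyfl_le m x : 0 <= x <= 1 -> (dyfl m x <= 2 ^ m)%N.
Proof.
by move=> /andP[x0 x1]; have /andP[h1 h2] := dyflP m x0; rewrite -dy_le1 (le_trans h1).
Qed.

Lemma dy1_near (e : R) : 0 < e -> \forall m \near \oo, dy m 1 < e.
Proof.
move=> e0; have := near_infty_natSinv_expn_lt (PosNum e0) => /=.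
apply: filterS => m; rewrite dyE !div1r natrX//.
Qed.

End dyadic.

Section unique_argmin.
Context {R : realType} d (T : measurableType d) (P : probability T R).
Variables (lam : R) (B : R -> {RV P >-> R}).
Hypotheses (lam0 : lam < 0) (HB : is_brownian_bridge lam B).
Local Notation path w := (fun u => B u w).
Local Notation gridtime := (@gridtime R).

(** Besides the interior points of [S], this covers an end point of [[0, 1]] taken alone, since it
    lies on the grids of all levels. *)
Definition dyadic_adherent (S : pred R) (tau : R) :=
  forall e : R, 0 < e -> \forall m \near \oo,
    exists i, [/\ (i <= 2 ^ m)%N, S (dy m i) & `|tau - dy m i| < e].

(** Near ties of tolerance [del q] have probability of order [1 / q] at all levels, while an exact
    tie is a near tie for every [q] at all fine levels. The bound on the value at the kink is lifted
    by taking countably many [K]. *)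
Lemma no_tie (S1 S2 : pred R) m0 k0 i0 (al be : R) :
  (0 < k0 < 2 ^ m0)%N -> (i0 <= 2 ^ m0)%N -> S1 (dy m0 i0) ->
  (forall u : R, 0 <= u <= 1 -> S1 u -> green (dy m0 k0) u <= al) ->
  (forall u : R, 0 <= u <= 1 -> S2 u -> be <= green (dy m0 k0) u) ->
  al < be ->
  {ae P, forall w, ~ exists tau1 tau2,
    [/\ argmin01 (path w) tau1, argmin01 (path w) tau2,
        dyadic_adherent S1 tau1 & dyadic_adherent S2 tau2]}.
Proof.
move=> k0m i0m S10 g1 g2 albe.
pose kk m := (k0 * 2 ^ (m - m0))%N.
(* The factor 4, twice what is allowed, gives the strict inequality required by [near_tie_prob]. *)
pose del (q : nat) : R := (be - al) / (4 * q.+1%:R).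
pose X (K q m : nat) : set T := [set w |
   near_tie (2 ^ m) (fun i => S1 (dy m i)) (fun i => S2 (dy m i)) (del q)
     (gridpath lam (gridtuple B (lev m) w)) /\ `|B (dy m (kk m)) w| <= K%:R].
have mX K q m : measurable (X K q m).
  apply: measurableI.
    apply: (measurable_near_tie (b := fun i w => gridpath lam (gridtuple B (lev m) w) i))
      => i.
    have mg := @measurable_gridtuple _ _ _ _ B (lev m).
    exact: (measurableT_comp (@measurable_gridpath R lam _ i) mg).
  rewrite [X in measurable X](_ : _ = B (dy m (kk m)) @^-1` `[- K%:R, K%:R]%classic).
    by rewrite -[X in measurable X]setTI; exact: measurable_funP.
  by apply/seteqP; split => t; rewrite /preimage/= in_itv/= ler_norml.
have prX K q m : (m0 <= m)%N -> pr P (X K q m) <= (q.+1%:R * cm_const lam 1 K%:R)^-1.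
  move=> mm; rewrite /X -levS.
  have kkm : (0 < kk m <= lev m)%N.
    have p0 : (0 < 2 ^ (m - m0))%N by rewrite expn_gt0.
    rewrite /kk muln_gt0 p0 andbT; case/andP: k0m => -> k0m/=.
    by rewrite -ltnS levS -(subnKC mm) expnD subnKC// ltn_pmul2r.
  have i0S : dy m (i0 * 2 ^ (m - m0)) = dy m0 i0 :> R by rewrite [RHS](dy_refine _ mm).
  have wE : dy m (kk m) = dy m0 k0 :> R by rewrite [RHS](dy_refine _ mm).
  apply: (@near_tie_prob R d T P lam B lam0 HB (lev m) (kk m) _ _ (del q)
    al be _ q.+1 (i0 * 2 ^ (m - m0)) kkm) => //.
  - by rewrite levS -(subnKC mm) expnD subnKC// leq_mul2r i0m orbT.
  - by rewrite i0S.
  - move=> i; rewrite levS => im Si; rewrite -/(dy m (kk m)) wE; apply: g1 Si;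
    exact: dy_itv.
  - move=> i; rewrite levS => im Si; rewrite -/(dy m (kk m)) wE; apply: g2 Si;
    exact: dy_itv.
  - rewrite /del (_ : 2 * _ = (be - al) / q.+1%:R / 2); last first.
      have : q.+1%:R != 0 :> R by rewrite pnatr_eq0.
      by move: (q.+1%:R) => Q Q0; field.
    by rewrite ltr_pdivrMr// ltr_pMr ?divr_gt0 ?subr_gt0// ltr1n.
have del0 q : 0 < del q.
  by rewrite divr_gt0 ?subr_gt0// mulr_gt0.
pose D K q := \bigcup_n \bigcap_(m in [set m | (n <= m)%N]) X K q m.
have mD K q : measurable (D K q).
  by apply: bigcup_measurable => n _; apply: bigcap_measurableType => m _.
have prD K q : pr P (D K q) <= (q.+1%:R * cm_const lam 1 K%:R)^-1.
  apply/ler_addgt0Pl => e e0.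
  have := @pr_liminf _ _ _ P (D K q) (X K q) e (mD K q) (mX K q) _ e0.
  case=> [|n _ Hn].
    by apply: aeW => w [n _ wn]; exists n => // m /= nm; exact: wn.
  apply: (le_trans (Hn (maxn n m0) _)); first by rewrite /= leq_maxl.
  by rewrite addrC lerD2l prX// leq_maxr.
pose Z K := \bigcap_q D K q.
have mZ K : measurable (Z K) by apply: bigcap_measurableType => q _.
have PZ K : P (Z K) = 0%E.
  rewrite -prE//; congr EFin; apply/eqP; rewrite eq_le pr_ge0 andbT.
  apply/ler_addgt0Pl => e e0; rewrite addr0.
  have [q _ /(_ q (leqnn q))/= H] :=
    near_infty_natSinv_lt (PosNum (mulr_gt0 e0 (cm_const_gt0 lam 1 K%:R))).
  apply: (@le_trans _ _ (pr P (D K q))).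
    by rewrite -lee_fin !prE// le_measure ?inE// => w; exact.
  apply: (le_trans (prD K q)); rewrite invfM ler_pdivrMr ?cm_const_gt0//.
  exact: ltW.
have nZ : {ae P, forall w, forall K, ~ Z K w}.
  apply: ae_foralln => K; exists (Z K); split;
    [exact: mZ|exact: PZ|by move=> w /= /contrapT].
apply: filterS2 nZ (bridge_end HB) => w nZw B1 [t1 [t2 [at1 at2 d1 d2]]].
pose K := (Num.trunc `|B (dy m0 k0) w|).+1.
apply: (nZw K) => q _.
have [t101 _] := at1; have [t201 _] := at2.
have cB := cont01P (bridge_continuous HB (w:=w)).
have [e1 e10 H1] := cB t1 t101 (del q) (del0 q).
have [e2 e20 H2] := cB t2 t201 _ (del0 q).
have {}d1 := d1 e1 e10; have {}d2 := d2 e2 e20.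
have mm0 : \forall m \near \oo, (m0 <= m)%N by exists m0.
have [n _ Hn] := filterI mm0 (filterI d1 d2).
exists n => // m nm; have [mm [[i1 [i1m S1i /H1 l1]] [i2 [i2m S2i /H2 l2]]]] := Hn m nm.
split; last first.
  have -> : dy m (kk m) = dy m0 k0 :> R by rewrite [RHS](dy_refine _ mm).
  by apply/ltW; case/andP: (@truncn_itv R `|B (dy m0 k0) w| (normr_ge0 _)).
have near (t : R) i : argmin01 (path w) t -> `|B t w - B (dy m i) w| < del q ->
  (i <= 2 ^ m)%N ->
    forall j, (j <= 2 ^ m)%N -> gridpath lam (gridtuple B (lev m) w) i <=
      gridpath lam (gridtuple B (lev m) w) j + del q.
  move=> [_ tmin] lt im j jm.
  rewrite !(gridpath_gridtuple lam0 HB) ?levS// /gridval -!/(dy _ _).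
  have := tmin _ (@dy_itv R _ _ jm); move: lt; rewrite ltr_norml => /andP[]; lra.
split => [i im Si|j jm Sj].
  exists i2; split => //; apply: near at2 _ _ _ _ => //; apply: l2; exact: dy_itv.
exists i1; split => //; apply: near at1 _ _ _ _ => //; apply: l1; exact: dy_itv.
Qed.

Lemma dyadic_adherent_nbhs (S : pred R) (tau e : R) : 0 <= tau <= 1 -> 0 < e ->
  (forall u, 0 <= u <= 1 -> `|tau - u| < e -> S u) -> dyadic_adherent S tau.
Proof.
move=> tau01 e0 H e' e'0; have [tau0 _] := andP tau01.
have ee : 0 < Num.min e e' by rewrite lt_min e0.
apply: filterS (dy1_near ee) => m; rewrite lt_min => /andP[d1 d2].
have h := dyfl_dist m tau0; have hi := dyfl_le m tau01.
exists (dyfl m tau); split => //; last exact: lt_trans h d2.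
apply: H; [exact: dy_itv|exact: lt_trans h d1].
Qed.

(** With its kink at [dy m k], [green] is linear and increasing up to there. It separates the points
    between [dy m j] and [dy m k] from those before [dy m i], and also from the point 1, where it
    vanishes. *)
Lemma ae_no_tie m i j k :
  {ae P, forall w, (0 < j <= k)%N -> (k < 2 ^ m)%N -> ~ exists tau1 tau2,
    [/\ argmin01 (path w) tau1, argmin01 (path w) tau2,
      ((i < j)%N /\ dyadic_adherent [pred u | u <= dy m i] tau1) \/
       dyadic_adherent [pred u | 1 <= u] tau1 &
        dyadic_adherent [pred u | dy m j <= u <= dy m k] tau2]}.
Proof.
have [jk|njk] := boolP (0 < j <= k)%N; last exact: aeW.
have [km|nkm] := boolP (k < 2 ^ m)%N; last exact: aeW.
have [j0 jk'] := andP jk.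
have k0m : (0 < k < 2 ^ m)%N by rewrite km andbT; lia.
have k1 : 0 < 1 - dy m k :> R by rewrite subr_gt0 -(dy_end m) ltr_dy.
have g2 (u : R) : 0 <= u <= 1 -> [pred u | dy m j <= u <= dy m k] u ->
    dy m j * (1 - dy m k) <= green (dy m k) u.
  by move=> _ /= /andP[ju uk]; rewrite green_le// ler_wpM2r// ltW.
have be0 : 0 < dy m j * (1 - dy m k) :> R.
  by rewrite mulr_gt0// -(dy0 m) ltr_dy.
have H2 : {ae P, forall w, ~ exists tau1 tau2,
    [/\ argmin01 (path w) tau1, argmin01 (path w) tau2,
       dyadic_adherent [pred u | 1 <= u] tau1 &
        dyadic_adherent [pred u | dy m j <= u <= dy m k] tau2]}.
  apply: (@no_tie _ _ m k (2 ^ m)%N 0 (dy m j * (1 - dy m k)) k0m) => //=.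
    by rewrite dy_end.
  move=> u /andP[_ u1] u1'; have -> : u = 1 by apply/eqP; rewrite eq_le u1.
  by rewrite green_ge ?subrr ?mulr0// dy_le1 ltnW.
have H1 : {ae P, forall w, (i < j)%N -> ~ exists tau1 tau2,
    [/\ argmin01 (path w) tau1, argmin01 (path w) tau2,
       dyadic_adherent [pred u | u <= dy m i] tau1 &
        dyadic_adherent [pred u | dy m j <= u <= dy m k] tau2]}.
  have [ij|nij] := boolP (i < j)%N; last exact: aeW.
  have H : {ae P, forall w, ~ exists tau1 tau2,
    [/\ argmin01 (path w) tau1, argmin01 (path w) tau2,
       dyadic_adherent [pred u | u <= dy m i] tau1 &
        dyadic_adherent [pred u | dy m j <= u <= dy m k] tau2]}.
    apply: (@no_tie _ _ m k 0%N (dy m i * (1 - dy m k)) (dy m j * (1 - dy m k)) k0m) => //=.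
    - by rewrite ler_dy.
    - move=> u /andP[u0 _] ui; rewrite green_le; first by rewrite ler_wpM2r// ltW.
      by apply: (le_trans ui); rewrite ler_dy; lia.
    - by rewrite ltr_pM2r// ltr_dy.
  by apply: filterS H => w H _.
apply: filterS2 H1 H2 => w H1 H2 _ _ [t1 [t2 [a1 a2 [[ij d1]|d1] d2]]].
  by apply: H1 => //; exists t1, t2.
by apply: H2; exists t1, t2.
Qed.

(** If the later of two argmins is less than 1, a dyadic bracket around it that excludes the earlier
    one contradicts [ae_no_tie]. If it is 1, the bracket is put around the earlier one, which is
    positive because [B 0 = 0] exceeds [lam]. *)
Lemma ae_unique_argmin : {ae P, forall w tau1 tau2,
  argmin01 (path w) tau1 -> argmin01 (path w) tau2 -> tau1 = tau2}.
Proof.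
have H : {ae P, forall w m i j k, (0 < j <= k)%N -> (k < 2 ^ m)%N -> ~ exists tau1 tau2,
    [/\ argmin01 (path w) tau1, argmin01 (path w) tau2,
      ((i < j)%N /\ dyadic_adherent [pred u | u <= dy m i] tau1) \/
       dyadic_adherent [pred u | 1 <= u] tau1 &
        dyadic_adherent [pred u | dy m j <= u <= dy m k] tau2]}.
  apply: ae_foralln => m; apply: ae_foralln => i; apply: ae_foralln => j.
  apply: ae_foralln => k; exact: ae_no_tie.
apply: filterS2 H (bridge_end HB) => w H B1 t1 t2.
wlog : t1 t2 / t1 < t2.
  move=> wl a1 a2; have [lt|lt|//] := ltgtP t1 t2; first exact: wl.
  by apply/esym; apply: wl.
move=> t12 a1 a2; exfalso.
have [/andP[t10 t11] _] := a1; have [/andP[t20 t21] _] := a2.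
(* The bracket starts one cell early, so that it is a neighbourhood of [t] even when [t] is
   dyadic. *)
have brk (t : R) m : t < 1 -> 2 * dy m 1 < t -> dy m 1 < 1 - t ->
    [/\ (0 < (dyfl m t).-1 <= (dyfl m t).+1)%N, ((dyfl m t).+1 < 2 ^ m)%N,
     t - 2 * dy m 1 < dy m (dyfl m t).-1 &
     dyadic_adherent [pred u | dy m (dyfl m t).-1 <= u <= dy m (dyfl m t).+1] t].
  move=> t1' l1 l2.
  have dm0 : 0 < dy m 1 :> R by rewrite -(dy0 m) ltr_dy.
  have t0 : 0 < t by lra.
  have /andP[h1 h2] := dyflP m (ltW t0).
  have E : dy m (dyfl m t).+1 = dy m (dyfl m t) + dy m 1 :> R by rewrite -dyD addn1.
  have fl1 : (1 < dyfl m t)%N by rewrite -(@ltr_dy R m); lra.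
  have E' : dy m (dyfl m t).-1 = dy m (dyfl m t) - dy m 1 :> R.
    by rewrite -subn1 dyB// ltnW.
  split.
  - by clear -fl1; move: (dyfl m t) fl1 => k; lia.
  - by rewrite -(@ltr_dy R m) dy_end; lra.
  - by lra.
  - apply: (@dyadic_adherent_nbhs _ _ (Num.min (dy m 1) (dy m (dyfl m t).+1 - t))).
    + by apply/andP; split; lra.
    + by rewrite lt_min dm0 subr_gt0.
    + move=> u _; rewrite lt_min => /andP[]; rewrite !ltr_norml => /andP[? ?] /andP[? ?] /=.
      by apply/andP; split; lra.
have [t2lt|t2ge] := ltP t2 1.
  have e0 : 0 < Num.min (t2 / 2) (Num.min (1 - t2) ((t2 - t1) / 4)).
    by rewrite !lt_min; apply/and3P; split; lra.
  have [m _ /(_ m (leqnn m))/=] := dy1_near e0.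
  rewrite !lt_min => /and3P[l1 l2 l3].
  have l1' : 2 * dy m 1 < t2 by lra.
  have [b1 b2 b3 b4] := brk t2 m t2lt l1' l2.
  apply: (H m (dyfl m t1).+1 _ _ b1 b2); exists t1, t2; split => //; left.
  have /andP[h1 h2] := dyflP m t10.
  have E : dy m (dyfl m t1).+1 = dy m (dyfl m t1) + dy m 1 :> R by rewrite -dyD addn1.
  split; first by rewrite -(@ltr_dy R m); lra.
  apply: (@dyadic_adherent_nbhs _ _ (dy m (dyfl m t1).+1 - t1)).
  - by rewrite t10.
  - by rewrite subr_gt0.
  - by move=> u _; rewrite ltr_norml => /andP[? ?] /=; lra.
have t2E : t2 = 1 by apply/eqP; rewrite eq_le t21.
have t1lt : t1 < 1 by rewrite -t2E.
have t1gt : 0 < t1.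
  rewrite lt_neqAle t10 andbT; apply/eqP => t1E.
  have [_ /(_ 1)] := a1; rewrite -t1E (bridge_start HB) B1 ler01 lexx => /(_ isT).
  by rewrite leNgt lam0.
have e0 : 0 < Num.min (t1 / 2) (1 - t1) by rewrite lt_min; apply/andP; split; lra.
have [m _ /(_ m (leqnn m))/=] := dy1_near e0.
rewrite lt_min => /andP[l1 l2].
have l1' : 2 * dy m 1 < t1 by lra.
have [b1 b2 b3 b4] := brk t1 m t1lt l1' l2.
apply: (H m 0%N _ _ b1 b2); exists t2, t1; split => //; right.
move=> e e'0; near=> n; exists (2 ^ n)%N; split => //=; first by rewrite dy_end.
by rewrite dy_end t2E subrr normr0.
Unshelve. all: end_near. Qed.

End unique_argmin.

(** * From the grid to continuous time *)

Section argmin_convergence.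
Context {R : realType}.
Implicit Types f : R -> R.

Lemma grid_first_argmin_ex N (b : nat -> R) :
  exists2 k, (k <= N)%N & grid_first_argmin N b k.
Proof.
pose Q k := (k <= N)%N && [forall i : 'I_N.+1, b k <= b i].
have exQ : exists k, Q k.
  case: (@arg_minP _ _ _ (@ord0 N) xpredT (fun i : 'I_N.+1 => b i) isT) => i _ imin.
  exists i; rewrite /Q -ltnS ltn_ord/=; apply/forallP => j; exact: imin.
case: (ex_minnP exQ) => k /andP[kN /forallP kmin] kleast.
exists k => //; split => [i ik|i iN]; last first.
  by have iN' : (i < N.+1)%N by []; exact: kmin (Ordinal iN').
have iN' : (i < N.+1)%N by rewrite ltnS ltnW// (leq_trans ik).
rewrite ltNge; apply/negP => bik.
suff : Q i by move/kleast; rewrite leqNgt ik.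
rewrite /Q -ltnS iN'/=; apply/forallP => j; exact: le_trans bik (kmin j).
Qed.

Lemma argmin_gap f tau (e : R) : {within `[0, 1], continuous f} -> 0 < e ->
  (forall t, argmin01 f t -> t = tau) ->
  exists2 gap : R, 0 < gap & forall t, 0 <= t <= 1 -> e <= `|tau - t| -> f tau + gap <= f t.
Proof.
move=> cf e0 uniq.
have taua : argmin01 f tau by rewrite -(uniq _ (first_argminP cf)); exact: first_argminP.
have [/andP[tau0 tau1] taumin] := taua.
have half a b : 0 <= a -> b <= 1 -> (forall t, a <= t <= b -> e <= `|tau - t|) ->
  exists2 gap : R, 0 < gap & forall t, a <= t <= b -> f tau + gap <= f t.
  move=> a0 b1 abe; have [ab|ba] := leP a b; last first.
    by exists 1 => // t /andP[at_ tb]; have := le_trans at_ tb; rewrite leNgt ba.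
  have [c /andP[ac cb] cmin] := argmin_itv cf a0 ab b1.
  have c01 : 0 <= c <= 1 by rewrite (le_trans a0)//= (le_trans cb).
  exists (f c - f tau); last by move=> t /cmin; lra.
  rewrite subr_gt0 lt_neqAle taumin// andbT; apply/eqP => fc.
  have ca : argmin01 f c by split => // s s01; rewrite -fc taumin.
  have := abe c; rewrite ac cb (uniq c ca) subrr normr0 => /(_ isT).
  by rewrite leNgt e0.
have [|||g1 g10 H1] := half 0 (tau - e) => //.
- by lra.
- by move=> t /andP[_ te]; rewrite ger0_norm; lra.
have [|||g2 g20 H2] := half (tau + e) 1 => //.
- by lra.
- by move=> t /andP[te _]; rewrite ler0_norm; lra.
exists (Num.min g1 g2); first by rewrite lt_min g10.
move=> t /andP[t0 t1]; rewrite ler_normr => /orP[h|h].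
  apply: le_trans (H1 t _); last by apply/andP; split; lra.
  by rewrite lerD2l ge_min lexx.
apply: le_trans (H2 t _); last by apply/andP; split; lra.
by rewrite lerD2l ge_min lexx orbT.
Qed.

(** Away from [tau] the function exceeds its minimum by a fixed gap, whereas a fine grid has a point
    near [tau] where it exceeds it by less. *)
Lemma grid_argmin_cvg f tau (e : R) : {within `[0, 1], continuous f} -> 0 < e ->
  (forall t, argmin01 f t -> t = tau) ->
  \forall m \near \oo, forall k, (k <= 2 ^ m)%N ->
    grid_first_argmin (2 ^ m) (fun i => f (dy m i)) k -> `|tau - dy m k| < e.
Proof.
move=> cf e0 uniq; have [gap gap0 H] := argmin_gap cf e0 uniq.
have taua : argmin01 f tau by rewrite -(uniq _ (first_argminP cf)); exact: first_argminP.
have [tau01 _] := taua; have [tau0 _] := andP tau01.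
have [del del0 Hd] := cont01P cf tau01 gap0.
apply: filterS (dy1_near del0) => m dm k km [_ kmin].
rewrite ltNge; apply/negP => /(H _ (dy_itv km)).
have flm := dyfl_le m tau01.
have h1 := kmin _ flm.
have := Hd _ (dy_itv flm) (lt_trans (dyfl_dist m tau0) dm).
by rewrite ltr_norml => /andP[]; lra.
Qed.

Lemma grid_vervaat_dy f m k i : (k <= 2 ^ m)%N -> 
  grid_vervaat (2 ^ m) (fun i => f (dy m i)) k i = cyclic_shift f (dy m k) (dy m i).
Proof.
move=> km; rewrite /grid_vervaat /cyclic_shift lerBrDr -(dyD m i k) dy_le1.
case: ifPn => [_|]; first by rewrite addnC dyD.
rewrite -ltnNge => /ltnW ikm.
by rewrite dyB// addnC dyD dy_end.
Qed.

Lemma vervaatE f t : vervaat f t = cyclic_shift f (first_argmin f) t.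
Proof. by []. Qed.

Lemma grid_vervaat_cvg f m0 i0 (e : R) : {within `[0, 1], continuous f} -> f 0 = 0 ->
  (i0 <= 2 ^ m0)%N -> 0 < e ->
  (forall t, argmin01 f t -> t = first_argmin f) ->
  \forall m \near \oo, forall k, (k <= 2 ^ m)%N ->
    grid_first_argmin (2 ^ m) (fun i => f (dy m i)) k ->
    `|vervaat f (dy m0 i0) - grid_vervaat (2 ^ m) (fun i => f (dy m i))
      k (i0 * 2 ^ (m - m0))| < e.
Proof.
move=> cf f0 i0m e0 uniq.
have [del del0 H] := cyclic_shift_cont cf f0 (first_argmin_itv cf) (dy_itv i0m) e0.
have mm0 : \forall m \near \oo, (m0 <= m)%N by exists m0.
apply: filterS2 mm0 (grid_argmin_cvg cf del0 uniq) => m mm Hm k km kmin.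
by rewrite grid_vervaat_dy// -dy_refine// vervaatE; apply: H (Hm k km kmin); exact: dy_itv.
Qed.

End argmin_convergence.

Section measurability.
Context {R : realType} d (T : measurableType d) (P : probability T R).
Variables (lam : R) (B : R -> {RV P >-> R}).
Hypothesis (HB : is_brownian_bridge lam B).
Local Notation path w := (fun u => B u w).

(** The minimum over [[0, x]] is the global one exactly when dyadic points before [x] come
    arbitrarily close to the infimum over all dyadic points. Only countably many values of [f] are
    involved, which gives measurability of the argmin. *)
Lemma first_argmin_leP (f : R -> R) (x : R) : {within `[0, 1], continuous f} ->
  0 <= x <= 1 ->
  first_argmin f <= x <-> forall j : nat, exists mi, [/\ (mi.2 <= 2 ^ mi.1)%N,
    dy mi.1 mi.2 <= x &
    forall m' i', (i' <= 2 ^ m')%N -> f (dy mi.1 mi.2) <= f (dy m' i') + j.+1%:R^-1 :> R].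
Proof.
move=> cf /andP[x0 x1]; have cf' := cont01P cf.
have [tau01 taumin] := first_argminP cf; have /andP[tau0 _] := tau01; split => [tx j|H].
  have j0 : 0 < j.+1%:R^-1 :> R by rewrite invr_gt0.
  have [del del0 H] := cf' _ tau01 _ j0.
  have [m _ /(_ m (leqnn m))/= dm] := dy1_near del0.
  have flm := dyfl_le m tau01; exists (m, dyfl m (first_argmin f)); split => //=.
    by apply: le_trans tx; case/andP: (dyflP m tau0).
  move=> m' i' im'; have := taumin _ (dy_itv im').
  have := H _ (dy_itv flm) (lt_trans (dyfl_dist m tau0) dm).
  by move: (j.+1%:R^-1) => e; rewrite ltr_norml => /andP[]; lra.
have [c /andP[c0 cx] cmin] := argmin_itv cf (lexx 0) x0 x1.
apply: (le_trans _ cx); apply: first_argmin_le; split => [|s s01].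
  by rewrite c0 (le_trans cx).
have cq m' i' : (i' <= 2 ^ m')%N -> f c <= f (dy m' i').
  move=> im'; apply/ler_addgt0Pr => e e0.
  have [j _ /(_ j (leqnn j))/= je] := near_infty_natSinv_lt (PosNum e0).
  have [[m i]/= [im ix /(_ m' i' im') h]] := H j.
  have := cmin (dy m i); rewrite dy_ge0 ix => /(_ isT); move: h je;
    move: (j.+1%:R^-1) => e'; lra.
apply/ler_addgt0Pr => e e0.
have [del del0 Hd] := cf' _ s01 _ e0.
have [m _ /(_ m (leqnn m))/= dm] := dy1_near del0.
have [s0 _] := andP s01; have flm := dyfl_le m s01.
have := Hd _ (dy_itv flm) (lt_trans (dyfl_dist m s0) dm).
by have := cq _ _ flm; rewrite ltr_norml => ? /andP[]; lra.
Qed.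

Lemma measurable_tau_le x : 0 <= x <= 1 -> measurable [set w | first_argmin (path w) <= x].
Proof.
move=> x01.
have mle (r r' c : R) : measurable [set w | B r w <= B r' w + c].
  rewrite (_ : mkset _ = (fun w => B r' w + c - B r w) @^-1` `[0, +oo[%classic).
    rewrite -[X in measurable X]setTI.
    have mB (q : R) : measurable_fun setT (B q) by exact: measurable_funP.
    apply: measurable_funB => //; apply: measurable_funD => //.
  by apply/seteqP; split => w; rewrite /= in_itv/= andbT subr_ge0.
rewrite (_ : mkset _ = \bigcap_j \bigcup_m \bigcup_(i in [set i |
  (i <= 2 ^ m)%N /\ dy m i <= x])
   \bigcap_m' \bigcap_(i' in [set i' | (i' <= 2 ^ m')%N])
    [set w | B (dy m i) w <= B (dy m' i') w + j.+1%:R^-1]).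
  apply: bigcap_measurableType => j _; apply: bigcup_measurable => m _.
  apply: bigcup_measurable => i _; apply: bigcap_measurableType => m' _.
  by apply: bigcap_measurableType => i' _; exact: mle.
apply/seteqP; split => w.
  move=> /(first_argmin_leP (bridge_continuous HB (w := w)) x01) H j _.
  have [[m i]/= [im ix h]] := H j.
  by exists m => //; exists i => // m' _ i' im'; exact: h.
move=> H; apply/(first_argmin_leP (bridge_continuous HB (w := w)) x01) => j.
have [m _ [i [im ix] h]] := H j I.
by exists (m, i); split => // m' i' im'; exact: h m' I i' im'.
Qed.

Lemma measurable_tau_lt x : 0 <= x -> measurable [set w | first_argmin (path w) < x].
Proof.
move=> x0; have [x1|x1] := leP x 1; last first.
  rewrite (_ : mkset _ = setT)//; apply/seteqP; split => // w _ /=.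
  apply: le_lt_trans x1.
  by case/andP: (first_argmin_itv (bridge_continuous HB (w := w))).
rewrite (_ : mkset _ = \bigcup_n (if 0 <= x - n.+1%:R^-1 then
    [set w | first_argmin (path w) <= x - n.+1%:R^-1] else set0)).
  apply: bigcup_measurable => n _; case: ifPn => // h; apply: measurable_tau_le.
  by rewrite h/= lerBlDr (le_trans x1)// lerDl.
apply/seteqP; split => w /=.
  move=> tx; have xt : 0 < x - first_argmin (path w) by rewrite subr_gt0.
  have [n _ /(_ n (leqnn n))/= H] := near_infty_natSinv_lt (PosNum xt).
  have h : first_argmin (path w) <= x - n.+1%:R^-1 by move: H; move: (n.+1%:R^-1) => e; lra.
  exists n => //; case: ifPn => // /negP; apply; apply: le_trans h.
  by case/andP: (first_argmin_itv (bridge_continuous HB (w := w))).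
move=> [n _]; case: ifPn => // _ /= /le_lt_trans; apply.
by rewrite ltrBlDr ltrDl.
Qed.

Lemma measurable_dyfl m k : measurable [set w | dyfl m (first_argmin (path w)) = k].
Proof.
rewrite (_ : mkset _ = [set w | first_argmin (path w) < dy m k.+1] `\`
    [set w | first_argmin (path w) < dy m k]).
  by apply: measurableD; apply: measurable_tau_lt; exact: dy_ge0.
apply/seteqP; split => w /=.
  have /andP[t0 _] := first_argmin_itv (bridge_continuous HB (w := w)).
  move=> <-; have /andP[h1 h2] := dyflP m t0; split => //.
  by rewrite ltNge h1.
move=> [h2 /negP]; rewrite -leNgt => h1.
have /andP[t0 _] := first_argmin_itv (bridge_continuous HB (w := w)).
have /andP[h3 h4] := dyflP m t0.
have := le_lt_trans h1 h4; have := le_lt_trans h3 h2; rewrite !ltr_dy !ltnS => ? ?.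
by apply/eqP; rewrite eqn_leq; apply/andP.
Qed.

Lemma measurable_fun_select d' (T' : measurableType d') (N : T' -> nat) (F : nat -> T' ->
  R) :
  (forall k, measurable [set w | N w = k]) -> (forall k, measurable_fun setT (F k)) ->
  measurable_fun setT (fun w => F (N w) w).
Proof.
move=> mN mF _ Y mY; rewrite setTI.
rewrite (_ : _ @^-1` Y = \bigcup_k ([set w | N w = k] `&` F k @^-1` Y)).
  apply: bigcup_measurable => k _; apply: measurableI => //.
  by rewrite -[X in measurable X]setTI; exact: mF.
apply/seteqP; split => w /=; first by move=> h; exists (N w).
by move=> [k _ [<-]].
Qed.

Lemma measurable_cyclic_shift (tau t : R) :
  measurable_fun setT (fun w => cyclic_shift (path w) tau t).
Proof.
have mB (q : R) : measurable_fun setT (B q) by exact: measurable_funP.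
rewrite /cyclic_shift; case: (t <= 1 - tau); first exact: measurable_funB.
by apply: measurable_funB => //; exact: measurable_funD.
Qed.

(** Limit of the cyclic shifts at the dyadic approximations of the argmin, each of which takes
    countably many values. *)
Lemma measurable_vervaat (t : R) : 0 <= t <= 1 ->
  measurable_fun setT (fun w => vervaat (path w) t).
Proof.
move=> t01.
apply: (@measurable_fun_cvg _ _ _ setT
  (fun m w => cyclic_shift (path w) (dy m (dyfl m (first_argmin (path w)))) t)).
  move=> m; apply: (@measurable_fun_select _ _ (fun w => dyfl m (first_argmin (path w)))
    (fun k w => cyclic_shift (path w) (dy m k) t)) => k.
    exact: measurable_dyfl.
  exact: measurable_cyclic_shift.
move=> w _; apply/cvgrPdist_lt => e e0.
have cf := bridge_continuous HB (w := w).
have tau01 := first_argmin_itv cf; have [tau0 _] := andP tau01.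
have [del del0 H] := cyclic_shift_cont cf (bridge_start HB w) tau01 t01 e0.
apply: filterS (dy1_near del0) => m dm; apply: H.
  by apply: dy_itv; exact: dyfl_le.
exact: lt_trans (dyfl_dist m tau0) dm.
Qed.

End measurability.

(** * Passage of the comparison inequality to the limit *)

Section grid_probability_comparison.
Context {R : realType} d (T : measurableType d) (P : probability T R).
Variables (lam : R) (B : R -> {RV P >-> R}).
Hypotheses (lam0 : lam < 0) (HB : is_brownian_bridge lam B).
Local Notation path w := (fun u => B u w).

(** Both sides of [grid_comparison] are quadratic in the masses, so the normalisation [phi] cancels.
    As the index [ns] of [s] is [a + 1], the factor is slightly weakened from [nt' - a] to
    [nt' - ns], the form that is invariant under refinement of the grid. *)
Lemma grid_pr_comparison n nu ns nt nt' (y0 eps c cu : R) (I J : set R)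
    (X := fun U C S : set R => grid_vervaat_events B n (Aev ns.-1 nu nt U C S)) :
  (0 < nu < ns)%N -> (ns < nt <= nt')%N -> (nt' <= n)%N ->
  0 < eps -> c <= 0 -> cu <= 0 ->
  eps <= pr P (X setT setT `]-oo, y0]%classic (n.+1 - nt')%N) ->
  measurable I -> measurable J -> I `<=` `]0, +oo[ -> J `<=` `]0, +oo[ ->
  (forall y, J y -> y0 <= y) -> (forall x y, I x -> J y -> x <= y) ->
  (1 + (nt' - ns)%:R / n.+1%:R * eps) *
    (pr P (X setT `]-oo, c[%classic J n.+1) * pr P (X `]-oo, cu[%classic setT I n.+1)) <=
  nt%:R / ns%:R *
    (pr P (X setT setT J n.+1) * pr P (X `]-oo, cu[%classic `]-oo, c[%classic I n.+1)).
Proof.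
have [b nE] : exists b, (0 < ns < n)%N -> (n = ns.-1 + b.+1)%N by exists (n - ns)%N; lia.
case: ns @X nE => [|a] X nE; first by lia.
move=> nua ntn ntn' eps0 c0 cu0 He mI mJ I0 J0 Jy IJ.
have {}nE : (n = a + b.+1)%N by apply: nE; lia.
have Phi0 : 0 < bm_density 1 0 lam by exact: bm_density_gt0.
have mX (U C S : set R) : measurable U -> measurable C -> measurable S ->
  forall i, measurable (Aev a nu nt U C S i).
  by move=> *; exact: measurable_Aev.
have mT : measurable (setT : set R) by [].
have my (x : R) : measurable `]-oo, x[%classic by exact: measurable_itv.
have my' (x : R) : measurable `]-oo, x]%classic by exact: measurable_itv.
have massE (A : nat -> set R) : (forall i, measurable (A i)) ->
    vervaat_mass (mesh n)
      lam a b A = (bm_density 1 0 lam * pr P (grid_vervaat_events B n A n.+1))%:E.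
  move=> mA; rewrite EFinM prE; last exact: measurable_gridEvU.
  rewrite (gridEvU_mass lam0 HB)// subnn /vervaat_mass nE; exact: erefl.
have h1 : (0 < nu <= a)%N by [].
have h2 : (a.+1 < nt <= a + b.+1)%N by rewrite -nE; lia.
have h3 : (nt <= nt' <= a + b.+1)%N by rewrite -nE; lia.
have H := @grid_comparison R (mesh n) lam (mesh_gt0 n) lam0 a b nu nt h1 h2 nt' y0 eps
  (bm_density 1 0 lam) c cu I J h3 eps0 Phi0 c0 cu0.
have H1 : ((eps * bm_density 1 0 lam)%:E <= \sum_(nt' <= j < (a + b.+1).+1)
     pathQ (mesh n) (cut_weight lam (Aev a nu nt setT setT `]-oo, y0]) j) 1 (a + b.+1)
       0 lam)%E.
  have := @gridEvU_mass R d T P lam B lam0 HB n (Aev a nu nt setT setT `]-oo, y0])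
    (n.+1 - nt')%N (leq_subr _ _) (mX _ _ _ mT mT (my' y0)).
  rewrite subKn; last exact: leqW.
  rewrite -nE => <-; rewrite -prE; last by apply: measurable_gridEvU; exact: mX.
  rewrite -EFinM lee_fin mulrC ler_pM2l; [exact: He|exact: Phi0].
have H2 : (vervaat_mass (mesh n) lam a b (Aev a nu nt setT setT `]-oo, y0])
  <= (bm_density 1 0 lam)%:E)%E.
  rewrite massE; last exact: mX.
  rewrite lee_fin ger_pMr// -lee_fin.
  have mE := @measurable_gridEvU _ _ _ P B n _ n.+1 (mX _ _ _ mT mT (my' y0)).
  by rewrite prE//; exact: probability_le1.
have {H} := H H1 H2 mI mJ I0 J0 Jy IJ.
rewrite !massE; [|exact: mX|exact: mX|exact: mX|exact: mX].
rewrite -nE -!EFinM lee_fin.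
set phi := bm_density 1 0 lam in Phi0 *.
set p1 := pr P _; set p2 := pr P _; set p3 := pr P _; set p4 := pr P _ => H.
have {}H : phi ^+ 2 * ((1 + (nt' - a)%:R / n.+1%:R * eps) * (p1 * p2)) <=
  phi ^+ 2 * ((nt%:R / a.+1%:R) * (p3 * p4)).
  by apply: le_trans (le_trans H _); rewrite le_eqVlt; apply/orP; left; apply/eqP; ring.
rewrite ler_pM2l ?exprn_gt0// in H; apply: le_trans H.
apply: ler_wpM2r; first by rewrite mulr_ge0 ?pr_ge0.
rewrite lerD2l ler_wpM2r ?(ltW eps0)// ler_wpM2r ?invr_ge0// ler_nat; lia.
Qed.

End grid_probability_comparison.

Section grid_event_limits.
Context {R : realType} d (T : measurableType d) (P : probability T R).
Variables (lam : R) (B : R -> {RV P >-> R}).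
Hypotheses (lam0 : lam < 0) (HB : is_brownian_bridge lam B).
Variables (m0 iu is_ it : nat).
Hypotheses (iu_gt0 : (0 < iu)%N) (iu_is : (iu < is_)%N) (is_it : (is_ < it)%N)
  (it_lt : (it < 2 ^ m0)%N).
Local Notation path w := (fun u => B u w).
Local Notation sc m i := (i * 2 ^ (m - m0))%N.

Definition vval i w : R := vervaat (path w) (dy m0 i).

(** [l] is a lower bound for the splice index, counted at level [m0]; [l = 0] imposes nothing. The
    predecessor converts the index of [s] into the parameter [a] of [Aev]. *)
Definition grid_event l (U C J : set R) m : set T :=
  grid_vervaat_events B (lev m) (Aev (sc m is_).-1 (sc m iu) (sc m it) U C J)
    (2 ^ m - sc m l).

Lemma measurable_grid_event l U C J m : measurable U -> measurable C -> measurable J ->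
  measurable (grid_event l U C J m).
Proof. by move=> *; apply: measurable_gridEvU; exact: measurable_Aev. Qed.

Lemma sc_lt m i j : (i < j)%N -> (sc m i < sc m j)%N.
Proof. by rewrite ltn_pmul2r// expn_gt0. Qed.

Lemma sc_le m i : (m0 <= m)%N -> (i <= 2 ^ m0)%N -> (sc m i <= 2 ^ m)%N.
Proof. by move=> mm im; rewrite -[in leqRHS](subnKC mm) expnD leq_mul2r im orbT. Qed.

Lemma grid_eventP l (U C J : set R) m w (b := fun i => B (dy m i) w) : (m0 <= m)%N ->
  grid_event l U C J m w <->
  exists k, [/\ (k <= 2 ^ m - sc m l)%N, grid_first_argmin (2 ^ m) b k,
    J (grid_vervaat (2 ^ m) b k (sc m is_)), U (grid_vervaat (2 ^ m) b k (sc m iu)) &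
    C (grid_vervaat (2 ^ m) b k (sc m it))].
Proof.
move=> mm; rewrite /grid_event gridEvUP.
have s0 : (0 < sc m is_)%N by apply: leq_ltn_trans (sc_lt m iu_is).
have u0 : (0 < sc m iu)%N by have := sc_lt m iu_gt0; rewrite mul0n.
have us := sc_lt m iu_is; have st := sc_lt m is_it.
have tN : (sc m it < 2 ^ m)%N.
  by apply: leq_trans (sc_lt m it_lt) _; exact: sc_le.
have As : Aev (sc m is_).-1 (sc m iu) (sc m it) U C J (sc m is_) = J.
  by rewrite /Aev prednK// eqxx.
have Au : Aev (sc m is_).-1 (sc m iu) (sc m it) U C J (sc m iu) = U.
  by rewrite /Aev prednK// ltn_eqF// eqxx.
have At : Aev (sc m is_).-1 (sc m iu) (sc m it) U C J (sc m it) = C.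
  by rewrite /Aev prednK// gtn_eqF// gtn_eqF ?eqxx//; exact: ltn_trans st.
have AT i : i != sc m is_ -> i != sc m iu -> i != sc m it ->
    Aev (sc m is_).-1 (sc m iu) (sc m it) U C J i = setT.
  by move=> /negPf h1 /negPf h2 /negPf h3; rewrite /Aev prednK// h1 h2 h3.
split.
  move=> [k kl [_ ]]; rewrite levS => -[kmin H]; exists k; split => //.
  - by rewrite -[X in X _]As; apply: H; rewrite s0 (ltn_trans st).
  - by rewrite -[X in X _]Au; apply: H; rewrite u0 (ltn_trans us)// (ltn_trans st).
  - by rewrite -[X in X _]At; apply: H; rewrite tN (ltn_trans s0).
move=> [k [kl kmin Js Uu Ct]]; exists k => //; split.
  by rewrite levS (leq_trans kl)// leq_subr.
rewrite levS; split => // i i0.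
have [->|is1] := eqVneq i (sc m is_); first by rewrite As.
have [->|is2] := eqVneq i (sc m iu); first by rewrite Au.
have [->|is3] := eqVneq i (sc m it); first by rewrite At.
by rewrite AT.
Qed.

Let near_good w (del : R) : 0 < del ->
  (forall t1 t2, argmin01 (path w) t1 -> argmin01 (path w) t2 -> t1 = t2) ->
  \forall m \near \oo, (m0 <= m)%N /\ forall k, (k <= 2 ^ m)%N ->
     grid_first_argmin (2 ^ m) (fun i => B (dy m i) w) k ->
    [/\ `|first_argmin (path w) - dy m k| < del,
     `|vval iu w - grid_vervaat (2 ^ m) (fun i => B (dy m i) w) k (sc m iu)| < del,
     `|vval is_ w - grid_vervaat (2 ^ m) (fun i => B (dy m i) w) k (sc m is_)| < del &
     `|vval it w - grid_vervaat (2 ^ m) (fun i => B (dy m i) w) k (sc m it)| < del].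
Proof.
move=> del0 uniq.
have cf := bridge_continuous HB (w := w); have f0 := bridge_start HB w.
have uniq' t : argmin01 (path w) t -> t = first_argmin (path w).
  by move=> at_; apply: uniq => //; exact: first_argminP.
have mm : \forall m \near \oo, (m0 <= m)%N by exists m0.
have itl := ltnW it_lt; have isl := leq_trans (ltnW is_it) itl.
have iul := leq_trans (ltnW iu_is) isl.
have H1 := grid_argmin_cvg cf del0 uniq'.
have H2 := grid_vervaat_cvg cf f0 iul del0 uniq'.
have H3 := grid_vervaat_cvg cf f0 isl del0 uniq'.
have H4 := grid_vervaat_cvg cf f0 itl del0 uniq'.
near=> m; split; first by near: m; exact: mm.
move=> k km kmin; split; move: k km kmin; near: m.
- exact: H1.
- exact: H2.
- exact: H3.
- exact: H4.
Unshelve. all: end_near. Qed.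

Let openP (U : set R) x : open U -> U x -> exists2 e : R, 0 < e & forall y, `|x - y|
  < e -> U y.
Proof.
move=> oU Ux; have /nbhs_ballP[e /= e0 H] : nbhs x U by exact: open_nbhs_nbhs.
by exists e.
Qed.

(** As the argmin is almost surely unique, the grid argmin and the grid transform converge to those
    of the path, and open conditions on the limits hold at all fine levels. *)
Lemma grid_event_open l (U C J : set R) : open U -> open C -> open J -> (l <= 2 ^ m0)%N ->
  {ae P, forall w, [/\ U (vval iu w), C (vval it w), J (vval is_ w) &
     (l = 0%N \/ first_argmin (path w) < 1 - dy m0 l)] ->
    \forall m \near \oo, grid_event l U C J m w}.
Proof.
move=> oU oC oJ lm; apply: filterS (ae_unique_argmin lam0 HB) => w uniq [Uw Cw Jw lw].
have [e1 e10 H1] := openP oU Uw; have [e2 e20 H2] := openP oC Cw.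
have [e3 e30 H3] := openP oJ Jw.
have [e4 e40 H4] : exists2 e4 : R, 0 < e4 & forall m k, (m0 <= m)%N -> (k <= 2 ^ m)%N ->
    `|first_argmin (path w) - dy m k| < e4 -> (k <= 2 ^ m - sc m l)%N.
  case: lw => [->|tl]; first by exists 1 => // m k _ km _; rewrite mul0n subn0.
  exists (1 - dy m0 l - first_argmin (path w)); first by rewrite subr_gt0.
  move=> m k mm km; rewrite ltr_norml => /andP[h _].
  rewrite -(@ler_dy R m) dyB; last exact: sc_le.
  by rewrite -dy_refine// dy_end; lra.
pose e := Num.min (Num.min e1 e2) (Num.min e3 e4).
have e0 : 0 < e by rewrite !lt_min e10 e20 e30.
apply: filterS (near_good e0 uniq) => m [mm Hm]; apply/grid_eventP => //.
have [k km kmin] := grid_first_argmin_ex (2 ^ m) (fun i => B (dy m i) w).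
have := Hm k km kmin; rewrite /e !lt_min.
move=> [/and3P[/andP[_ _] _ d4] /and3P[/andP[d1 _] _ _] /and3P[/andP[_ _] d3 _] /and3P[/andP[_ d2] _ _]].
by exists k; split; [exact: H4 d4|exact: kmin|exact: H3|exact: H1|exact: H2].
Qed.

Lemma grid_event_closed (U C J : set R) : closed U -> closed C -> closed J ->
  {ae P, forall w, \forall m \near \oo, grid_event 0 U C J m w ->
     [/\ U (vval iu w), C (vval it w) & J (vval is_ w)]}.
Proof.
move=> cU cC cJ; apply: filterS (ae_unique_argmin lam0 HB) => w uniq.
have [Dw|nDw] := pselect [/\ U (vval iu w), C (vval it w) & J (vval is_ w)].
  by apply: nearW => m _.
have sep (A : set R) i : closed A -> exists2 e : R, 0 < e & forall y, `|vval i w - y|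
  < e -> A y -> A (vval i w).
  move=> cA; have [Aw|nA] := pselect (A (vval i w)); first by exists 1.
  have [e e0 He] := openP (closed_openC cA) nA; exists e => // y /He nAy Ay; by exfalso;
    exact: nAy.
have [e1 e10 H1] := sep U iu cU; have [e2 e20 H2] := sep C it cC.
have [e3 e30 H3] := sep J is_ cJ.
pose e := Num.min e1 (Num.min e2 e3).
have e0 : 0 < e by rewrite !lt_min e10 e20.
apply: filterS (near_good e0 uniq) => m [mm Hm] /(grid_eventP _ _ _ _ _ mm).
move=> [k [km kmin Jk Uk Ck]]; have := Hm k (leq_trans km (leq_subr _ _)) kmin;
  rewrite /e !lt_min.
move=> [_ /and3P[d1 _ _] /and3P[_ _ d3] /and3P[_ d2 _]].
by split; [exact: H1 Uk|exact: H2 Ck|exact: H3 Jk].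
Qed.

End grid_event_limits.

Section limit_comparison.
Context {R : realType}.

Lemma le_product_limit (K L p1 p2 p3 p4 : R) : 0 <= K -> 0 <= L ->
  0 <= p3 -> p3 <= 1 -> 0 <= p4 -> p4 <= 1 -> 0 <= p1 -> 0 <= p2 ->
  (forall e : R, 0 < e -> exists x1 x2 x3 x4 : R,
    [/\ 0 <= x1 <= 1 /\ 0 <= x2 <= 1, 0 <= x3 /\ 0 <= x4,
    p1 <= x1 + e /\ p2 <= x2 + e, x3 <= p3 + e /\ x4 <= p4 + e &
    K * (x1 * x2) <= L * (x3 * x4)]) ->
  K * (p1 * p2) <= L * (p3 * p4).
Proof.
move=> K0 L0 p30 p31 p40 p41 p10 p20 H; apply/ler_addgt0Pr => e e0.
(* A product of two numbers of [[0, 1]], each increased by [e' <= 1], grows by at most [3 * e']; the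
   added 1 keeps [M] positive. *)
pose M := 3 * (K + L) + 1.
have M0 : 0 < M by rewrite /M; lra.
pose e' := Num.min 1 (e / M).
have e'0 : 0 < e' by rewrite lt_min ltr01 divr_gt0.
have e'1 : e' <= 1 by rewrite ge_min lexx.
have e'e : M * e' <= e by rewrite mulrC -ler_pdivlMr// ge_min lexx orbT.
have [x1 [x2 [x3 [x4 [[/andP[x10 x11] /andP[x20 x21]] [x30 x40] [h1 h2] [h3 h4] h]]]]] :=
  H e' e'0.
have a1 : p1 * p2 <= x1 * x2 + 3 * e'.
  apply: (@le_trans _ _ ((x1 + e') * (x2 + e'))); first exact: ler_pM.
  have : e' * e' <= e' by rewrite ler_piMl// ltW.
  have : x1 * e' <= e' by rewrite ler_piMl// ltW.
  have : e' * x2 <= e' by rewrite ler_piMr// ltW.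
  move=> ? ? ?; rewrite mulrDl !mulrDr; lra.
have a2 : x3 * x4 <= p3 * p4 + 3 * e'.
  apply: (@le_trans _ _ ((p3 + e') * (p4 + e'))); first exact: ler_pM.
  have : e' * e' <= e' by rewrite ler_piMl// ltW.
  have : p3 * e' <= e' by rewrite ler_piMl// ltW.
  have : e' * p4 <= e' by rewrite ler_piMr// ltW.
  move=> ? ? ?; rewrite mulrDl !mulrDr; lra.
have {}a1 := ler_wpM2l K0 a1; have {}a2 := ler_wpM2l L0 a2.
apply: (le_trans a1); rewrite mulrDr.
have : L * (p3 * p4 + 3 * e') + K * (3 * e') <= L * (p3 * p4) + e.
  rewrite /M in e'e; rewrite mulrDr; nra.
lra.
Qed.

Lemma near_inv_lt (z : R) : z != 0 -> \forall k \near \oo, k.+1%:R^-1 < `|z|.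
Proof.
rewrite -normr_gt0 => z0; exact: near_infty_natSinv_lt (PosNum z0).
Qed.

Lemma near_shift (x y : R) : \forall k \near \oo,
  [/\ (x < y + k.+1%:R^-1) = (x <= y), (x <= y + k.+1%:R^-1) = (x <= y),
      (y + k.+1%:R^-1 < x) = (y < x) & (y + k.+1%:R^-1 <= x) = (y < x)].
Proof.
have [->|xy] := eqVneq x y.
  apply: nearW => k; have : 0 < k.+1%:R^-1 :> R by rewrite invr_gt0.
  move: (k.+1%:R^-1) => e e0.
  split; first by rewrite lexx; lra.
  - by rewrite lexx; lra.
  - by rewrite ltxx; apply/negbTE; rewrite -leNgt; lra.
  - by rewrite ltxx; apply/negbTE; rewrite -ltNge; lra.
have := near_inv_lt (z := x - y); rewrite subr_eq0 => /(_ xy); apply: filterS => k.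
have : 0 < k.+1%:R^-1 :> R by rewrite invr_gt0.
move: (k.+1%:R^-1) => e e0; have [lt|lt|E] := ltgtP x y; last by rewrite E eqxx in xy.
  rewrite ltr0_norm; last lra.
  by move=> h; split; try lra; apply/negbTE; rewrite -?leNgt -?ltNge; lra.
rewrite gtr0_norm; last lra.
by move=> h; split; try lra; apply/negbTE; rewrite -?leNgt -?ltNge; lra.
Qed.

End limit_comparison.

Section vervaat_comparison.
Context {R : realType} d (T : measurableType d) (P : probability T R).
Variables (lam : R) (B : R -> {RV P >-> R}).
Hypotheses (lam0 : lam < 0) (HB : is_brownian_bridge lam B).
Variables (m0 iu is_ it it' : nat).
Hypotheses (iu_gt0 : (0 < iu)%N) (iu_is : (iu < is_)%N) (is_it : (is_ < it)%N)
  (it_it' : (it <= it')%N) (it'_lt : (it' < 2 ^ m0)%N).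
Local Notation path w := (fun u => B u w).
Local Notation sc m i := (i * 2 ^ (m - m0))%N.
Local Notation Vu := (vval B m0 iu).
Local Notation Vs := (vval B m0 is_).
Local Notation Vt := (vval B m0 it).

Let it_lt : (it < 2 ^ m0)%N. Proof. exact: leq_ltn_trans it'_lt. Qed.
Let is_lt : (is_ < 2 ^ m0)%N. Proof. exact: ltn_trans it_lt. Qed.
Let iu_lt : (iu < 2 ^ m0)%N. Proof. exact: ltn_trans is_lt. Qed.

Lemma measurable_vval i : (i <= 2 ^ m0)%N -> measurable_fun setT (vval B m0 i).
Proof. by move=> im; apply: (measurable_vervaat HB); exact: dy_itv. Qed.

Lemma measurable_vval_pre i (A : set R) : (i <= 2 ^ m0)%N -> measurable A ->
  measurable [set w | A (vval B m0 i w)].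
Proof.
move=> im mA; rewrite -[X in measurable X]setTI.
exact: (measurable_vval im measurableT mA).
Qed.

Definition Vevent (U C J : set R) : set T := [set w | [/\ U (Vu w), C (Vt w) & J (Vs w)]].

Lemma measurable_Vevent U C J : measurable U -> measurable C -> measurable J ->
  measurable (Vevent U C J).
Proof.
move=> mU mC mJ.
rewrite (_ : Vevent U C J = [set w | U (Vu w)] `&` ([set w | C (Vt w)] `&` [set w |
  J (Vs w)])).
  by apply: measurableI; [|apply: measurableI]; apply: measurable_vval_pre => //;
    exact: ltnW.
by apply/seteqP; split => w; [move=> [? ? ?]|move=> [? [? ?]]].
Qed.

(** An early argmin is a late splice: here the splice comes after the time of index [it']. *)
Definition early_event y0 : set T := [set w | Vs w < y0 /\ first_argmin (path w)
  < 1 - dy m0 it'].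

Lemma measurable_early_event y0 : measurable (early_event y0).
Proof.
apply: measurableI; last first.
  by apply: (measurable_tau_lt HB); rewrite subr_ge0 dy_le1 ltnW.
rewrite [X in measurable X](_ : _ = [set w | `]-oo, y0[%classic (Vs w)]).
  by apply: measurable_vval_pre; [exact: ltnW|exact: measurable_itv].
by apply/seteqP; split => w /=; rewrite in_itv.
Qed.

Variables (y0 eps : R).
Hypotheses (y00 : 0 <= y0) (eps0 : 0 < eps) (early : eps < pr P (early_event y0)).

Let K := 1 + (it' - is_)%:R / (2 ^ m0)%:R * eps.
Let L : R := it%:R / is_%:R.

(** The left side needs lower bounds for the grid probabilities and the right side upper bounds, so
    the sets are open on the left and closed on the right. *)
Lemma open_closed_comparison (a b a' b' c : R) : y0 <= a -> b <= a' -> a < b -> c < 0 ->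
  K * (pr P (Vevent setT `]-oo, c[ `]a', b'[) * pr P (Vevent `]-oo, c[ setT `]a, b[)) <=
  L * (pr P (Vevent setT setT `[a', b']) * pr P (Vevent `]-oo, c] `]-oo, c] `[a, b])).
Proof.
move=> y0a ba' ab c0.
have K0 : 0 <= K by rewrite /K addr_ge0// mulr_ge0 ?divr_ge0// ltW.
have L0 : 0 <= L by rewrite /L divr_ge0.
have mT : measurable (setT : set R) by [].
have my (i : interval R) : measurable [set` i] by exact: measurable_itv.
have pr1 A : measurable A -> pr P A <= 1.
  by move=> mA; rewrite -lee_fin prE//; exact: probability_le1.
apply: le_product_limit => //; rewrite ?pr_ge0 ?pr1//; try exact: measurable_Vevent.
move=> e e0.
pose X U C J m := grid_event B m0 iu is_ it 0 U C J m.
have mX (U C J : set R) m : measurable U -> measurable C -> measurable J ->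
  measurable (X U C J m).
  by move=> *; exact: measurable_grid_event.
have low (U C J : set R) : measurable U -> measurable C -> measurable J ->
    open U -> open C -> open J ->
    \forall m \near \oo, pr P (Vevent U C J) <= pr P (X U C J m) + e.
  move=> mU mC mJ oU oC oJ; apply: pr_liminf => //.
  - exact: measurable_Vevent.
  - by move=> m; exact: mX.
  - have := @grid_event_open _ _ _ P lam B lam0 HB m0 iu is_ it iu_gt0 iu_is is_it it_lt 0 U C J oU oC oJ (leq0n _).
    by apply: filterS => w H [Uw Cw Jw]; apply: H; split => //; left.
have up (U C J U' C' J' : set R) : measurable U -> measurable C -> measurable J ->
    measurable U' -> measurable C' -> measurable J' ->
    closed U' -> closed C' -> closed J' -> U `<=` U' -> C `<=` C' -> J `<=` J' ->
    \forall m \near \oo, pr P (X U C J m) <= pr P (Vevent U' C' J') + e.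
  move=> mU mC mJ mU' mC' mJ' cU cC cJ sU sC sJ; apply: pr_limsup => //.
  - exact: measurable_Vevent.
  - by move=> m; exact: mX.
  - have := @grid_event_closed _ _ _ P lam B lam0 HB m0 iu is_ it iu_gt0 iu_is is_it it_lt U' C' J' cU cC cJ.
    apply: filterS => w [n _ Hn]; exists (maxn n m0) => // m;
      rewrite /= geq_max => /andP[nm mm].
    move=> /(grid_eventP B iu_gt0 iu_is is_it it_lt _ _ _ _ _ mm) [k [h1 h2 h3 h4 h5]].
    apply: (Hn m nm); apply/(grid_eventP B iu_gt0 iu_is is_it it_lt _ _ _ _ _ mm).
    by exists k; split => //; [exact: sJ|exact: sU|exact: sC].
have oR (x : R) : open `]-oo, x[%classic by exact: itv_open_ends_open.
have oB (x y : R) : open `]x, y[%classic by exact: itv_open.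
have cR (x : R) : closed `]-oo, x]%classic by exact: itv_closed_ends_closed.
have cB (x y : R) : closed `[x, y]%classic by exact: itv_closed.
have sB (x y : R) : `]x, y[%classic `<=` `[x, y]%classic by apply: subset_itvW.
have sR (x : R) : `]-oo, x[%classic `<=` `]-oo, x]%classic by move=> z /=;
  rewrite !in_itv/= => /ltW.
have E1 := low setT `]-oo, c[%classic `]a', b'[%classic mT (my _) (my _) openT (oR _)
  (oB _ _).
have E2 := low `]-oo, c[%classic setT `]a, b[%classic (my _) mT (my _) (oR _)
  openT (oB _ _).
have E3 := up setT setT `]a', b'[%classic setT setT `[a', b']%classic mT mT (my _)
  mT mT (my _)
  closedT closedT (cB _ _) (fun _ H => H) (fun _ H => H) (sB _ _).
have E4 := up `]-oo, c[%classic `]-oo, c[%classic `]a, b[%classic `]-oo,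
  c]%classic `]-oo, c]%classic
  `[a, b]%classic (my _) (my _) (my _) (my _) (my _) (my _) (cR _) (cR _) (cB _ _) (sR _)
    (sR _) (sB _ _).
have E5 : \forall m \near \oo,
  eps <= pr P (grid_event B m0 iu is_ it it' setT setT `]-oo, y0[ m).
  have d0 : 0 < pr P (early_event y0) - eps by rewrite subr_gt0.
  have := @pr_liminf _ _ _ P (early_event y0)
    (fun m => grid_event B m0 iu is_ it it' setT setT `]-oo, y0[ m)
      _ (measurable_early_event y0)
    (fun m => measurable_grid_event _ _ _ _ _ _ _ mT mT (my _)) _ d0.
  case.
    have := @grid_event_open _ _ _ P lam B lam0 HB m0 iu is_ it iu_gt0 iu_is is_it it_lt it' setT setT
      `]-oo, y0[%classic openT openT (oR _) (ltnW it'_lt).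
    apply: filterS => w H [h1 h2]; apply: H; split => //; last by right.
  by move=> n _ Hn; exists n => // m /Hn; lra.
have E6 : \forall m \near \oo, (m0 <= m)%N by exists m0.
have [n _ Hn] := filterI E6 (filterI E5 (filterI E1 (filterI E2 (filterI E3 E4)))).
have [mm [h5 [h1 [h2 [h3 h4]]]]] := Hn n (leqnn n).
exists (pr P (X setT `]-oo, c[%classic `]a', b'[%classic n)), (pr P (X `]-oo,
  c[%classic setT `]a, b[%classic n)),
  (pr P (X setT setT `]a', b'[%classic n)), (pr P (X `]-oo, c[%classic `]-oo,
    c[%classic `]a, b[%classic n)).
split; rewrite ?pr_ge0 ?pr1//; try exact: mX.
have e1 : (0 < sc n iu < sc n is_)%N.
  by rewrite sc_lt// andbT; have := sc_lt m0 n iu_gt0; rewrite mul0n.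
have e2 : (sc n is_ < sc n it <= sc n it')%N by rewrite sc_lt//= leq_mul2r it_it' orbT.
have e3 : (sc n it' <= lev n)%N.
  by rewrite -ltnS levS (leq_trans (sc_lt m0 n it'_lt))// sc_le.
have I0 (x y : R) : y0 <= x -> `]x, y[%classic `<=` (`]0, +oo[%classic : set R).
  by move=> xy z /=; rewrite !in_itv/= andbT => /andP[xz _];
    exact: le_lt_trans (le_trans y00 xy) xz.
have y0a' : y0 <= a' by lra.
have := @grid_pr_comparison R d T P lam B lam0 HB (lev n) (sc n iu) (sc n is_) (sc n it)
  (sc n it')
  y0 eps c c `]a, b[%classic `]a', b'[%classic e1 e2 e3 eps0 (ltW c0) (ltW c0) _ (my _)
    (my _)
  (I0 _ _ y0a) (I0 _ _ y0a') _ _.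
have XE U C J : X U C J n = grid_vervaat_events B (lev n) (Aev (sc n is_).-1 (sc n iu)
  (sc n it) U C J) (lev n).+1.
  by rewrite /X /grid_event mul0n subn0 levS.
rewrite !XE => H.
have KE : (sc n it' - sc n is_)%:R / (lev n).+1%:R = (it' - is_)%:R / (2 ^ m0)%:R :> R.
  by rewrite -mulnBl levS -!dyE -dy_refine.
have LE : (sc n it)%:R / (sc n is_)%:R = it%:R / is_%:R :> R.
  by rewrite !natrM -mulf_div divff ?mulr1//.
rewrite KE LE in H; apply: H.
- apply: (le_trans h5); rewrite -lee_fin !prE; last 2 first.
  + by apply: measurable_gridEvU; exact: measurable_Aev.
  + exact: measurable_grid_event.
  apply: le_measure; rewrite ?inE; [exact: measurable_grid_event| |].
    by apply: measurable_gridEvU; exact: measurable_Aev.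
  have HE : grid_vervaat_events B (lev n) (Aev (sc n is_).-1 (sc n iu) (sc n it)
    setT setT `]-oo, y0])
     ((lev n).+1 - sc n it') = grid_event B m0 iu is_ it it' setT setT `]-oo, y0] n.
    by rewrite /grid_event levS.
  rewrite HE => w /(grid_eventP B iu_gt0 iu_is is_it it_lt _ _ _ _ _ mm)
    [k [g1 g2 g3 g4 g5]].
  apply/(grid_eventP B iu_gt0 iu_is is_it it_lt _ _ _ _ _ mm).
  by exists k; split => //; exact: sR.
- by move=> y /=; rewrite in_itv/= => /andP[]; lra.
- by move=> x y /=; rewrite !in_itv/= => /andP[? ?] /andP[? ?]; lra.
Qed.

(** Moved to the right by [r k], the open and the closed interval with the same ends converge
    pointwise to the same half-open interval; likewise the half-lines ending at [- r k] both
    converge to []-oo, 0[]. In the limit the two sides involve the same sets. *)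
Lemma vervaat_comparison (a b a' b' : R) : y0 <= a -> b <= a' -> a < b ->
  K * (pr P (Vevent setT `]-oo, 0[ `]a', b']) * pr P (Vevent `]-oo, 0[ setT `]a, b])) <=
  L * (pr P (Vevent setT setT `]a', b']) * pr P (Vevent `]-oo, 0[ `]-oo, 0[ `]a, b])).
Proof.
move=> y0a ba' ab.
have K0 : 0 <= K by rewrite /K addr_ge0// mulr_ge0 ?divr_ge0// ltW.
have L0 : 0 <= L by rewrite /L divr_ge0.
have mT : measurable (setT : set R) by [].
have my (i : interval R) : measurable [set` i] by exact: measurable_itv.
have pr1 A : measurable A -> pr P A <= 1.
  by move=> mA; rewrite -lee_fin prE//; exact: probability_le1.
apply: le_product_limit => //; rewrite ?pr_ge0 ?pr1//; try exact: measurable_Vevent.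
move=> e e0.
pose r k : R := k.+1%:R^-1.
have cvg (U C J : set R) (Uk Ck Jk : nat -> set R) :
    measurable U -> measurable C -> measurable J ->
    (forall k, measurable (Uk k)) -> (forall k, measurable (Ck k)) ->
      (forall k, measurable (Jk k)) ->
    (forall x, \forall k \near \oo, Uk k x <-> U x) ->
    (forall x, \forall k \near \oo, Ck k x <-> C x) ->
    (forall x, \forall k \near \oo, Jk k x <-> J x) ->
    \forall k \near \oo, `|pr P (Vevent (Uk k) (Ck k) (Jk k)) - pr P (Vevent U C J)| <= e.
  move=> mU mC mJ mUk mCk mJk hU hC hJ; apply: pr_cvg => //.
  - exact: measurable_Vevent.
  - by move=> k; exact: measurable_Vevent.
  apply: aeW => w; have := filterI (hU (Vu w)) (filterI (hC (Vt w)) (hJ (Vs w))).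
  by case=> n _ Hn; exists n => // k /Hn [[? ?] [[? ?] [? ?]]]; split => -[? ? ?]; split;
    auto.
have nT (x : R) : \forall k \near \oo, (setT : set R) x <->
  (setT : set R) x by exact: nearW.
have nlt (x : R) : \forall k \near \oo, `]-oo, - r k[%classic x <-> `]-oo, 0[%classic x.
  have [n _ Hn] := near_shift 0 x; exists n => // k /Hn [_ _ h _].
  by rewrite /= !in_itv/= -h -ltrBrDr sub0r.
have nle (x : R) : \forall k \near \oo, `]-oo, - r k]%classic x <-> `]-oo, 0[%classic x.
  have [n _ Hn] := near_shift 0 x; exists n => // k /Hn [_ _ _ h].
  by rewrite /= !in_itv/= -h -lerBrDr sub0r.
have oc (x y z : R) : \forall k \near \oo, `]x + r k, y + r k[%classic z <->
  `]x, y]%classic z.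
  have [n _ Hn] := filterI (near_shift z y) (near_shift z x).
  by exists n => // k /Hn [[h1 _ _ _] [_ _ h2 _]]; rewrite /= !in_itv/= h1 h2.
have cc (x y z : R) : \forall k \near \oo, `[x + r k, y + r k]%classic z <->
  `]x, y]%classic z.
  have [n _ Hn] := filterI (near_shift z y) (near_shift z x).
  by exists n => // k /Hn [[_ h1 _ _] [_ _ _ h2]]; rewrite /= !in_itv/= h1 h2.
have E1 := cvg setT `]-oo, 0[%classic `]a', b']%classic (fun=> setT) (fun k => `]-oo,
  - r k[%classic)
  (fun k => `]a' + r k, b' + r k[%classic) mT (my _) (my _) (fun=> mT) (fun=> my _)
    (fun=> my _) nT nlt (oc _ _).
have E2 := cvg `]-oo, 0[%classic setT `]a, b]%classic (fun k => `]-oo, - r k[%classic)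
  (fun=> setT)
  (fun k => `]a + r k, b + r k[%classic) (my _) mT (my _) (fun=> my _) (fun=> mT)
    (fun=> my _) nlt nT (oc _ _).
have E3 := cvg setT setT `]a', b']%classic (fun=> setT) (fun=> setT)
  (fun k => `[a' + r k, b' + r k]%classic) mT mT (my _) (fun=> mT) (fun=> mT)
    (fun=> my _) nT nT (cc _ _).
have E4 := cvg `]-oo, 0[%classic `]-oo, 0[%classic `]a, b]%classic (fun k => `]-oo,
  - r k]%classic)
  (fun k => `]-oo, - r k]%classic) (fun k => `[a + r k, b + r k]%classic) (my _) (my _)
    (my _)
  (fun=> my _) (fun=> my _) (fun=> my _) nle nle (cc _ _).
have [k _ Hk] := filterI E1 (filterI E2 (filterI E3 E4)).
have [h1 [h2 [h3 h4]]] := Hk k (leqnn k).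
have r0 : 0 < r k by rewrite invr_gt0.
do 4 eexists; split; last first.
- apply: (@open_closed_comparison (a + r k) (b + r k) (a' + r k) (b' + r k) (- r k)); lra.
- move: h3 h4; rewrite !ler_distl => /andP[? ?] /andP[? ?]; split; lra.
- move: h1 h2; rewrite !ler_distl => /andP[? ?] /andP[? ?]; split; lra.
- by rewrite !pr_ge0.
- by rewrite !pr_ge0 !pr1//; exact: measurable_Vevent.
Qed.

End vervaat_comparison.

(** * Tubes around polygonal paths *)

Section interpolation.
Context {R : realType}.
Implicit Types f : R -> R.

Lemma dyadic_modulus f (e : R) : cont01 f -> 0 < e ->
  \forall m \near \oo, forall x y : R, 0 <= x <= 1 -> 0 <= y <= 1 -> `|x - y| <= dy m 1 ->
    `|f x - f y| <= e.
Proof.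
move=> cf e0.
have /compact_near_coveringP := @segment_compact R 0 1.
move=> /(_ nat \oo (fun m x => 0 <= x <= 1 -> forall y, 0 <= y <= 1 -> `|x - y| <= dy m 1 ->
    `|f x - f y| <= e) _) => H.
have [|n _ Hn] := H; last first.
  by exists n => // m nm x y x01 y01; apply: (Hn m nm) => //; rewrite /= in_itv.
move=> x; rewrite /= in_itv/= => x01.
have e2 : 0 < e / 2 by rewrite divr_gt0.
have [del del0 Hd] := cf x x01 _ e2.
have d2 : 0 < del / 2 by rewrite divr_gt0.
exists (ball x (del / 2), [set m | dy m 1 < del / 2]).
  by split => /=; [exact: nbhsx_ballx|exact: dy1_near].
move=> [x' m] /= [xx' dm] x'01 y y01 x'y; rewrite /ball/= in xx'.
have h1 : `|x - x'| < del by apply: lt_trans xx' _; lra.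
have h2 : `|x - y| < del.
  rewrite (_ : x - y = (x - x') + (x' - y)); last by ring.
  by apply: le_lt_trans (ler_normD _ _) _; lra.
have := Hd _ x'01 h1; have := Hd _ y01 h2.
rewrite !ltr_norml ler_norml => /andP[? ?] /andP[? ?]; apply/andP; split; lra.
Qed.

(* Second difference of [w |-> green w u]. *)
Definition tent (w h u : R) : R := 2 * Num.min u w - Num.min u (w - h) - Num.min u (w + h).

Lemma tent_green w h u : tent w h u = 2 * green w u - green (w - h) u - green (w + h) u.
Proof. by rewrite /tent /green; ring. Qed.

Lemma tent_out w h u : 0 <= h -> h <= `|u - w| -> tent w h u = 0.
Proof.
move=> h0; rewrite ler_normr /tent => /orP[uw|uw].
  by rewrite !min_r; lra.
by rewrite !min_l; lra.
Qed.

Lemma tent_in w h u : `|u - w| <= h -> tent w h u = h - `|u - w|.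
Proof.
rewrite /tent ler_norml => /andP[h1 h2]; case: (ger0P (u - w)) => uw.
  by rewrite [Num.min u w]min_r ?[Num.min u (w - h)]min_r ?[Num.min u (w + h)]min_l; lra.
by rewrite [Num.min u w]min_l ?[Num.min u (w - h)]min_r ?[Num.min u (w + h)]min_l; lra.
Qed.

Lemma tent_ge0 w h u : 0 <= h -> 0 <= tent w h u.
Proof.
move=> h0; case: (lerP `|u - w| h) => [H|/ltW H]; last by rewrite tent_out.
by rewrite tent_in// subr_ge0.
Qed.

Lemma tent_lip w h u u' : `|tent w h u - tent w h u'| <= 4 * `|u - u'|.
Proof.
have mlip (c : R) : `|Num.min u c - Num.min u' c| <= `|u - u'|.
  have h1 := ler_norm (u - u'); have h2 := ler_norm (u' - u); rewrite distrC in h2.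
  rewrite ler_norml; case: (lerP u c) => ?; case: (lerP u' c) => ?; apply/andP; split; lra.
have := mlip w; have := mlip (w - h); have := mlip (w + h).
rewrite /tent !ler_norml => /andP[? ?] /andP[? ?] /andP[? ?]; apply/andP; split; lra.
Qed.

(** On a cell, all the tents vanish except those centered at its two ends, and these give the linear
    interpolation. *)
Lemma tent_interpolation m (c : nat -> R) k u : (k < 2 ^ m)%N -> dy m k <= u <= dy m k.+1 ->
  \sum_(0 <= i < (2 ^ m).+1) c i * tent (dy m i) (dy m 1) u =
  c k * (dy m k.+1 - u) + c k.+1 * (u - dy m k).
Proof.
move=> km /andP[ku uk].
have dS i : dy m i.+1 = dy m i + dy m 1 :> R by rewrite -dyD addn1.
have d0 : 0 <= dy m 1 :> R by exact: dy_ge0.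
rewrite (@big_cat_nat _ _ _ k)//=; last by lia.
rewrite [X in X + _]big1_seq ?add0r; last first.
  move=> i /=; rewrite mem_index_iota => /andP[_ ik]; rewrite tent_out ?mulr0//.
  have : dy m i.+1 <= dy m k :> R by rewrite ler_dy.
  by rewrite dS => ?; rewrite ger0_norm; lra.
rewrite big_ltn; last by lia.
rewrite big_ltn; last by lia.
rewrite [X in _ + (_ + X)]big1_seq ?addr0; last first.
  move=> i /=; rewrite mem_index_iota => /andP[ki _]; rewrite tent_out ?mulr0//.
  have : dy m k.+2 <= dy m i :> R by rewrite ler_dy.
  by rewrite dS => ?; rewrite ler0_norm; lra.
rewrite (dS k) in uk *.
rewrite !tent_in; last 2 first.
- by rewrite ler0_norm; lra.
- by rewrite ger0_norm; lra.
by rewrite ger0_norm ?subr_ge0// ler0_norm; [congr (_ * _ + _ * _); ring|lra].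
Qed.

(** Heights are integer multiples of [e], so that the polygons of all levels form a countable
    family. The factor [2 ^ m] compensates the height [dy m 1] of a tent. *)
Definition polygon m (e : R) (z : seq int) u :=
  \sum_(1 <= i < 2 ^ m) (e * (nth 0 z i)%:~R * (2 ^ m)%:R) * tent (dy m i) (dy m 1) u.

(** One [e] accounts for the oscillation of [f] on a cell, the other for rounding the heights. *)
Lemma polygon_approx f (e : R) : cont01 f -> f 0 = 0 -> f 1 = 0 -> 0 < e ->
  exists m z, forall u, 0 <= u <= 1 -> `|f u - polygon m e z u| <= 2 * e.
Proof.
move=> cf f0 f1 e0; have [m _ /(_ m (leqnn m))/= Hm] := dyadic_modulus cf e0.
pose z := mkseq (fun i => Num.floor (f (dy m i) / e)) (2 ^ m).+1.
have zE i : (i <= 2 ^ m)%N -> nth 0 z i = Num.floor (f (dy m i) / e).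
  by move=> im; rewrite nth_mkseq.
have zf i : (i <= 2 ^ m)%N -> `|f (dy m i) - e * (nth 0 z i)%:~R| <= e.
  move=> im; rewrite zE//; have /andP[] := floor_itv (f (dy m i) / e).
  rewrite ler_pdivlMr// ltr_pdivrMr// intrD mulrDl mul1r mulrC => h1 h2.
  by rewrite ger0_norm; lra.
have p2 : (0 < 2 ^ m)%N by rewrite expn_gt0.
have p2R : 0 < (2 ^ m)%:R :> R by rewrite ltr0n.
exists m, z => u u01.
have -> : polygon m e z u = \sum_(0 <= i < (2 ^ m).+1)
    (e * (nth 0 z i)%:~R * (2 ^ m)%:R) * tent (dy m i) (dy m 1) u.
  rewrite big_nat_recr//= big_ltn// !zE// dy_end f1 dy0 f0 mul0r floor0.
  by rewrite mulr0 !mul0r add0r addr0.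
have [k km /andP[ku uk]] : exists2 k, (k < 2 ^ m)%N & dy m k <= u <= dy m k.+1.
  have /andP[u0] := u01; rewrite le_eqVlt => /orP[/eqP ->|u1].
    exists (2 ^ m).-1; first by rewrite prednK.
    by rewrite prednK// dy_end lexx dy_le1 leq_pred.
  have /andP[h1 h2] := dyflP m u0; exists (dyfl m u); last by rewrite h1 ltW.
  by rewrite -(@ltr_dy R m) dy_end (le_lt_trans h1).
rewrite (tent_interpolation _ km) ?ku//.
have N1 : (dy m k.+1 - dy m k) * (2 ^ m)%:R = 1 :> R.
  by rewrite -(addn1 k) dyD [_ + dy m 1]addrC addrK dyE mul1r mulVf// gt_eqF.
pose al := (2 ^ m)%:R * (dy m k.+1 - u); pose be := (2 ^ m)%:R * (u - dy m k).
have al0 : 0 <= al by rewrite mulr_ge0 ?subr_ge0// ltW.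
have be0 : 0 <= be by rewrite mulr_ge0 ?subr_ge0// ltW.
have albe : al + be = 1 by rewrite -N1 /al /be; ring.
have dS : dy m k.+1 - dy m k = dy m 1 :> R by rewrite -(addn1 k) dyD addrAC subrr add0r.
have bnd i : (i <= 2 ^ m)%N -> `|u - dy m i| <= dy m 1 ->
  `|f u - e * (nth 0 z i)%:~R| <= 2 * e.
  move=> im ui; rewrite (_ : f u - _ = (f u - f (dy m i)) + (f (dy m i)
    - e * (nth 0 z i)%:~R)); last by ring.
  apply: (le_trans (ler_normD _ _)); rewrite (_ : 2 * e = e + e); last by ring.
  by apply: lerD; [apply: Hm => //; exact: dy_itv|exact: zf].
have b1 : `|f u - e * (nth 0 z k)%:~R| <= 2 * e.
  by apply: bnd; [exact: ltnW|rewrite ger0_norm; lra].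
have b2 : `|f u - e * (nth 0 z k.+1)%:~R| <= 2 * e.
  by apply: bnd => //; rewrite ler0_norm; lra.
rewrite (_ : f u - _ = al * (f u - e * (nth 0 z k)%:~R)
  + be * (f u - e * (nth 0 z k.+1)%:~R)); last first.
  transitivity ((al + be) * f u - (al * (e * (nth 0 z k)%:~R)
    + be * (e * (nth 0 z k.+1)%:~R))); last by ring.
  by rewrite albe mul1r /al /be; congr (_ - _); ring.
apply: (le_trans (ler_normD _ _)); rewrite (normrM al) (normrM be) (ger0_norm al0)
  (ger0_norm be0).
apply: (@le_trans _ _ (al * (2 * e) + be * (2 * e))); last by rewrite -mulrDl albe mul1r.
by apply: lerD; exact: ler_wpM2l.
Qed.

End interpolation.

Section tubes.
Context {R : realType} d (T : measurableType d) (P : probability T R).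
Variables (lam : R) (B : R -> {RV P >-> R}).
Hypotheses (lam0 : lam < 0) (HB : is_brownian_bridge lam B).
Local Notation path w := (fun u => B u w).
Variable eta : R.
Hypothesis eta0 : 0 < eta.
Implicit Type v : R -> R.

(* The end points are left out: all the paths and centers agree there. *)
Definition grid_tube v m : set T :=
  [set w | forall i, (0 < i < 2 ^ m)%N -> `|B (dy m i) w - v (dy m i)| <= eta].

Definition tube v : set T := \bigcap_m grid_tube v m.

Lemma measurable_grid_tube v m : measurable (grid_tube v m).
Proof.
rewrite (_ : grid_tube v m = \bigcap_(i in [set i | (0 < i < 2 ^ m)%N])
   B (dy m i) @^-1` `[v (dy m i) - eta, v (dy m i) + eta]).
  apply: bigcap_measurableType => i _; rewrite -[X in measurable X]setTI.
  exact: measurable_funP.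
by apply/seteqP; split => w H i /= im; have := H i im; rewrite /= in_itv/= ler_distl.
Qed.

Lemma measurable_tube v : measurable (tube v).
Proof. by apply: bigcap_measurableType => m _; exact: measurable_grid_tube. Qed.

Lemma grid_tube_anti v m m' : (m <= m')%N -> grid_tube v m' `<=` grid_tube v m.
Proof.
move=> mm w H i /andP[i0 im]; rewrite (dy_refine _ mm); apply: H.
have p0 : (0 < 2 ^ (m' - m))%N by rewrite expn_gt0.
by rewrite muln_gt0 i0 p0/= -[X in (_ < 2 ^ X)%N](subnKC mm) expnD ltn_pmul2r.
Qed.

Lemma pr_tube_ge v (x : R) : (\forall m \near \oo, x <= pr P (grid_tube v m)) ->
  x <= pr P (tube v).
Proof.
move=> H; apply/ler_addgt0Pr => e e0.
have := @pr_limsup _ _ _ P (tube v) (grid_tube v) e (measurable_tube v)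
  (measurable_grid_tube v) _ e0.
case=> [|n _ Hn].
  apply: aeW => w; have [tw|ntw] := pselect (tube v w); first exact: nearW.
  have [m0 nm0] : exists m, ~ grid_tube v m w.
    apply: contrapT => nE; apply: ntw => m _; apply: contrapT => nt.
    by apply: nE; exists m.
  by exists m0 => // m /= mm /(grid_tube_anti mm).
have [n' _ Hn'] := H.
apply: le_trans (Hn' (maxn n n') _) (Hn _ _); rewrite /= ?leq_maxl ?leq_maxr//.
Qed.

Lemma eq_tube v v' : (forall u, 0 <= u <= 1 -> v u = v' u) -> tube v = tube v'.
Proof.
move=> vv'; apply/seteqP; split => w H m _ i im.
  by rewrite -vv'; [exact: H m I i im|apply: dy_itv; case/andP: im => _ /ltnW].
by rewrite vv'; [exact: H m I i im|apply: dy_itv; case/andP: im => _ /ltnW].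
Qed.

(** Inside the tube the value at the kink is bounded by [K], so [cameron_martin] applies to the
    whole tube. Its constant is the same at all levels, hence the lower bound survives the
    intersection over the levels. *)
Lemma tube_green v m0 k0 c : (0 < k0 < 2 ^ m0)%N -> 0 < pr P (tube v) ->
  0 < pr P (tube (fun u => v u + c * green (dy m0 k0) u)).
Proof.
move=> k0m pv; set v' := fun u => _.
pose K := `|v (dy m0 k0)| + eta.
apply: (@lt_le_trans _ _ (cm_const lam (- c) K * pr P (tube v))).
  by rewrite mulr_gt0 ?cm_const_gt0.
apply: pr_tube_ge; exists m0 => // m /= mm.
pose k := (k0 * 2 ^ (m - m0))%N.
have p0 : (0 < 2 ^ (m - m0))%N by rewrite expn_gt0.
have k2 : (0 < k < 2 ^ m)%N.
  case/andP: k0m => k00 k0m; rewrite /k muln_gt0 k00 p0/=.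
  by rewrite -[X in (_ < 2 ^ X)%N](subnKC mm) expnD ltn_pmul2r.
have kE : dy m k = dy m0 k0 :> R by rewrite [RHS](dy_refine _ mm).
have kl : (0 < k <= lev m)%N by rewrite -(ltnS k) levS.
pose E : set ((lev m).-tuple R) := rect 1 (fun i => `[v (dy m i) - eta, v (dy m i)
  + eta]%classic).
have mE : measurable E by apply: measurable_rect => i; exact: measurable_itv.
have := @cameron_martin R d T P lam B lam0 HB (lev m) k (- c) K E kl mE.
have tE : grid_tube v m = [set w | E (gridtuple B (lev m) w) /\ `|B (gridtime (lev m) k)
  w| <= K].
  apply/seteqP; split => w H.
    split.
      move=> i il; rewrite nth_gridtuple// add1n /= in_itv/= -ler_distl.
      by apply: H; rewrite /= -levS ltnS.
    rewrite -/(dy m k) /K -kE -(subrKC (v (dy m k)) (B (dy m k) w)).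
    by apply: (le_trans (ler_normD _ _)); rewrite lerD2l; exact: H.
  move=> i /andP[i00 im]; have [EH _] := H.
  have il : (i.-1 < lev m)%N by rewrite -ltnS levS prednK.
  have := EH i.-1 il; rewrite nth_gridtuple// add1n prednK// /= in_itv/= -ler_distl; exact.
have tE' : grid_tube v' m = [set w | E [tuple gridval B (lev m) i.+1 w +
     - c * green (gridtime (lev m) k) (gridtime (lev m) i.+1) | i < lev m]].
  have e i w : B (dy m i) w - v' (dy m i) =
     gridval B (lev m) i w + - c * green (gridtime (lev m) k) (gridtime (lev m) i)
       - v (dy m i).
    by rewrite /v' /gridval -!/(dy _ _) kE; ring.
  apply/seteqP; split => w H.
    move=> i il; rewrite -(tnth_nth _ _ (Ordinal il))
      tnth_mktuple add1n /= in_itv/= -ler_distl -e.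
    by apply: H; rewrite /= -levS ltnS.
  move=> i /andP[i00 im].
  have il : (i.-1 < lev m)%N by rewrite -ltnS levS prednK.
  have := H i.-1 il; rewrite -(tnth_nth _ _ (Ordinal il)) tnth_mktuple add1n /= prednK//.
  by rewrite in_itv/= -ler_distl -e.
rewrite -tE -tE' => H; apply: (@le_trans _ _ (cm_const lam (- c) K * pr P (grid_tube v m))).
  rewrite ler_wpM2l ?(ltW (cm_const_gt0 _ _ _))// -lee_fin !prE; last 2 first.
  - exact: measurable_grid_tube.
  - exact: measurable_tube.
  apply: le_measure; rewrite ?inE; [exact: measurable_tube|exact: measurable_grid_tube|].
  by move=> w; apply.
rewrite -lee_fin EFinM !prE//; exact: measurable_grid_tube.
Qed.

Lemma tube_green_ends v m k c : (k <= 2 ^ m)%N -> 0 < pr P (tube v) ->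
  0 < pr P (tube (fun u => v u + c * green (dy m k) u)).
Proof.
move=> km pv; have [k0|] := boolP (0 < k < 2 ^ m)%N; first exact: tube_green.
move=> nk; rewrite (eq_tube (v' := v))// => u /andP[u0 u1].
have : (k == 0)%N || (k == 2 ^ m)%N.
  by move: nk; rewrite negb_and -leqNgt leqn0 -leqNgt => /orP[->//|mk];
    rewrite [X in _ || X]eqn_leq km mk orbT.
case/orP => /eqP ->; first by rewrite dy0 green_ge// mul0r mulr0 addr0.
by rewrite dy_end green_le// subrr mulr0 mulr0 addr0.
Qed.

Lemma tube_tent v m i c : (0 < i < 2 ^ m)%N -> 0 < pr P (tube v) ->
  0 < pr P (tube (fun u => v u + c * tent (dy m i) (dy m 1) u)).
Proof.
move=> /andP[i0 im] pv.
have iS : dy m i + dy m 1 = dy m i.+1 :> R by rewrite -dyD addn1.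
have iP : dy m i - dy m 1 = dy m i.-1 :> R by rewrite -subn1 dyB.
have h1 := tube_green_ends (2 * c) (ltnW im) pv.
have h2 := tube_green_ends (- c) (leq_trans (leq_pred i) (ltnW im)) h1.
have := tube_green_ends (- c) im h2; congr (0 < pr P (tube _)).
by apply/funext => u; rewrite tent_green iS iP; ring.
Qed.

Lemma tube_tents v m (c : nat -> R) r : all (fun i => 0 < i < 2 ^ m)%N r ->
  0 < pr P (tube v) ->
  0 < pr P (tube (fun u => v u + \sum_(i <- r) c i * tent (dy m i) (dy m 1) u)).
Proof.
elim: r v => [|i r IH] v /=.
  by move=> _; congr (0 < pr P (tube _)); apply/funext => u; rewrite big_nil addr0.
move=> /andP[ir rr] pv; have := IH _ rr (tube_tent (c i) ir pv).
by congr (0 < pr P (tube _)); apply/funext => u; rewrite big_cons addrA.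
Qed.

Lemma ae_false : ~ {ae P, forall w, False}.
Proof.
move=> [N [mN PN sN]]; have NT : N = setT.
  by apply/seteqP; split => // w _; apply: sN => /=; exact.
have : (P setT = 0)%E by rewrite -NT.
by rewrite probability_setT => /eqP; rewrite onee_eq0.
Qed.

Lemma cont01_affine (a : R) : cont01 (fun u : R => a * u).
Proof.
move=> x _ e e0; exists (e / (`|a| + 1)); first by rewrite divr_gt0// ltr_wpDl.
move=> y _; rewrite ltr_pdivlMr ?ltr_wpDl// -mulrBr normrM => H.
apply: le_lt_trans H; rewrite mulrC mulrDr mulr1 lerDl//.
Qed.

Lemma cont01D (f g : R -> R) : cont01 f -> cont01 g -> cont01 (fun u => f u + g u).
Proof.
move=> cf cg x x01 e e0; have e2 : 0 < e / 2 by rewrite divr_gt0.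
have [d1 d10 H1] := cf x x01 _ e2; have [d2 d20 H2] := cg x x01 _ e2.
exists (Num.min d1 d2) => [|y y01]; first by rewrite lt_min d10.
rewrite lt_min => /andP[l1 l2].
have := H1 y y01 l1; have := H2 y y01 l2.
by rewrite !ltr_norml => /andP[? ?] /andP[? ?]; apply/andP; split; lra.
Qed.

(** Almost every path lies in one of countably many tubes, those around [lam * u] plus a polygon, so
    one of them has positive probability; subtracting its tents brings the center back to the
    line. *)
Lemma tube_affine_pos : 0 < pr P (tube (fun u => lam * u)).
Proof.
(* [polygon_approx] is accurate up to [2 * e], which is then the radius of the tube. *)
pose e := eta / 2; have e0 : 0 < e by rewrite divr_gt0.
pose psi (mz : nat * seq int) (u : R) := lam * u + polygon mz.1 e mz.2 u.
have [[mz H]|nH] := pselect (exists mz, 0 < pr P (tube (psi mz))).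
  have rr : all (fun i => 0 < i < 2 ^ mz.1)%N (index_iota 1 (2 ^ mz.1)).
    by apply/allP => i; rewrite mem_index_iota.
  have := tube_tents (fun i => - (e * (nth 0 mz.2 i)%:~R * (2 ^ mz.1)%:R)) rr H.
  congr (0 < pr P (tube _)); apply/funext => u; rewrite /psi /polygon -addrA -big_split/=.
  by rewrite big1 ?addr0// => i _; rewrite mulNr subrr.
have Z mz : P (tube (psi mz)) = 0%E.
  rewrite -prE; last exact: measurable_tube.
  congr EFin; apply/eqP; rewrite eq_le pr_ge0 andbT leNgt; apply/negP => h.
  by apply: nH; exists mz.
exfalso; apply: ae_false.
have H1 : {ae P, forall w (n : nat), ~ (if unpickle n is Some mz then tube (psi mz)
  w else False)}.
  apply: ae_foralln => n; case: unpickle => [mz|]; last by apply: aeW => w; case.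
  exists (tube (psi mz)); split; [exact: measurable_tube|exact: Z|].
  by move=> w /= /contrapT.
apply: filterS2 H1 (bridge_end HB) => w H1 B1.
have cB := cont01P (bridge_continuous HB (w:=w)).
have cf := cont01D cB (cont01_affine (- lam)).
have [| |m [z Hz]] := polygon_approx cf _ _ e0.
- by rewrite (bridge_start HB) mulr0 addr0.
- by rewrite B1 mulr1 subrr.
apply: (H1 (pickle (m, z))); rewrite pickleK => m' _ i /andP[_ im].
have := Hz _ (dy_itv (ltnW im)); rewrite /psi /e [2 * _]mulrC divfK//.
by congr (`|_| <= _); rewrite /=; ring.
Qed.

Lemma tube_tent_pos m i H : (0 < i < 2 ^ m)%N ->
  0 < pr P (tube (fun u => lam * u + H * tent (dy m i) (dy m 1) u)).
Proof. by move=> im; apply: tube_tent => //; exact: tube_affine_pos. Qed.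

(** Membership in a tube concerns dyadic times only; continuity carries it to all times. *)
Lemma tube_path v w : cont01 v -> v 0 = 0 -> v 1 = B 1 w -> tube v w ->
  forall u, 0 <= u <= 1 -> `|B u w - v u| <= eta.
Proof.
move=> cv v0 v1 tw u u01; apply/ler_addgt0Pr => e e0.
have cB := cont01P (bridge_continuous HB (w:=w)).
have e2 : 0 < e / 2 by rewrite divr_gt0.
have [d1 d10 H1] := cB u u01 _ e2; have [d2 d20 H2] := cv u u01 _ e2.
have d0 : 0 < Num.min d1 d2 by rewrite lt_min d10.
have [m _ /(_ m (leqnn m))/=] := dy1_near d0; rewrite lt_min => /andP[l1 l2].
have [u0 _] := andP u01.
have im := dyfl_le m u01; have h := dyfl_dist m u0.
have h1 := H1 _ (dy_itv im) (lt_trans h l1); have h2 := H2 _ (dy_itv im) (lt_trans h l2).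
have : `|B (dy m (dyfl m u)) w - v (dy m (dyfl m u))| <= eta.
  have [->|i0] := eqVneq (dyfl m u) 0%N; first by rewrite dy0 v0 (bridge_start HB)
    subrr normr0 ltW.
  have [->|iN] := eqVneq (dyfl m u) (2 ^ m)%N; first by rewrite dy_end v1 subrr normr0 ltW.
  by apply: (tw m I); rewrite lt0n i0 ltn_neqAle iN im.
move: h1 h2; rewrite !ltr_norml !ler_norml => /andP[? ?] /andP[? ?] /andP[? ?].
by apply/andP; split; lra.
Qed.

End tubes.

(** * Events of positive probability *)

Section positive_events.
Context {R : realType} d (T : measurableType d) (P : probability T R).
Variables (lam : R) (B : R -> {RV P >-> R}).
Hypotheses (lam0 : lam < 0) (HB : is_brownian_bridge lam B).
Local Notation path w := (fun u => B u w).

Lemma pr_pos_ae (D E : set T) : measurable D -> measurable E ->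
  {ae P, forall w, D w -> E w} -> 0 < pr P D -> 0 < pr P E.
Proof.
move=> mD mE DE /lt_le_trans; apply.
by rewrite -lee_fin !prE//; exact: ae_le_measure.
Qed.

Lemma cont01_tent_path (a H c h : R) : cont01 (fun u => a * u + H * tent c h u).
Proof.
apply: cont01D; first exact: cont01_affine.
move=> x _ e e0; exists (e / (4 * (`|H| + 1))).
  by rewrite divr_gt0// mulr_gt0// ltr_wpDl.
move=> y _; rewrite ltr_pdivlMr ?mulr_gt0 ?ltr_wpDl// -mulrBr normrM => lt.
apply: (@le_lt_trans _ _ (`|H| * (4 * `|x - y|))); first by rewrite ler_wpM2l// tent_lip.
apply: le_lt_trans lt; rewrite (_ : _ * (4 * _) = `|x - y| * (4 * `|H|)); last by ring.
by rewrite ler_wpM2l// ler_pM2l// lerDl.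
Qed.

Lemma tent_path_ends m i (H : R) : (0 < i < 2 ^ m)%N ->
  lam * 0 + H * tent (dy m i) (dy m 1) 0 = 0 /\ lam * 1 + H * tent (dy m i) (dy m 1)
    1 = lam.
Proof.
move=> /andP[i0 im].
have d0 : 0 <= dy m 1 :> R by exact: dy_ge0.
have h1 : dy m 1 <= dy m i :> R by rewrite ler_dy.
have h2 : dy m i + dy m 1 <= 1 :> R by rewrite -dyD addn1 dy_le1.
split; rewrite tent_out//.
- by rewrite !mulr0 addr0.
- by rewrite sub0r normrN (le_trans h1)// ler_norm.
- by rewrite mulr1 mulr0 addr0.
- by rewrite ger0_norm; lra.
Qed.

(** A path that follows a line with a deep tent downwards near 0 has its argmin there. *)
Lemma early_pos (x : R) : 0 < x <= 1 -> 0 < pr P [set w | first_argmin (path w) < x].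
Proof.
move=> /andP[x0 x1]; have x2 : 0 < x / 2 by rewrite divr_gt0.
have [m _ /(_ m (leqnn m))/= dm] := dy1_near x2.
set h := dy m 1 in dm.
have h0 : 0 < h by rewrite /h -(dy0 m) ltr_dy.
have i1 : (0 < 1 < 2 ^ m)%N by rewrite /= -(@ltr_dy R m) dy_end -/h; lra.
(* At time [h] the center is at [lam * h + lam - 3], and after [2 * h] it is at least [lam]; in a
   tube of radius 1 around it, the path at [h] is below all its values after [x]. *)
pose H := (lam - 3) / h.
apply: (pr_pos_ae _ _ _ (tube_tent_pos lam0 HB (@ltr01 R) H i1)).
- exact: measurable_tube.
- by apply: (measurable_tau_lt HB); exact: ltW.
apply: filterS (bridge_end HB) => w B1 tw.
have [v0 v1] := tent_path_ends H i1.
have tp := tube_path HB ltr01 (cont01_tent_path lam H (dy m 1) (dy m 1))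
  v0 (etrans v1 (esym B1)) tw.
have [tau01 taumin] := first_argminP (bridge_continuous HB (w := w)).
rewrite /= ltNge; apply/negP => xt.
have h01 : 0 <= h <= 1 by apply/andP; split; lra.
have := taumin h h01; have := tp _ tau01; have := tp h h01.
rewrite /= -/h (@tent_out _ _ _ (first_argmin _)); last 2 first.
- exact: ltW.
- by rewrite ler_normr; apply/orP; left; lra.
rewrite tent_in ?subrr ?normr0 ?(ltW h0)// subr0 {2}/H divfK ?gt_eqF// mulr0 addr0.
case/andP: tau01; set tau := first_argmin _ => t0 t1.
rewrite !ler_norml => /andP[_ h1] /andP[h2 _].
have : lam * h <= 0 by rewrite nmulr_rle0// ltW.
have : lam <= lam * tau by rewrite ler_niMr// ltW.
lra.
Qed.

(** [V_s] is finite, so a large [y0] keeps at least half of the probability that the argmin is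
    early. *)
Lemma early_event_pos m0 is_ it' : (is_ <= 2 ^ m0)%N -> (it' < 2 ^ m0)%N ->
  exists2 y0 : R, 0 <= y0 & 0 < pr P (early_event B m0 is_ it' y0).
Proof.
move=> ism it'm.
have x01 : 0 < (1 - dy m0 it' : R) <= 1.
  by rewrite subr_gt0 -(dy_end m0) ltr_dy it'm/= lerBlDr lerDl dy_ge0.
have [x0 _] := andP x01.
have D0 := early_pos x01.
set D := mkset _ in D0.
have mD : measurable D by apply: (measurable_tau_lt HB); exact: ltW.
have d2 : 0 < pr P D / 2 by rewrite divr_gt0.
have := @pr_liminf _ _ _ P D (fun n => early_event B m0 is_ it' n%:R) _ mD _ _ d2.
case.
- move=> n; apply: measurableI => //.
  rewrite [X in measurable X](_ : _ = [set w | `]-oo, n%:R[%classic (vval B m0 is_ w)]).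
    rewrite -[X in measurable X]setTI.
    have mv : measurable_fun setT (vval B m0 is_) by apply: (measurable_vervaat HB);
      exact: dy_itv.
    exact: mv measurableT _ (measurable_itv _).
  by apply/seteqP; split => w /=; rewrite in_itv.
- apply: aeW => w Dw; exists (Num.trunc `|vval B m0 is_ w|).+1 => // n /= nn; split => //.
  apply: (le_lt_trans (ler_norm _));
    apply: (@lt_le_trans _ _ (Num.trunc `|vval B m0 is_ w|).+1%:R).
    by case/andP: (truncn_itv (normr_ge0 (vval B m0 is_ w))).
  by rewrite ler_nat.
- by move=> n _ /(_ n (leqnn n))/= Hn; exists n%:R => //; lra.
Qed.

(** The path follows the line of slope [lam], except for a tent at [s] that reaches the middle of
    []p, q[]. Its argmin is then close to 1 and the transform is nearly the path itself. The
    transform reads the path at slightly earlier times, which moves [u] away from the tent but [t]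
    towards it: hence at least two cells between [s] and [t]. *)
Lemma Vevent_pos m0 iu is_ it (p q : R) : (0 < iu)%N -> (iu < is_)%N -> (is_.+1 < it)%N ->
  (it < 2 ^ m0)%N -> 0 <= p -> p < q ->
  0 < pr P (Vevent B m0 iu is_ it `]-oo, 0[ `]-oo, 0[ `]p, q[).
Proof.
move=> iu0 ius isit itm p0 pq.
set h : R := dy m0 1; set s : R := dy m0 is_; set t : R := dy m0 it; set u : R := dy m0 iu.
have h0 : 0 < h by rewrite /h -(dy0 m0) ltr_dy.
have u_h : h <= u by rewrite ler_dy.
have us : u + h <= s by rewrite -dyD addn1 ler_dy.
have st : s + h + h <= t by rewrite -!dyD !addn1 ler_dy.
have t1 : t < 1 by rewrite -(dy_end m0) ltr_dy.
have ish : (0 < is_ < 2 ^ m0)%N by apply/andP; split; lia.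
pose G := (p + q) / 2 - lam * s.
have G0 : 0 < G.
  have : lam * s <= 0 by rewrite nmulr_rle0//; lra.
  rewrite /G; lra.
pose H := G / h; have H0 : 0 < H by rewrite divr_gt0.
have Hh : H * h = G by rewrite divfK// gt_eqF.
(* The first bound forces [1 - tau <= h / 4] and keeps [V_u] and [V_t] negative, the second limits
   the error on the heights, and the third limits the drop [H * (1 - tau)] of the tent due to the
   change of time. *)
pose eta := Num.min (- lam * h / 4) (Num.min ((q - p) / 8) ((q - p) * (- lam) / (8 * H))).
have l0 : 0 < - lam by rewrite oppr_gt0.
have qp : 0 < q - p by rewrite subr_gt0.
have eta0 : 0 < eta.
  rewrite !lt_min; apply/and3P; split; rewrite divr_gt0//; exact: mulr_gt0.
have e1 : 4 * eta <= - lam * h by rewrite mulrC -ler_pdivlMr// ge_min lexx.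
have e2 : 8 * eta <= q - p by rewrite mulrC -ler_pdivlMr// !ge_min lexx orbT.
have e3 : eta * (8 * H) <= (q - p) * (- lam).
  rewrite -ler_pdivlMr; last exact: mulr_gt0.
  by rewrite /eta !ge_min lexx !orbT.
apply: (pr_pos_ae _ _ _ (tube_tent_pos lam0 HB eta0 H ish)).
- exact: measurable_tube.
- apply: (measurable_Vevent HB ius (ltnW isit) (leqnn it) itm); exact: measurable_itv.
apply: filterS (bridge_end HB) => w B1 tw.
have [v0 v1] := tent_path_ends H ish.
have tp := tube_path HB eta0 (cont01_tent_path lam H s h) v0 (etrans v1 (esym B1)) tw.
have [tau01 taumin] := first_argminP (bridge_continuous HB (w := w)).
have vE i : h <= dy m0 i -> 1 - first_argmin (path w) < h ->
    vval B m0 i w = B (dy m0 i - (1 - first_argmin (path w)))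
      w + lam - B (first_argmin (path w)) w.
  move=> hi th; rewrite /vval vervaatE /cyclic_shift leNgt (lt_le_trans th hi)/= B1.
  by congr (B _ w + _ - _); ring.
move: tau01 taumin vE; set tau := first_argmin _ => tau01 taumin vE.
have [tau0 tau1] := andP tau01.
have taulam : B tau w <= lam by rewrite -B1; apply: taumin; rewrite ler01 lexx.
have Ht x : 0 <= H * tent s h x by rewrite mulr_ge0 ?tent_ge0// ltW.
have := tp _ tau01; rewrite /= ler_norml => /andP[tp1 _].
have := Ht tau => Htau.
pose de := 1 - tau; have de0 : 0 <= de by rewrite subr_ge0.
have lamtau : lam * tau = lam - lam * de by rewrite /de; ring.
have lde : - lam * de <= eta by lra.
have deh : de <= h / 4.
  by rewrite -(ler_pM2l l0); lra.
have Hde : H * de <= (q - p) / 8.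
  rewrite -(ler_pM2r l0).
  have : H * (- lam * de) <= H * eta by rewrite ler_pM2l.
  lra.
have lde0 : 0 <= - lam * de by rewrite mulr_ge0// ltW.
have Btau : lam - eta <= B tau w by lra.
have deh' : 1 - tau < h by rewrite -/de; lra.
have lamle x : h <= x -> lam * x <= lam * h by move=> hx; rewrite ler_wnM2l// ltW.
have neg x : h <= x -> x <= 1 -> h <= `|x - de - s| -> B (x - de) w + lam - B tau w < 0.
  move=> hx x1 hxs; have x01 : 0 <= x - de <= 1 by apply/andP; split; lra.
  have := tp _ x01; rewrite /= tent_out ?(ltW h0)// mulr0 addr0 ler_norml => /andP[_ h1].
  have := lamle x hx; rewrite mulrBr in h1; lra.
have hs : h <= s by lra.
have ht : h <= t by lra.
split; rewrite /= in_itv/=.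
- rewrite vE// -/de -/u; apply: neg => //; first by lra.
  by rewrite ler_normr; apply/orP; right; lra.
- rewrite vE// -/de -/t; apply: neg => //; first by lra.
  by rewrite ler_normr; apply/orP; left; lra.
rewrite vE// -/de -/s.
have s01 : 0 <= s - de <= 1 by apply/andP; split; lra.
have := tp _ s01; rewrite /= (_ : tent s h (s - de) = h - de); last first.
  have ss : s - de - s = - de by rewrite addrAC subrr sub0r.
  by rewrite tent_in ss normrN ger0_norm//; lra.
rewrite (mulrBr lam s de) (mulrBr H h de) Hh /G ler_norml => /andP[h1 h2].
have Hde0 : 0 <= H * de by rewrite mulr_ge0// ltW.
apply/andP; split; lra.
Qed.

End positive_events.

(** * Conditional probabilities *)

Section borel_domination.
Context {R : realType}.

(** Outer regularity by half-open intervals, read off from the construction of Stieltjes measures as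
    outer measures. *)
Lemma halfopen_cover (f : cumulative R R) (mu : probability (measurableTypeR R) R)
    (K : set (measurableTypeR R)) (e : R) :
  (forall A : set (measurableTypeR R), measurable A ->
    lebesgue_stieltjes_measure f A = mu A) ->
  measurable K -> 0 < e ->
  exists J : (R * R)^nat, K `<=` \bigcup_k `](J k).1, (J k).2]%classic /\
    (\sum_(k <oo) mu (`](J k).1, (J k).2]%classic) <= mu K + e%:E)%E.
Proof.
move=> fmu mK e0.
have KE : mu_ext (wlength f) K = mu K by rewrite -fmu.
have Kfin : mu_ext (wlength f) K \is a fin_num by rewrite KE fin_num_measure.
have [x [A [mA KA] <-] lt] := lb_ereal_inf_adherent e0 Kfin.
have /choice[J JE] : forall k, exists J : R * R, A k = `]J.1, J.2]%classic.
  by move=> k; have [J _ <-] := mA k; exists J.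
exists J; split.
  by move=> y /KA [k _ Aky]; exists k => //; rewrite -JE.
rewrite -KE; apply: le_trans _ (ltW lt); apply: lee_nneseries => // k _.
rewrite -JE -fmu; last exact: sub_sigma_algebra.
by rewrite /lebesgue_stieltjes_measure /measure_extension measurable_mu_extE.
Qed.

Context d (T : measurableType d) (P : probability T R).

(** An inequality between measures, unlike an equality, does not extend from a pi-system to the
    sigma-algebra. Hence the covers by half-open intervals, truncated at [b] so as to stay where the
    hypothesis holds. *)
Lemma borel_domination (V : T -> R) (E : set T) (b c : R) : measurable_fun setT V ->
  measurable E -> 0 <= c ->
  (forall x y : R, b <= x -> x < y ->
     (P (E `&` V @^-1` `]x, y]) <= c%:E * P (V @^-1` `]x, y]))%E) ->
  forall K : set R, measurable K -> K `<=` `]b, +oo[ ->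
  (P (E `&` V @^-1` K) <= c%:E * P (V @^-1` K))%E.
Proof.
move=> mV mE c0 H K mK Kb.
have mV' : measurable_fun setT (V : T -> measurableTypeR R) by exact: mV.
pose X : {mfun T >-> measurableTypeR R} :=
  HB.pack_for {mfun T >-> measurableTypeR R} (V : T -> measurableTypeR R)
  (@isMeasurableFun.Build _ _ T (measurableTypeR R) V mV').
pose mu : probability (measurableTypeR R) R := distribution P X.
have mpre (A : set R) : measurable A -> measurable (V @^-1` A).
  by move=> mA; rewrite -[X in measurable X]setTI; exact: mV.
have Hoc (x y : R) : b <= x -> (P (E `&` V @^-1` `]x, y]) <= c%:E * P (V @^-1` `]x, y]))%E.
  move=> bx; have [xy|yx] := ltP x y; first exact: H.
  by rewrite set_itv_ge ?preimage_set0 ?setI0 ?measure0 ?mule0// bnd_simp -leNgt.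
apply/lee_addgt0Pr => e e0.
have ec0 : 0 < e / (c + 1) by rewrite divr_gt0// ltr_wpDl.
have [J [KJ sumJ]] := halfopen_cover (fun A => @lebesgue_stieltjes_cdf_id R mu A)
  (mK : measurable (K : set (measurableTypeR R))) ec0.
pose J' k := `](Num.max b (J k).1), (J k).2]%classic.
have mJ' k : measurable (J' k) by exact: measurable_itv.
have KJ' : K `<=` \bigcup_k J' k.
  move=> y Ky; have [k _] := KJ y Ky; have := Kb y Ky.
  rewrite /= !in_itv/= andbT => yb /andP[h1 h2]; exists k => //.
  by rewrite /J' /= in_itv/= gt_max yb h1.
apply: (@le_trans _ _ (\sum_(k <oo) P (E `&` V @^-1` (J' k)))%E).
  apply: measure_sigma_subadditive.
  - by move=> k; apply: measurableI => //; exact: mpre.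
  - by apply: measurableI => //; exact: mpre.
  - by move=> w [Ew /KJ' [k _ Jk]]; exists k.
apply: (@le_trans _ _ (\sum_(k <oo) (c%:E * mu (`](J k).1, (J k).2]%classic)))%E).
  apply: lee_nneseries => // k _; apply: le_trans (Hoc _ _ _) _.
    by rewrite le_max lexx.
  apply: lee_wpmul2l; first by rewrite lee_fin.
  have -> : mu `](J k).1, (J k).2]%classic = P (V @^-1` `](J k).1, (J k).2]) by [].
  apply: le_measure; rewrite ?inE;
    [exact: mpre (measurable_itv _)|exact: mpre (measurable_itv _)|].
  by move=> w /=; rewrite !in_itv/= gt_max => /andP[/andP[_ ->] ->].
rewrite nneseriesZl//.
apply: (@le_trans _ _ (c%:E * (mu K + (e / (c + 1))%:E))%E).
  by apply: lee_wpmul2l.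
have -> : mu K = P (V @^-1` K) by [].
have fK : P (V @^-1` K) \is a fin_num by apply: fin_num_measure; exact: mpre.
rewrite -(fineK fK) -EFinD -!EFinM -EFinD lee_fin mulrDr lerD2l mulrCA ger_pMr//.
by rewrite ler_pdivrMr ?ltr_wpDl// mul1r lerDl.
Qed.

End borel_domination.

Section conditional_ratio.
Context {R : realType} d (T : measurableType d) (P : probability T R).

(** By [dom], the mean of [Y] over any event of [V] beyond [b] is at most [c]. As [Y] is measurable
    with respect to [V], this forces [Y <= c] almost surely there, and the bound then passes to the
    intersection with [U]. *)
Lemma cond_prob_ratio (V Y : T -> R) (E U : set T) (b c : R) :
  measurable_fun setT V -> measurable E -> measurable U -> 0 <= c ->
  sigma_rv Y `<=` sigma_rv V -> P.-integrable setT (EFin \o Y) ->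
  (forall K : set R, measurable K ->
    (\int[P]_(w in V @^-1` K) (Y w)%:E = P (E `&` V @^-1` K))%E) ->
  (forall K : set R, measurable K ->
    (\int[P]_(w in U `&` V @^-1` K) (Y w)%:E = P (E `&` (U `&` V @^-1` K)))%E) ->
  (forall x y : R, b <= x -> x < y ->
     (P (E `&` V @^-1` `]x, y]) <= c%:E * P (V @^-1` `]x, y]))%E) ->
  forall K : set R, measurable K -> K `<=` `]b, +oo[ ->
  (P (E `&` (U `&` V @^-1` K)) <= c%:E * P (U `&` V @^-1` K))%E.
Proof.
move=> mV mE mU c0 YV iY intV intU dom K mK Kb.
have mpre (A : set R) : measurable A -> measurable (V @^-1` A).
  by move=> mA; rewrite -[X in measurable X]setTI; exact: mV.
have mY : measurable_fun setT Y by apply/measurable_EFinP; exact: measurable_int iY.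
have dom' := borel_domination mV mE c0 dom.
(* On [{Y > r} `&` {V > b}], which is an event of [V], the mean of [Y] would exceed [c]. *)
have null r : c < r -> P (Y @^-1` `]r, +oo[ `&` V @^-1` K) = 0%E.
  move=> cr.
  have /YV [K0 mK0] : sigma_rv Y (Y @^-1` `]r, +oo[).
    by exists `]r, +oo[%classic; [exact: measurable_itv|rewrite setTI].
  rewrite setTI => YE.
  rewrite -YE -preimage_setI; set D := V @^-1` _.
  have mK' : measurable (K0 `&` K) by exact: measurableI.
  have mD : measurable D by exact: mpre.
  have Dfin : P D \is a fin_num by exact: fin_num_measure.
  have h1 : (r%:E * P D <= c%:E * P D)%E.
    apply: le_trans (dom' _ mK' _); last by move=> x [_ /Kb].
    rewrite -intV// -integral_cst//; apply: le_integral => //.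
    - exact: finite_measure_integrable_cst.
    - exact: integrableS iY.
    - move=> w /set_mem [K0w _]; rewrite lee_fin ltW//.
      by have : (V @^-1` K0) w by []; rewrite YE /= in_itv/= andbT.
  move: h1; rewrite -(fineK Dfin) -!EFinM lee_fin => h1.
  congr EFin; apply/eqP; rewrite eq_le fine_ge0// andbT leNgt; apply/negP => D0.
  by move: h1; rewrite ler_pM2r// leNgt cr.
have mF : measurable (U `&` V @^-1` K) by apply: measurableI => //; exact: mpre.
rewrite -intU//; apply/lee_addgt0Pr => e e0.
pose N := Y @^-1` `](c + e), +oo[ `&` V @^-1` K.
have mN : measurable N.
  apply: measurableI; last exact: mpre.
  by rewrite -[X in measurable X]setTI; apply: mY => //; exact: measurable_itv.
rewrite (@negligible_integral _ _ _ _ _ N)//; last 2 first.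
- exact: integrableS iY.
- by apply: null; rewrite ltrDl.
have mFN := measurableD mF mN.
have le1 : (\int[P]_(w in (U `&` V @^-1` K) `\` N) (Y w)%:E <=
    (c + e)%:E * P ((U `&` V @^-1` K) `\` N))%E.
  rewrite -integral_cst//; apply: le_integral => //.
  - exact: integrableS iY.
  - exact: finite_measure_integrable_cst.
  - move=> w /set_mem [[_ Kw] nw]; rewrite lee_fin leNgt; apply/negP => lt; apply: nw;
    split => //.
    by rewrite /= in_itv/= lt.
apply: (le_trans le1); apply: (@le_trans _ _ ((c + e)%:E * P (U `&` V @^-1` K))%E).
  apply: lee_wpmul2l; first by rewrite lee_fin addr_ge0// ltW.
  by apply: le_measure; rewrite ?inE// => w [].
have Ffin : P (U `&` V @^-1` K) \is a fin_num by exact: fin_num_measure.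
have F1 : fine (P (U `&` V @^-1` K)) <= 1 by rewrite -lee_fin fineK//;
  exact: probability_le1.
rewrite -(fineK Ffin) -!EFinM -EFinD lee_fin mulrDl lerD2l.
by rewrite ler_piMr// ltW.
Qed.

End conditional_ratio.

Unset Implicit Arguments.

Theorem proposition3p2 (R : realType) (d : measure_display)
    (T : measurableType d) (P : probability T R)
    (lambda : R) (B : R -> {RV P >-> R}) :
  lambda < 0 ->
  is_brownian_bridge lambda B ->
  ~ is_markov P (fun t w => vervaat (fun u => B u w) t).
Proof.
move=> lam0 HB Mk.
(* The times [u = 1 / 4], [s = 1 / 2] and [t' = 3 / 4] are on the grid of level 2, so [y0] and [eps]
   are obtained before [t]. *)
have [|y0 y00 ey0] := early_event_pos (m0 := 2) (is_ := 2) (it' := 3) lam0 HB isT;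
  first by [].
pose eps := pr P (early_event B 2 2 3 y0) / 2.
have eps0 : 0 < eps by rewrite divr_gt0.
(* This makes [Lc = 1 + dy j 1] smaller than [Kc = 1 + eps / 4], whose term [eps / 4] is
   [(t' - s) * eps]. *)
have [j [j1 jeps]] : exists j, (0 < j)%N /\ dy j 1 < eps / 4.
  have H1 : \forall j \near \oo, (0 < j)%N by exists 1%N.
  have H2 := dy1_near (divr_gt0 eps0 (ltr0Sn R 3)).
  have [j _ Hj] := filterI H1 H2; exists j; exact: Hj j (leqnn j).
pose r := (2 ^ j)%N; pose m0 := (j + 2)%N.
have r2 : (1 < r)%N by rewrite -[1%N](expn0 2) ltn_exp2l.
have NE : (2 ^ m0 = r * 4)%N by rewrite expnD.
(* [t] comes two cells after [s], the least gap that [Vevent_pos] admits. *)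
pose iu := r; pose is_ := (2 * r)%N; pose it := (2 * r).+2; pose it' := (3 * r)%N.
have iu_gt0 : (0 < iu)%N by exact: ltnW.
have iu_is : (iu < is_)%N by rewrite /iu /is_; lia.
have is_it : (is_ < it)%N by rewrite /it.
have it_it' : (it <= it')%N by rewrite /it /it'; lia.
have it'_lt : (it' < 2 ^ m0)%N by rewrite NE /it'; lia.
have early : eps < pr P (early_event B m0 is_ it' y0).
  have dE i : dy 2 i = dy m0 (i * r) :> R.
    by rewrite (dy_refine (m' := m0)) ?leq_addl// /m0 addnK.
  have -> : early_event B m0 is_ it' y0 = early_event B 2 2 3 y0.
    by rewrite /early_event /vval !dE.
  by rewrite /eps ltr_pdivrMr// ltr_pMr// ltr1n.
have comp := vervaat_comparison lam0 HB iu_gt0 iu_is is_it it_it' it'_lt y00 eps0 early.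
move: comp; set Kc := 1 + _; set Lc := it%:R / is_%:R => comp.
have r0 : 0 < r%:R :> R by rewrite ltr0n.
have KE : Kc = 1 + eps / 4.
  rewrite /Kc NE (_ : it' - is_ = r)%N; last by rewrite /it' /is_; lia.
  by rewrite natrM; field; rewrite gt_eqF.
have LE : Lc = 1 + dy j 1.
  rewrite /Lc /it /is_ dyE -/r -addn2 natrD natrM; field; rewrite gt_eqF//.
have LK : Lc < Kc by rewrite KE LE ltrD2l.
have K0 : 0 < Kc by rewrite KE; lra.
have L0 : 0 <= Lc by rewrite LE addr_ge0// dy_ge0.
pose th := Lc / Kc.
have th0 : 0 <= th by rewrite divr_ge0// ltW.
have th1 : th < 1 by rewrite ltr_pdivrMr// mul1r.
have itm := ltnW (leq_ltn_trans it_it' it'_lt).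
have ism := leq_trans (ltnW is_it) itm.
have ium := leq_trans (ltnW iu_is) ism.
pose V := vval B m0 is_.
pose E := vval B m0 it @^-1` `]-oo, 0[.
pose U := vval B m0 iu @^-1` `]-oo, 0[.
have mV : measurable_fun setT V by exact: (measurable_vval HB ism).
have mE : measurable E by exact: (measurable_vval_pre HB itm (measurable_itv _)).
have mU : measurable U by exact: (measurable_vval_pre HB ium (measurable_itv _)).
have mpre (A : set R) : measurable A -> measurable (V @^-1` A).
  by move=> mA; rewrite -[X in measurable X]setTI; exact: mV.
have [Y [[YV iY intY] [_ _ intY']]] := Mk (dy m0 is_) (dy m0 it) `]-oo, 0[%classic
  (dy_ge0 _ _) ltac:(by rewrite ler_dy ltnW) ltac:(by rewrite dy_le1) (measurable_itv _).
have intV (K : set R) : measurable K ->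
    (\int[P]_(w in V @^-1` K) (Y w)%:E = P (E `&` V @^-1` K))%E.
  by move=> mK; apply: intY; exists K => //; rewrite setTI.
(* Here the Markov property acts: the version [Y] attached to [V_s] also serves the whole past of
   [s], to which [U] belongs. *)
have intU (K : set R) : measurable K ->
    (\int[P]_(w in U `&` V @^-1` K) (Y w)%:E = P (E `&` (U `&` V @^-1` K)))%E.
  move=> mK; apply: intY'.
  pose G := \bigcup_(u in `[0, dy m0 is_]) sigma_rv (fun w => vervaat (fun q => B q w) u).
  have gen i (A : set R) : (i <= is_)%N -> measurable A -> <<s G >> (vval B m0 i @^-1` A).
    move=> ii mA; apply: sub_gen_smallest; exists (dy m0 i).
      by rewrite /= in_itv/= dy_ge0 ler_dy.
    by exists A => //; rewrite setTI.
  have gU := gen iu `]-oo, 0[%classic (ltnW iu_is) (measurable_itv _).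
  have gV := gen is_ K (leqnn _) mK.
  exact: (@measurableI _ (g_sigma_algebraType G) _ _ gU gV).
have VJ (J : set R) : Vevent B m0 iu is_ it setT `]-oo, 0[ J = E `&` V @^-1` J.
  by apply/seteqP; split => w; [case=> _ ? ?|case=> ? ?].
have VI (J : set R) : Vevent B m0 iu is_ it `]-oo, 0[ setT J = U `&` V @^-1` J.
  by apply/seteqP; split => w; [case=> ? _ ?|case=> ? ?].
have VT (J : set R) : Vevent B m0 iu is_ it setT setT J = V @^-1` J.
  by apply/seteqP; split => w; [case=> _ _ ?|move=> ?].
have VUE (J : set R) : Vevent B m0 iu is_ it `]-oo, 0[ `]-oo,
  0[ J = E `&` (U `&` V @^-1` J).
  by apply/seteqP; split => w; [case=> ? ? ?|case=> ? [? ?]].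
(* These points increase from [y0] and stay below [y0 + 1], so the interval [J] chosen below lies to
   the right of every [I i]. *)
pose beta i : R := y0 + 1 - i.+1%:R^-1.
have betaS i : beta i < beta i.+1.
  by rewrite /beta ltrD2l ltrN2 ltf_pV2 ?posrE// ltr_nat.
have beta0 i : y0 <= beta i.
  by rewrite /beta -addrA lerDl subr_ge0 invf_le1// ler1n.
have beta1 i : beta i <= y0 + 1 by rewrite /beta lerBlDr lerDl.
pose I i := `](beta i), (beta i.+1)]%classic.
have mI i : measurable (I i) by exact: measurable_itv.
pose mu i := pr P (U `&` V @^-1` (I i)).
pose nu i := pr P (E `&` (U `&` V @^-1` (I i))).
have mUV i : measurable (U `&` V @^-1` (I i)) by apply: measurableI => //; exact: mpre.
have mEUV i : measurable (E `&` (U `&` V @^-1` (I i))) by exact: measurableI.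
have nu0 i : 0 < nu i.
  have := Vevent_pos lam0 HB iu_gt0 iu_is (leqnn it) (leq_ltn_trans it_it' it'_lt)
    (le_trans y00 (beta0 i)) (betaS i).
  rewrite VUE => /lt_le_trans; apply; rewrite -lee_fin !prE//; last first.
    by apply: measurableI => //; apply: measurableI => //; apply: mpre;
      exact: measurable_itv.
  apply: le_measure; rewrite ?inE//.
    by apply: measurableI => //; apply: measurableI => //; apply: mpre;
      exact: measurable_itv.
  by move=> w [Ew [Uw]]; rewrite /= in_itv/= => /andP[h1 h2]; split; [exact: Ew|split;
    [exact: Uw|by rewrite /I /= in_itv/= h1 ltW]].
have numu i : nu i <= mu i.
  by rewrite -lee_fin !prE//; apply: le_measure; rewrite ?inE// => w [].
have mu0 i : 0 < mu i by exact: lt_le_trans (numu i).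
pose rho i := nu i / mu i.
have rho0 i : 0 <= rho i by rewrite divr_ge0// ltW.
have domi i (x y : R) : beta i.+1 <= x -> 
    pr P (E `&` V @^-1` `]x, y]) <= th * rho i * pr P (V @^-1` `]x, y]).
  move=> bx; have := comp (beta i) (beta i.+1) x y (beta0 i) bx (betaS i).
  rewrite VJ VI VT VUE -/(mu i) -/(nu i) => h.
  rewrite /th /rho -(ler_pM2l K0) -(ler_pM2r (mu0 i)).
  rewrite (_ : Kc * (Lc / Kc * (nu i / mu i) * _) * _ = Lc * (pr P (V @^-1` `]x, y])
    * nu i)).
    by rewrite -mulrA.
  by field; rewrite !gt_eqF.
(* By [domi] the constant [th * rho i] dominates on every interval beyond [beta i.+1];
   [cond_prob_ratio] transfers this bound to the mass on [U] over the next interval. *)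
have rec i : rho i.+1 <= th * rho i.
  rewrite ler_pdivrMr// -lee_fin EFinM !prE//.
  apply: (@cond_prob_ratio R d T P V Y E U (beta i.+1)) => //; first exact: mulr_ge0.
    move=> x y bx xy.
    have mVxy : measurable (V @^-1` `]x, y]) by apply: mpre; exact: measurable_itv.
    by have := domi i x y bx; rewrite -lee_fin EFinM !prE//; exact: measurableI.
  by move=> x; rewrite /I /= !in_itv/= andbT => /andP[].
have rhoX i : rho i <= th ^+ i.
  elim: i => [|i IH]; first by rewrite expr0 ler_pdivrMr// mul1r.
  by rewrite exprS; apply: le_trans (rec i) _; exact: ler_wpM2l.
pose J := `](y0 + 1), (y0 + 2)]%classic.
have mJ : measurable (V @^-1` J) by apply: mpre; exact: measurable_itv.
have nuJ i : pr P (E `&` V @^-1` J) <= th ^+ i.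
  apply: (le_trans (domi i _ (y0 + 2) (beta1 i.+1))).
  apply: (@le_trans _ _ (th * rho i)).
    have pJ : pr P (V @^-1` J) <= 1 by rewrite -lee_fin prE//; exact: probability_le1.
    by rewrite ler_piMr// mulr_ge0.
  by apply: le_trans (rhoX i); rewrite ler_piMl// ltW.
have nuJ0 : 0 < pr P (E `&` V @^-1` J).
  have y12 : y0 + 1 < y0 + 2 by rewrite ltrD2l ltr1n.
  have := Vevent_pos lam0 HB iu_gt0 iu_is (leqnn it) (leq_ltn_trans it_it' it'_lt)
    (addr_ge0 y00 ler01) y12.
  rewrite VUE => /lt_le_trans; apply; rewrite -lee_fin !prE//; last 2 first.
  - exact: measurableI.
  - by apply: measurableI => //; apply: measurableI => //; apply: mpre;
    exact: measurable_itv.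
  apply: le_measure; rewrite ?inE//; last 1 first.
  - move=> w [Ew [Uw]]; rewrite /= in_itv/= => /andP[h1 h2]; split => //.
    by rewrite /J /= in_itv/= h1 ltW.
  - by apply: measurableI => //; apply: measurableI => //; apply: mpre;
    exact: measurable_itv.
  - exact: measurableI.
have thn : `|th| < 1 by rewrite ger0_norm.
have /cvgrPdist_lt/(_ _ nuJ0)[n _ /(_ n (leqnn n))/=] := cvg_geometric 1 thn.
by rewrite mul1r sub0r normrN ger0_norm ?exprn_ge0// ltNge nuJ.
Qed.
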